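(* Let $f:\Omega\times\mathbb R\to\mathbb R$ satisfy the structural assumption (A) stated in the context. (1) Let $z_1,z_2\in\mathbb H^{-s}(\Omega)$ and let $u_1,u_2\in\mathbb H^s(\Omega)$ be the corresponding weak solutions of $(L_D)^su_i+f(x,u_i)=z_i$ in $\Omega$. Then there is a constant $C=C(N,s,\Omega)>0$ such that $$\|u_1-u_2\|_{L^2(\Omega)}\le C\|u_1-u_2\|_{\mathbb H^s(\Omega)}\le C\|z_1-z_2\|_{\mathbb H^{-s}(\Omega)} .$$ (2) Let $p>\frac N{2s}$ if $N>2s$, $p>1$ if $N=2s$, $p=1$ if $N<2s$. Assume in addition that $f$ satisfies the growth condition: there exists $c\in(0,1]$ such that $c|f(x,\xi-\eta)|\le|f(x,\xi)-f(x,\eta)|$ for a.e. $x\in\Omega$ and all $\xi,\eta\in\mathbb R$. Let $u_1,u_2\in\mathbb H^s(\Omega)\cap L^\infty(\Omega)$ be the weak solutions with right-hand sides $z_1,z_2\in L^p(\Omega)$, respectively. Then there is a constant $C=C(N,p,s,\Omega)>0$ such that $$\|u_1-u_2\|_{L^\infty(\Omega)}+\|u_1-u_2\|_{\mathbb H^s(\Omega)}\le C\|z_1-z_2\|_{L^p(\Omega)} .$$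
   Context: Setting. $N\ge 1$, $0<s<1$, and $\Omega\subset\mathbb R^N$ is an arbitrary bounded open set. The coefficients $a_{ij}\in L^\infty(\Omega)$ are real, measurable, symmetric ($a_{ij}=a_{ji}$ a.e.) and elliptic: there is $\gamma>0$ with $\sum_{i,j}a_{ij}(x)\xi_i\xi_j\ge\gamma|\xi|^2$ for all $\xi\in\mathbb R^N$ and a.e. $x\in\Omega$. $L_D$ is the positive self-adjoint operator on $L^2(\Omega)$ associated with the closed form $\mathcal E_D(u,v)=\sum_{i,j}\int_\Omega a_{ij}D_iu\,D_jv\,dx$, $u,v\in H^1_0(\Omega)$. It has compact resolvent, eigenvalues $0<\lambda_1\le\lambda_2\le\cdots\to\infty$ and an orthonormal basis of eigenfunctions $(\varphi_n)$ of $L^2(\Omega)$. For $\theta\ge0$, $\mathbb H^\theta(\Omega)=\{u\in L^2(\Omega):\|u\|^2_{\mathbb H^\theta(\Omega)}:=\sum_n\lambda_n^\theta u_n^2<\infty\}$, with $u_n=\int_\Omega u\varphi_n\,dx$; $\mathbb H^{-s}(\Omega)$ is the dual of $\mathbb H^s(\Omega)$. Powers are defined spectrally, $(L_D)^{\alpha}u=\sum_n\lambda_n^{\alpha}u_n\varphi_n$, so $\|u\|_{\mathbb H^s(\Omega)}=\|(L_D)^{s/2}u\|_{L^2(\Omega)}$. The operator $L_D$ is fixed, and constants said to depend on $\Omega$ may also depend on $L_D$. Assumption (A) on $f$. For a.e. $x\in\Omega$: $f(x,\cdot)$ is odd, strictly increasing, continuous, $f(x,0)=0$, and $\lim_{t\to\infty}f(x,t)=\infty$;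 for all $t$, $f(\cdot,t)$ is measurable. Let $\widetilde f(x,\cdot)$ be the inverse of $f(x,\cdot)$, $F(x,t)=\int_0^{|t|}f(x,\tau)\,d\tau$, $\widetilde F(x,t)=\int_0^{|t|}\widetilde f(x,\tau)\,d\tau$. There are constants $c_1,c_2\in(0,1]$ independent of $x$ such that for a.e. $x\in\Omega$ and all $t\in\mathbb R$: $c_1tf(x,t)\le F(x,t)\le tf(x,t)$ and $c_2t\widetilde f(x,t)\le\widetilde F(x,t)\le t\widetilde f(x,t)$. Space and weak solutions. $\mathcal V_0=\{u\in\mathbb H^s(\Omega):F(\cdot,u(\cdot))\in L^1(\Omega)\}$. A weak solution of $(L_D)^su+f(x,u)=z$ is $u\in\mathcal V_0$ with $\int_\Omega(L_D)^{s/2}u\,(L_D)^{s/2}v\,dx+\int_\Omega f(x,u)v\,dx=\langle z,v\rangle$ for all $v\in\mathcal V_0$, where $\langle z,v\rangle$ is the $\mathbb H^{-s}$–$\mathbb H^s$ duality if $z\in\mathbb H^{-s}(\Omega)$, and equals $\int_\Omega zv\,dx$ for $z\in L^p(\Omega)$ with $p$ as in (2). Under (A) the weak solution exists and is unique. *)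

(* Defs.v *)
From HB Require Import structures.
From mathcomp Require Import all_boot all_order all_algebra.
From mathcomp Require Import all_classical all_reals all_analysis.

Set Implicit Arguments.
Unset Strict Implicit.
Unset Printing Implicit Defensive.
Import Order.TTheory GRing.Theory Num.Theory.
Import numFieldNormedType.Exports.
Local Open Scope classical_set_scope.
Local Open Scope ring_scope.

Definition measure_row_display : measure_display -> measure_display.
Proof. exact. Qed.

Section measurable_row.
Context {d : measure_display} {T : measurableType d}.
Variable n : nat.

Definition row_coord (i : 'I_n) (v : 'rV[T]_n) : T := v ord0 i.

Let row_set0 : g_sigma_preimage row_coord set0.
Proof. exact: sigma_algebra0. Qed.

Let row_setC A : g_sigma_preimage row_coord A ->
  g_sigma_preimage row_coord (~` A).
Proof. exact: sigma_algebraC. Qed.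

Let row_bigcup (F : (set 'rV[T]_n)^nat) :
  (forall i, g_sigma_preimage row_coord (F i)) ->
  g_sigma_preimage row_coord (\bigcup_i F i).
Proof. exact: sigma_algebra_bigcup. Qed.

HB.instance Definition _ := @isMeasurable.Build (measure_row_display d)
  'rV[T]_n (g_sigma_preimage row_coord) row_set0 row_setC row_bigcup.

End measurable_row.

Section measurable_row_lemmas.
Context d1 d2 (T1 : measurableType d1) (T2 : measurableType d2).

Lemma measurable_row_coord n (i : 'I_n) :
  measurable_fun [set: 'rV[T2]_n] (@row_coord _ T2 n i).
Proof.
move=> _ Y mY; rewrite setTI; apply: sub_sigma_algebra => /=.
rewrite -bigcup_seq/=; exists i => /=; first by rewrite mem_index_enum.
by exists Y => //; rewrite setTI.
Qed.

Lemma measurable_fun_row n (f : T1 -> 'rV[T2]_n) :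
  (forall i, measurable_fun [set: T1] (fun x => f x ord0 i)) ->
  measurable_fun [set: T1] f.
Proof.
move=> mf _ A mA; rewrite setTI.
have : preimage_set_system [set: T1] f (g_sigma_preimage (@row_coord _ T2 n))
    (f @^-1` A) by exists A => //; rewrite setTI.
rewrite -g_sigma_preimage_comp.
apply: smallest_sub => {A mA}; first exact: sigma_algebra_measurable.
rewrite -bigcup_seq; apply: bigcup_sub => i _ A [B mB <-].
exact: mf.
Qed.

End measurable_row_lemmas.

Section lebesgue_row.
Context {R : realType}.

Definition row_cons n (p : measurableTypeR R * 'rV[R]_n) : 'rV[R]_n.+1 :=
  \row_i oapp (p.2 ord0) p.1 (unlift ord0 i).

Lemma measurable_row_cons n : measurable_fun setT (@row_cons n).
Proof.
apply: measurable_fun_row => i; case: (unliftP ord0 i) => [j ->|->].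
  apply: (eq_measurable_fun (row_coord j \o snd)) => [[x v] _ /=|].
    by rewrite mxE liftK.
  by apply: measurableT_comp; [exact: measurable_row_coord|exact: measurable_snd].
apply: (eq_measurable_fun fst) => [[x v] _ /=|]; last exact: measurable_fst.
by rewrite mxE unlift_none.
Qed.

Definition row_uncons n (v : 'rV[R]_n.+1) : measurableTypeR R * 'rV[R]_n :=
  (v ord0 ord0, \row_j v ord0 (lift ord0 j)).

Lemma row_consK n : cancel (@row_cons n) (@row_uncons n).
Proof.
move=> [x v]; congr pair; first by rewrite mxE unlift_none.
by apply/rowP => j; rewrite !mxE liftK.
Qed.

Lemma row_unconsK n : cancel (@row_uncons n) (@row_cons n).
Proof.
move=> v; apply/rowP => i; rewrite mxE /=.
by case: unliftP => [j ->|->] //=; rewrite mxE.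
Qed.

Lemma measurable_row_uncons n : measurable_fun setT (@row_uncons n).
Proof.
apply/measurable_fun_pairP; split.
  exact: (@measurable_row_coord _ R n.+1 ord0).
apply: measurable_fun_row => j.
apply: (eq_measurable_fun (row_coord (lift ord0 j))) => [v _ /=|].
  by rewrite mxE.
exact: measurable_row_coord.
Qed.

Section lebesgue_step.
Variables (n : nat) (m : {sigma_finite_measure set 'rV[R]_n -> \bar R}).

Definition lebesgue_step : set 'rV[R]_n.+1 -> \bar R :=
  pushforward (lebesgue_measure \x m)%E (@row_cons n).

Let step0 : lebesgue_step set0 = 0%E.
Proof. by rewrite /lebesgue_step /pushforward preimage_set0 measure0. Qed.

Let step_ge0 A : (0 <= lebesgue_step A)%E.
Proof.
by rewrite /lebesgue_step /pushforward; apply: integral_ge0 => x _;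
  exact: measure_ge0.
Qed.

Let step_sigma_additive : semi_sigma_additive lebesgue_step.
Proof.
have mc : measurable_fun setT (@row_cons n) := @measurable_row_cons n.
move=> F mF tF mUF; rewrite /lebesgue_step /pushforward preimage_bigcup.
apply: measure_semi_sigma_additive.
- by move=> k; rewrite -[X in measurable X]setTI; exact: mc.
- apply/trivIsetP => /= i j _ _ ij; rewrite -preimage_setI.
  by move/trivIsetP : tF => /(_ _ _ _ _ ij) ->//; rewrite preimage_set0.
- by rewrite -preimage_bigcup -[X in measurable X]setTI; exact: mc.
Qed.

HB.instance Definition _ := isMeasure.Build _ _ _ lebesgue_step
  step0 step_ge0 step_sigma_additive.

Let step_sigma_finite : sigma_finite setT lebesgue_step.
Proof.
have /sigma_finiteP[F [TF ndF Foo]] := sigma_finiteT (@lebesgue_measure R).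
have /sigma_finiteP[G [TG ndG Goo]] := sigma_finiteT m.
exists (fun k => @row_uncons n @^-1` (F k `*` G k)) => [|k].
  apply/esym; rewrite -subTset => v _; case E : (row_uncons v) => [x w].
  have [k _ Fx] : (\bigcup_k F k) x by rewrite -TF.
  have [l _ Gw] : (\bigcup_k G k) w by rewrite -TG.
  exists (maxn k l) => //; rewrite /preimage /mkset E; split => /=.
    by move: x Fx {E}; exact/subsetPset/ndF/leq_maxl.
  by move: w Gw {E}; exact/subsetPset/ndG/leq_maxr.
have [mF Fk] := Foo k; have [mG Gk] := Goo k; split.
  rewrite -[X in measurable X]setTI; apply: measurable_row_uncons => //.
  exact: measurableX.
rewrite /lebesgue_step /pushforward -comp_preimage.
rewrite (_ : _ \o _ = id); last by apply/funext => p; exact: row_consK.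
by rewrite preimage_id product_measure1E// lte_mul_pinfty// ge0_fin_numE.
Qed.

HB.instance Definition _ := Measure_isSigmaFinite.Build _ _ _ lebesgue_step
  step_sigma_finite.

End lebesgue_step.

Fixpoint borel_lebesgue n : {sigma_finite_measure set 'rV[R]_n -> \bar R} :=
  match n with
  | 0 => \d_(0 : 'rV[R]_0)
  | k.+1 => lebesgue_step (borel_lebesgue k)
  end.

End lebesgue_row.

(* The sets measurable for borel_lebesgue are the Borel sets of R^n, generated
   by the coordinates; lebesgue_n is its completion, so that measurability and
   "almost everywhere" below are meant in the sense of Lebesgue. The carrier of
   lebesgue_space is convertible to 'rV[R]_n. *)
Definition lebesgue_space (R : realType) n :=
  caratheodory_type ((@borel_lebesgue R n)^*)%mu.

HB.instance Definition _ R n := Measurable.on (@lebesgue_space R n).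

Definition lebesgue_n (R : realType) n : set (lebesgue_space R n) -> \bar R :=
  @completed_measure_extension _ _ _ (@borel_lebesgue R n).

HB.instance Definition _ R n := Measure.on (@lebesgue_n R n).

HB.instance Definition _ R n := Measure_isSigmaFinite.Build _ _ _
  (@lebesgue_n R n)
  (completed_measure_extension_sigma_finite (sigma_finiteT (@borel_lebesgue R n))).

Section function_spaces.
Context {R : realType} {N : nat}.
Local Notation E := 'rV[R]_N.
Local Notation mu := (@lebesgue_n R N).
Implicit Types (Omega : set E) (u v w g : E -> R).

Definition Lmeasurable Omega u :=
  measurable_fun (Omega : set (lebesgue_space R N)) (u : lebesgue_space R N -> R).

Definition Lint Omega u : R := \int[mu]_(x in Omega) u x.

Definition Lpnorm Omega (p : \bar R) u : \bar R :=
  'N[mu]_p[EFin \o (u \_ Omega)]%E.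

Definition Lp Omega (p : \bar R) u :=
  Lmeasurable Omega u /\ (Lpnorm Omega p u < +oo)%E.

Definition L2 Omega u := Lp Omega 2%:E u.

Definition Linfty Omega u := Lp Omega +oo%E u.

Definition ae_in Omega (P : E -> Prop) := {ae mu, forall x, Omega x -> P x}.

Definition partial (i : 'I_N) (phi : E -> R) : E -> R :=
  'D_(delta_mx 0 i) phi.

(* All iterated partial derivatives exist and are continuous. *)
Definition smooth (phi : E -> R) := forall s : seq 'I_N,
  continuous (foldr partial phi s) /\
  forall (i : 'I_N) x, derivable (foldr partial phi s) x (delta_mx 0 i).

Definition test_function Omega (phi : E -> R) :=
  [/\ smooth phi, compact (closure [set x | phi x != 0]) &
      closure [set x | phi x != 0] `<=` Omega].

Definition is_weak_partial Omega (i : 'I_N) u g :=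
  L2 Omega g /\
  forall phi, test_function Omega phi ->
    Lint Omega (fun x => u x * partial i phi x) =
    - Lint Omega (fun x => g x * phi x).

(* A representative of the weak derivative D_i u in L^2, unique a.e. when it
   exists *)
Definition wpartial Omega (i : 'I_N) u : E -> R :=
  xget (cst 0) [set g | is_weak_partial Omega i u g].

Definition H1 Omega u :=
  L2 Omega u /\ forall i : 'I_N, exists g, is_weak_partial Omega i u g.

Definition H1norm Omega u : R :=
  Num.sqrt (Lint Omega (fun x => u x ^+ 2) +
            \sum_(i < N) Lint Omega (fun x => wpartial Omega i u x ^+ 2)).

Definition H10 Omega u :=
  H1 Omega u /\
  forall e : R, 0 < e ->
    exists2 phi, test_function Omega phi & H1norm Omega (u \- phi) < e.

End function_spaces.

Section operator.
Context {R : realType} {N : nat}.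
Local Notation E := 'rV[R]_N.
Variables (Omega : set E) (a : 'I_N -> 'I_N -> E -> R).

Definition elliptic_coefficients :=
  [/\ forall i j, Linfty Omega (a i j),
      forall i j, ae_in Omega (fun x => a i j x = a j i x) &
      exists2 gamma : R, 0 < gamma &
        ae_in Omega (fun x => forall xi : E,
          gamma * (\sum_(i < N) xi 0 i ^+ 2) <=
          \sum_(i < N) \sum_(j < N) a i j x * xi 0 i * xi 0 j)].

Definition energy (u v : E -> R) : R :=
  \sum_(i < N) \sum_(j < N)
    Lint Omega (fun x => a i j x * wpartial Omega i u x * wpartial Omega j v x).

(* The graph of the operator L_D associated with the form *)
Definition LD (u w : E -> R) :=
  [/\ H10 Omega u, L2 Omega w &
      forall v, H10 Omega v -> energy u v = Lint Omega (fun x => w x * v x)].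

(* The eigenvalues are numbered from 0. *)
Record eigenbasis (lam : nat -> R) (phi : nat -> E -> R) : Prop := Eigenbasis {
  eigenbasis_gt0 : forall n, 0 < lam n ;
  eigenbasis_le : forall n, lam n <= lam n.+1 ;
  eigenbasis_cvg : lam n @[n --> \oo] --> +oo ;
  eigenbasis_eigen : forall n, LD (phi n) (fun x => lam n * phi n x) ;
  eigenbasis_orthonormal : forall m n,
    Lint Omega (fun x => phi m x * phi n x) = (m == n)%:R ;
  eigenbasis_complete : forall u, L2 Omega u ->
    Lpnorm Omega 2%:E (fun x =>
      u x - \sum_(k < n) Lint Omega (fun y => u y * phi k y) * phi k x)
    @[n --> \oo] --> 0%E }.

End operator.

Section spectral.
Context {R : realType} {N : nat}.
Local Notation E := 'rV[R]_N.
Variables (Omega : set E) (lam : nat -> R) (phi : nat -> E -> R).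

Definition coef (u : E -> R) n : R := Lint Omega (fun x => u x * phi n x).

Definition Hsqnorm (theta : R) (u : E -> R) : \bar R :=
  (\sum_(0 <= n <oo) (lam n `^ theta * coef u n ^+ 2)%:E)%E.

Definition Hspace (theta : R) (u : E -> R) :=
  L2 Omega u /\ (Hsqnorm theta u < +oo)%E.

Definition Hnorm (theta : R) (u : E -> R) : R :=
  Num.sqrt (fine (Hsqnorm theta u)).

(* A representative of (L_D)^alpha u, the L^2 sum of its eigenfunction
   expansion *)
Definition LDpow (alpha : R) (u : E -> R) : E -> R :=
  xget (cst 0) [set w | L2 Omega w /\
    Lpnorm Omega 2%:E (fun x =>
      w x - \sum_(k < n) lam k `^ alpha * coef u k * phi k x)
    @[n --> \oo] --> 0%E].

(* z is in the dual H^{-theta} of H^theta. Linearity and boundedness force z to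
   take the same value on functions that are equal a.e. *)
Definition Hdual (theta : R) (z : (E -> R) -> R) :=
  (forall (c : R) v w, Hspace theta v -> Hspace theta w ->
     z (fun x => c * v x + w x) = c * z v + z w) /\
  exists M : R, forall v, Hspace theta v -> `|z v| <= M * Hnorm theta v.

Definition Hdualnorm (theta : R) (z : (E -> R) -> R) : R :=
  sup [set `|z v| | v in [set v | Hspace theta v /\ Hnorm theta v <= 1]].

End spectral.

Section nonlinearity.
Context {R : realType} {N : nat}.
Local Notation E := 'rV[R]_N.
Variable f : E -> R -> R.

Definition primitive (h : E -> R -> R) (x : E) (t : R) : R :=
  \int[lebesgue_measure]_(tau in `[0, `|t|]) h x tau.

(* f(x, .) is a bijection of R for a.e. x under the assumption below *)
Definition finverse (x : E) (y : R) : R := xget 0 [set t | f x t = y].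

Definition assumptionA (Omega : set E) :=
  [/\ ae_in Omega (fun x =>
        [/\ forall t, f x (- t) = - f x t,
            {homo f x : t t' / t < t'},
            continuous (f x),
            f x 0 = 0 &
            f x t @[t --> +oo] --> +oo]),
      forall t, Lmeasurable Omega (f ^~ t) &
      exists c1 c2 : R, [/\ 0 < c1 <= 1, 0 < c2 <= 1 &
        ae_in Omega (fun x => forall t,
          c1 * (t * f x t) <= primitive f x t <= t * f x t /\
          c2 * (t * finverse x t) <= primitive finverse x t
            <= t * finverse x t)]].

Definition growth (Omega : set E) :=
  exists2 c : R, 0 < c <= 1 &
    ae_in Omega (fun x => forall xi eta,
      c * `|f x (xi - eta)| <= `|f x xi - f x eta|).

Variables (Omega : set E) (lam : nat -> R) (phi : nat -> E -> R) (s : R).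

Definition V0 (u : E -> R) :=
  Hspace Omega lam phi s u /\
  (@lebesgue_n R N).-integrable Omega
    (fun x => (primitive f x (u x))%:E).

(* Weak solution of (L_D)^s u + f(x, u) = z, where z is a functional on V0 *)
Definition weak_solution (z : (E -> R) -> R) (u : E -> R) :=
  V0 u /\
  forall v, V0 v ->
    Lint Omega (fun x => LDpow Omega lam phi (s / 2) u x *
                         LDpow Omega lam phi (s / 2) v x) +
    Lint Omega (fun x => f x (u x) * v x) = z v.

End nonlinearity.

Definition admissible_exponent {R : realType} (N : nat) (s : R) (p : \bar R) :=
  [/\ 2 * s < N%:R -> ((N%:R / (2 * s))%:E < p)%E,
      N%:R = 2 * s -> (1 < p)%E &
      N%:R < 2 * s -> p = 1%E].

(* Main.v *)
(* Let E_s(u) = \sum_n lam_n^s u_n^2. Since t^s is a superposition of the resolvent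
   weights t / (t + m), and \sum_n lam_n / (lam_n + m) u_n^2 is the infimum of
   |u - psi|^2 + E(psi) / m over test functions psi, the contraction property of
   the local form E under truncations passes to E_s. Averaging (psi x - psi y)^2
   over cubes of side r bounds |psi|^2 by r^2 |D psi|^2 plus the L^1 term of Nash's
   inequality; together with the same infimum this gives a fractional Nash
   inequality, hence |w|^2 <= C |A|^(2s/N) E_s(w) for w vanishing outside A.
   By monotonicity of f, testing the equations for u1 and u2 with the truncations
   w_k of w = u1 - u2 at level k yields E_s(w_k) <= 2 <z1 - z2, w_k>: here k = 0 is
   the first estimate, and a Stampacchia iteration over k bounds w in L^oo. The
   pairing is at most |w|_oo |z1 - z2|_p |{|w| > k}|^(1 - 1/p), so the iteration
   gives |w|_oo^2 <= C |w|_oo |z1 - z2|_p. *)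

Require Import Defs.
From HB Require Import structures.
From mathcomp Require Import all_boot all_order all_algebra.
From mathcomp Require Import all_classical all_reals all_analysis.
From mathcomp Require Import measurable_realfun ess_sup_inf.
From mathcomp Require Import ring lra.

Set Implicit Arguments.
Unset Strict Implicit.
Unset Printing Implicit Defensive.
Import Order.TTheory GRing.Theory Num.Theory.
Import numFieldNormedType.Exports.
Local Open Scope classical_set_scope.
Local Open Scope ring_scope.

(** * Square-integrable functions and orthonormal systems *)

(** Weak derivatives are available only through chosen representatives, and truncations are merely
    Lipschitz. The local form is therefore compared under truncation on test functions alone: the
    absolute values in the truncation are smoothed to [sqrt(a^2 + e^2)], which keeps its derivative
    bounded by 1, and the passage to general functions takes place inside the infimum, where
    approximate minimizers suffice. They are explicit in eigenfunction coefficients, because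
    [t / (t + m)] is the minimum over y of [(1 - y)^2 + (t / m) y^2]. Taken at [m = r^-2], the same
    infimum has exactly the scaling of the averages over cubes of side r. In the iteration the
    pairing with [w_k] is estimated by the sup norm of w times an L^1 norm on the level set. The
    measures of the level sets then carry the exponent [2s/N + 1 - 1/p], and the conditions on p
    make it exceed 1. The sup norm M of w reappears on the right; it is finite since u1 and u2 are
    bounded, and since the threshold d enters squared, a condition of the form [L M <= d^2] turns
    into [M <= L]. *)

Section square_integrable.
Context d (T : measurableType d) (R : realType).
Variables (mu : {measure set T -> \bar R}) (D : set T) (mD : measurable D).
Implicit Types u v w : T -> R.

Definition sqint u := measurable_fun D u /\
  mu.-integrable D (fun x => (u x ^+ 2)%:E).

Definition inner u v : R := \int[mu]_(x in D) (u x * v x).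

Lemma integrable_le u v : measurable_fun D u ->
  (forall x, D x -> `|u x| <= v x) -> mu.-integrable D (fun x => (v x)%:E) ->
  mu.-integrable D (fun x => (u x)%:E).
Proof.
move=> mu_ uv iv; apply: (le_integrable mD _ _ iv).
  exact/measurable_EFinP.
move=> x Dx /=; rewrite lee_fin (le_trans (uv x Dx))//.
by rewrite ler_norm.
Qed.

Lemma EFin_integrableZ (a : R) u : mu.-integrable D (fun x => (u x)%:E) ->
  mu.-integrable D (fun x => (a * u x)%:E).
Proof. by move=> iu; have := integrableZl mD a iu; apply: eq_integrable. Qed.

Lemma EFin_integrableD u v : mu.-integrable D (fun x => (u x)%:E) ->
  mu.-integrable D (fun x => (v x)%:E) ->
  mu.-integrable D (fun x => (u x + v x)%:E).
Proof. by move=> iu iv; have := integrableD mD iu iv; apply: eq_integrable. Qed.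

Lemma sqint_mul u v : sqint u -> sqint v ->
  mu.-integrable D (fun x => (u x * v x)%:E).
Proof.
move=> [mu1 iu] [mv iv].
apply: (@integrable_le _ (fun x => u x ^+ 2 + v x ^+ 2)).
- exact: measurable_funM.
- move=> x _; rewrite normrM -(real_normK (num_real (u x))).
  rewrite -(real_normK (num_real (v x))).
  have := sqr_ge0 (`|u x| - `|v x|).
  have := normr_ge0 (u x); have := normr_ge0 (v x); nra.
- have := integrableD mD iu iv; apply: eq_integrable => // x _.
Qed.

Lemma sqint_lin (a b : R) u v : sqint u -> sqint v ->
  sqint (fun x => a * u x + b * v x).
Proof.
move=> [mu1 iu] [mv iv]; have iuv := sqint_mul (conj mu1 iu) (conj mv iv).
split; first by apply: measurable_funD; apply: measurable_funM => //.
have i1 := integrableZl mD (a ^+ 2) iu.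
have i2 := integrableZl mD (b ^+ 2) iv.
have i3 := integrableZl mD (2 * a * b) iuv.
have := integrableD mD (integrableD mD i1 i2) i3.
apply: eq_integrable => // x _ /=; rewrite -!EFinM -!EFinD; congr EFin; ring.
Qed.

Lemma sqint0 : sqint (fun=> 0).
Proof.
split; first exact: measurable_cst.
by apply: eq_integrable (integrable0 mu D) => // x _ /=; rewrite expr0n.
Qed.

Lemma eq_sqint u v : {in D, u =1 v} -> sqint u -> sqint v.
Proof.
move=> uv [mu1 iu]; split; first exact: eq_measurable_fun mu1.
by apply: eq_integrable iu => // x xD /=; rewrite uv.
Qed.

Lemma sqintZ (a : R) u : sqint u -> sqint (fun x => a * u x).
Proof.
move=> su; have := sqint_lin a 0 su sqint0.
by apply: eq_sqint => x _; rewrite mulr0 addr0.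
Qed.

Lemma sqintD u v : sqint u -> sqint v -> sqint (fun x => u x + v x).
Proof.
move=> su sv; have := sqint_lin 1 1 su sv.
by apply: eq_sqint => x _; rewrite !mul1r.
Qed.

Lemma sqintB u v : sqint u -> sqint v -> sqint (fun x => u x - v x).
Proof.
move=> su sv; have := sqint_lin 1 (-1) su sv.
by apply: eq_sqint => x _; rewrite mul1r mulN1r.
Qed.

Lemma sqint_sum (I : Type) (r : seq I) (c : I -> R) (F : I -> T -> R) :
  (forall i, sqint (F i)) -> sqint (fun x => \sum_(i <- r) c i * F i x).
Proof.
move=> sF; elim: r => [|i r IH].
  by have := sqint0; apply: eq_sqint => x _; rewrite big_nil.
have := sqint_lin (c i) 1 (sF i) IH.
by apply: eq_sqint => x _; rewrite big_cons mul1r.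
Qed.

Lemma sqint_le u v : measurable_fun D u -> (forall x, D x -> `|u x| <= `|v x|) ->
  sqint v -> sqint u.
Proof.
move=> mu1 uv [mv iv]; split => //; apply: integrable_le iv.
  exact: measurable_funX.
move=> x Dx; rewrite normrX -(real_normK (num_real (v x))).
by rewrite ler_pXn2r// ?nnegrE ?normr_ge0 ?uv.
Qed.

Lemma innerC u v : inner u v = inner v u.
Proof. by apply: eq_Rintegral => x _; rewrite mulrC. Qed.

Lemma eq_inner u u' v v' : {in D, u =1 u'} -> {in D, v =1 v'} ->
  inner u v = inner u' v'.
Proof. by move=> uu' vv'; apply: eq_Rintegral => x xD; rewrite uu'// vv'. Qed.

Lemma inner_linl (a b : R) u v w : sqint u -> sqint v -> sqint w ->
  inner (fun x => a * u x + b * v x) w = a * inner u w + b * inner v w.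
Proof.
move=> su sv sw; have iu := sqint_mul su sw; have iv := sqint_mul sv sw.
rewrite /inner -!RintegralZl// -RintegralD//=; [|exact: EFin_integrableZ..].
by apply: eq_Rintegral => x _; ring.
Qed.

Lemma inner_linr (a b : R) u v w : sqint u -> sqint v -> sqint w ->
  inner w (fun x => a * u x + b * v x) = a * inner w u + b * inner w v.
Proof. by move=> su sv sw; rewrite innerC inner_linl// ![inner w _]innerC. Qed.

Lemma innerDl u v w : sqint u -> sqint v -> sqint w ->
  inner (fun x => u x + v x) w = inner u w + inner v w.
Proof.
move=> su sv sw; have := inner_linl 1 1 su sv sw; rewrite !mul1r => <-.
by apply: eq_inner => x _ //; rewrite !mul1r.
Qed.

Lemma innerBl u v w : sqint u -> sqint v -> sqint w ->
  inner (fun x => u x - v x) w = inner u w - inner v w.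
Proof.
move=> su sv sw; have := inner_linl 1 (-1) su sv sw; rewrite mul1r mulN1r => <-.
by apply: eq_inner => x _ //; rewrite mul1r mulN1r.
Qed.

Lemma innerBr u v w : sqint u -> sqint v -> sqint w ->
  inner w (fun x => u x - v x) = inner w u - inner w v.
Proof. by move=> su sv sw; rewrite innerC innerBl// ![inner w _]innerC. Qed.

Lemma innerZl (a : R) u w : sqint u -> sqint w ->
  inner (fun x => a * u x) w = a * inner u w.
Proof.
move=> su sw; rewrite -[RHS]addr0 -(mul0r (inner (fun=> 0) w)) -(inner_linl a 0 su sqint0 sw).
by apply: eq_inner => x _ //; rewrite mulr0 addr0.
Qed.

Lemma inner_suml (I : Type) (r : seq I) (c : I -> R) (F : I -> T -> R) w :
  (forall i, sqint (F i)) -> sqint w ->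
  inner (fun x => \sum_(i <- r) c i * F i x) w = \sum_(i <- r) c i * inner (F i) w.
Proof.
move=> sF sw; elim: r => [|i r IH].
  rewrite big_nil (_ : inner _ _ = inner (fun x => 0 * w x) w).
    by rewrite innerZl// mul0r.
  by apply: eq_inner => x _ //; rewrite big_nil mul0r.
rewrite big_cons -IH -[X in _ + X]mul1r -inner_linl//; last exact: sqint_sum.
by apply: eq_inner => x _ //; rewrite big_cons mul1r.
Qed.

Lemma inner_ge0 u : 0 <= inner u u.
Proof. by apply: Rintegral_ge0 => x _; rewrite -expr2 sqr_ge0. Qed.

Lemma inner_sqrB u v : sqint u -> sqint v ->
  inner (fun x => u x - v x) (fun x => u x - v x) =
  inner u u - 2 * inner u v + inner v v.
Proof.
move=> su sv; have sB := sqintB su sv.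
by rewrite innerBl// !innerBr// (innerC v u); ring.
Qed.

Lemma cauchy_schwarz u v : sqint u -> sqint v ->
  inner u v ^+ 2 <= inner u u * inner v v.
Proof.
move=> su sv; have [v0|v0] := eqVneq (inner v v) 0.
  rewrite v0 mulr0; case: (eqVneq (inner u v) 0) => [->|uv0].
    by rewrite expr0n.
  (* If [v] has norm 0 and yet pairs nontrivially with [u], this multiple of [v] gives the sum the
     square -1, a contradiction. *)
  have := inner_ge0 (fun x => 1 * u x + (- (inner u u + 1) / (2 * inner u v)) * v x).
  set c := (- _ / _); have suv := sqint_lin 1 c su sv.
  rewrite inner_linl// !inner_linr// v0 (innerC v u).
  have -> : 1 * (1 * inner u u + c * inner u v) +
     c * (1 * inner u v + c * 0) = -1 by rewrite /c; field.
  by rewrite ler0N1.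
have v1 : 0 < inner v v by rewrite lt_def v0 inner_ge0.
have := inner_ge0 (fun x => inner v v * u x + (- inner u v) * v x).
have suv := sqint_lin (inner v v) (- inner u v) su sv.
rewrite inner_linl// !inner_linr// (innerC v u).
have -> : inner v v * (inner v v * inner u u + - inner u v * inner u v) +
  - inner u v * (inner v v * inner u v + - inner u v * inner v v) =
  inner v v * (inner u u * inner v v - inner u v ^+ 2) by ring.
by rewrite pmulr_rge0// subr_ge0.
Qed.

(** Positivity of the square of [e u - v], divided by [e]. For small [e] the square of [u] is hardly
    enlarged, so a small error [v] can be split off without losing the sharp constant in front of
    [u]. *)
Lemma inner_sqrD_le u v (e : R) : 0 < e -> sqint u -> sqint v ->
  inner (fun x => u x + v x) (fun x => u x + v x) <=
  (1 + e) * inner u u + (1 + e^-1) * inner v v.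
Proof.
move=> e0 su sv; have sD := sqintD su sv.
have := inner_ge0 (fun x => e * u x + (-1) * v x).
have sl := sqint_lin e (-1) su sv.
rewrite inner_linl// !inner_linr//.
rewrite innerDl// !(innerC _ (fun x => u x + v x)) !innerDl// (innerC v u).
move=> h; rewrite -subr_ge0.
have -> : (1 + e) * inner u u + (1 + e^-1) * inner v v -
  (inner u u + inner u v + (inner u v + inner v v)) = e^-1 *
  (e * (e * inner u u + -1 * inner u v) + -1 * (e * inner u v + -1 * inner v v)).
  by field; rewrite gt_eqF.
by rewrite pmulr_rge0 ?invr_gt0.
Qed.

Lemma inner_integral u : sqint u ->
  (inner u u)%:E = (\int[mu]_(x in D) (u x ^+ 2)%:E)%E.
Proof.
move=> [mu1 iu]; rewrite /inner /Rintegral fineK.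
  by apply: eq_integral => x _; rewrite expr2.
rewrite (_ : (\int[mu]_(x in D) _)%E = (\int[mu]_(x in D) (u x ^+ 2)%:E)%E).
  exact: integrable_fin_num.
by apply: eq_integral => x _; rewrite expr2.
Qed.

End square_integrable.

(** * Completeness of the space of square-integrable functions *)

Section l2_complete.
Context d (T : measurableType d) (R : realType).
Variables (mu : {measure set T -> \bar R}) (D : set T) (mD : measurable D).
Local Notation sqint := (sqint mu D).
Local Notation inner := (inner mu D).

Lemma fatou_sqint (h : nat -> T -> R) (w : T -> R) (e : R) :
  (forall n, sqint (h n)) -> (forall x, D x -> h n x @[n --> \oo] --> w x) ->
  (\forall n \near \oo, inner (h n) (h n) <= e) ->
  sqint w /\ inner w w <= e.
Proof.
move=> sh hw he.
have mw : measurable_fun D w.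
  by apply: (measurable_fun_cvg (h := h)) => // n; case: (sh n).
have iw : (\int[mu]_(x in D) (w x ^+ 2)%:E <= e%:E)%E.
  have := @fatou _ _ _ mu D mD (fun n x => (h n x ^+ 2)%:E).
  set I := (X in X -> _ -> _); have hI : I.
    by move=> n; apply/measurable_EFinP/measurable_funX; case: (sh n).
  move=> /(_ hI) => {}hI.
  have h0 : forall n x, D x -> (0 <= (h n x ^+ 2)%:E :> \bar R)%E.
    by move=> n x _; rewrite lee_fin sqr_ge0.
  have := hI h0; rewrite (_ : \int[mu]_(x in D) _ = \int[mu]_(x in D) (w x ^+ 2)%:E)%E.
    move=> /le_trans; apply; rewrite limn_einf_lim.
    apply: lime_le; first exact: is_cvg_einfs.
    near=> n; apply: ereal_inf_le; exists (\int[mu]_(x in D) (h n x ^+ 2)%:E)%E.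
      by exists n => //=.
    rewrite -inner_integral// lee_fin; near: n; exact: he.
  apply: eq_integral => x; rewrite inE => Dx.
  have hc : (h n x ^+ 2)%:E @[n --> \oo] --> (w x ^+ 2)%:E.
    apply: cvg_EFin; first exact: nearW.
    rewrite expr2; under eq_fun do rewrite expr2.
    by apply: cvgM; exact: hw.
  by have [->] := cvg_limn_einf_sup hc.
have sw : sqint w.
  split => //; apply/integrableP; split.
    exact/measurable_EFinP/measurable_funX.
  rewrite (_ : integral _ _ _ = \int[mu]_(x in D) (w x ^+ 2)%:E)%E.
    by rewrite (le_lt_trans iw)// ltry.
  by apply: eq_integral => x _ /=; rewrite ger0_norm ?sqr_ge0.
by split => //; rewrite -lee_fin inner_integral.
Unshelve. all: by end_near. Qed.

(** The sum of [2^j del_j^2] over the increments [del_j] has integral at most the sum of [2^j 4^-j],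
    so it is finite almost everywhere. Where it is finite, [|del_j| <= 2^-j + 2^j del_j^2] makes the
    telescoping series absolutely convergent. The good points are returned as a measurable set, by
    whose indicator a limit can be cut off. *)
Lemma ae_cvg_fast (S : nat -> T -> R) : (forall n, sqint (S n)) ->
  (forall j, inner (fun x => S j.+1 x - S j x) (fun x => S j.+1 x - S j x)
     <= 4^-1 ^+ j) ->
  exists A, [/\ measurable A, A `<=` D, {ae mu, forall x, D x -> A x} &
    forall x, A x -> cvgn (fun j => S j x)].
Proof.
move=> sS hS; pose del x j := S j.+1 x - S j x.
pose g j x : \bar R := (2 ^+ j * del x j ^+ 2)%:E.
have sd j : sqint (del ^~ j) by apply: sqintB.
have g0 j x : (0 <= g j x)%E by rewrite lee_fin mulr_ge0 ?sqr_ge0 ?exprn_ge0.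
have mg j : measurable_fun D (g j).
  apply/measurable_EFinP/measurable_funM => //; apply: measurable_funX.
  by case: (sd j).
pose G x := (\sum_(j <oo) g j x)%E.
have G0 x : (0 <= G x)%E by apply: nneseries_ge0.
have mG : measurable_fun D G.
  exact: ge0_emeasurable_sum.
have iG : (\int[mu]_(x in D) G x <= 2%:E)%E.
  rewrite integral_nneseries//.
  have -> : 2%:E = (\sum_(j <oo) (2^-1 ^+ j)%:E)%E :> \bar R.
    apply/esym/cvg_lim => //.
    under eq_fun do rewrite sumEFin.
    apply: cvg_EFin; first exact: nearW.
    have := @cvg_geometric_series R 1 (2^-1).
    have -> : 1 * (1 - 2^-1)^-1 = 2 :> R by field.
    rewrite ger0_norm//= => /(_ _); rewrite invf_lt1// ltr1n => /(_ isT).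
    rewrite /series/=; under eq_fun do under eq_bigr do rewrite mul1r.
    by [].
  apply: lee_nneseries => [j _ _|j _].
    by apply: integral_ge0.
  rewrite (_ : integral _ _ _ = (2 ^+ j * inner (del ^~ j) (del ^~ j))%:E).
    rewrite lee_fin (le_trans (ler_wpM2l _ (hS j)))//.
    by rewrite -exprMn (_ : 2 * 4^-1 = 2^-1)//; field.
  rewrite EFinM inner_integral// -ge0_integralZl_EFin//.
  - by move=> x _; rewrite lee_fin sqr_ge0.
  - by apply/measurable_EFinP/measurable_funX; case: (sd j).
exists (D `&` [set x | G x \is a fin_num]); split.
- exact: emeasurable_fin_num.
- exact: subIsetl.
- have : mu.-integrable D G.
    apply/integrableP; split => //.
    rewrite (_ : integral _ _ _ = \int[mu]_(x in D) G x)%E.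
      by rewrite (le_lt_trans iG)// ltry.
    by apply: eq_integral => x _; rewrite gee0_abs ?G0.
  move=> /(integrable_ae mD); apply: filterS => x h Dx; split => //; exact: h.
- move=> x [Dx Gx].
  have cG : cvgn (series (fun j => 2 ^+ j * del x j ^+ 2)).
    apply: nnseries_is_cvg => [j|]; last by rewrite -ge0_fin_numE; [exact: Gx|exact: G0].
    by rewrite mulr_ge0 ?sqr_ge0 ?exprn_ge0.
  have c2 : cvgn (series (geometric 1 (2^-1 : R))).
    by apply: is_cvg_geometric_series; rewrite ger0_norm// invf_lt1// ltr1n.
  have cd : cvgn (series (del x)).
    apply: normed_cvg; apply: (@series_le_cvg _ _ (fun j =>
        geometric 1 (2^-1 : R) j + 2 ^+ j * del x j ^+ 2)) => /=.
    + by move=> j; rewrite normr_ge0.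
    + by move=> j; rewrite addr_ge0// ?mul1r ?exprn_ge0// mulr_ge0 ?sqr_ge0 ?exprn_ge0.
    + move=> j; rewrite mul1r exprVn -(real_normK (num_real (del x j))).
      have p0 : 0 < 2 ^+ j :> R by rewrite exprn_gt0.
      have := normr_ge0 (del x j); set a := `|del x j|; set p := 2 ^+ j in p0 * => a0.
      rewrite -(ler_pM2l p0) mulrDr divff ?gt_eqF//.
      have := sqr_ge0 (p * a - 1); have : 0 <= p * a by rewrite mulr_ge0// ltW.
      nra.
    + rewrite (_ : series _ = series (geometric 1 (2^-1)) +
        series (fun j => 2 ^+ j * del x j ^+ 2)); first exact: is_cvgD.
      by apply/funext => n; rewrite /series /= fctE big_split.
  have -> : (fun j => S j x) = (fun j => S 0%N x + series (del x) j).
    apply/funext => n; rewrite /series /= telescope_sumr//.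
    by rewrite addrCA subrr addr0.
  by apply: is_cvgD => //; exact: is_cvg_cst.
Qed.

Lemma l2_complete (S : nat -> T -> R) : (forall n, sqint (S n)) ->
  (forall e : R, 0 < e -> exists N, forall m n, (N <= m)%N -> (N <= n)%N ->
     inner (fun x => S m x - S n x) (fun x => S m x - S n x) <= e) ->
  exists2 w, sqint w &
    inner (fun x => w x - S n x) (fun x => w x - S n x) @[n --> \oo] --> 0.
Proof.
move=> sS cS.
have /choice[M hM] : forall j : nat, exists N, forall m n, (N <= m)%N -> (N <= n)%N ->
     inner (fun x => S m x - S n x) (fun x => S m x - S n x) <= 4^-1 ^+ j.
  by move=> j; apply: cS; rewrite exprn_gt0// invr_gt0.
(* The sum dominates each of [M 0], ..., [M j], so the subsequence meets every Cauchy threshold up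
   to the j-th. *)
pose N j := (\sum_(i < j.+1) M i)%N.
have MN i j : (i <= j)%N -> (M i <= N j)%N.
  by move=> ij; rewrite /N (bigD1 (Ordinal (ij : (i < j.+1)%N)))//= leq_addr.
have [A [mA AD aeA cA]] := ae_cvg_fast (fun n => sS (N n))
   (fun j => hM j _ _ (MN j j.+1 (leqnSn j)) (MN j j (leqnn j))).
pose w x := limn (fun j => S (N j) x * \1_A x).
have cw x : D x -> S (N j) x * \1_A x @[j --> \oo] --> w x.
  move=> Dx; rewrite /w /=; have [Ax|nAx] := pselect (A x).
    by apply: is_cvgMr_tmp; exact: cA.
  rewrite indicE memNset//; under eq_fun do rewrite mulr0; exact: is_cvg_cst.
have m1 : measurable_fun D (\1_A : T -> R) by exact: measurable_indic.
have mw : measurable_fun D w.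
  apply: (measurable_fun_cvg (h := fun j x => S (N j) x * \1_A x)) => // j.
  by apply: measurable_funM => //; case: (sS (N j)).
(* Fatou along the subsequence, with [m] fixed: this controls the distance to every late term of the
   full sequence, not only to those of the subsequence. *)
have key i m : (M i <= m)%N -> sqint (fun x => w x - S m x) /\
   inner (fun x => w x - S m x) (fun x => w x - S m x) <= 4^-1 ^+ i.
  move=> im; pose h j x := \1_A x * (S (N j) x - S m x).
  have sh j : sqint (h j).
    apply: (@sqint_le _ _ _ _ _ mD _ (fun x => S (N j) x - S m x)).
    - apply: measurable_funM => //; apply: measurable_funB.
        by case: (sS (N j)).
      by case: (sS m).
    - move=> x Dx; rewrite /h normrM ler_piMl// indicE.
      by case: (x \in A); rewrite ?normr1 ?normr0.
    - exact: sqintB.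
  have [| |sw' iw'] := @fatou_sqint h (fun x => \1_A x * (w x - S m x)) (4^-1 ^+ i) sh.
    move=> x Dx; have := cw x Dx; rewrite /h.
    have [Ax|nAx] := pselect (A x).
      rewrite indicE mem_set//; under eq_fun do rewrite mulr1; move=> hc.
      under eq_fun do rewrite mul1r; rewrite mul1r.
      by apply: cvgB => //; exact: cvg_cst.
    rewrite indicE memNset// => _; under eq_fun do rewrite mul0r.
    by rewrite mul0r; exact: cvg_cst.
    exists i => // j /= ij; rewrite -lee_fin inner_integral//.
    apply: (@le_trans _ _ (\int[mu]_(x in D) ((S (N j) x - S m x) ^+ 2)%:E)%E).
      apply: ge0_le_integral => //.
      - by move=> x _; rewrite lee_fin sqr_ge0.
      - by apply/measurable_EFinP/measurable_funX; case: (sh j).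
      - by apply/measurable_EFinP/measurable_funX; case: (sqintB mD (sS (N j)) (sS m)).
      - move=> y _; rewrite lee_fin /h exprMn ler_piMl ?sqr_ge0// indicE.
    rewrite -inner_integral ?lee_fin //; last exact: sqintB.
    by apply: hM => //; apply: MN.
  have mws : measurable_fun D (fun x => w x - S m x).
    by apply: measurable_funB => //; case: (sS m).
  have ei : (\int[mu]_(x in D) ((w x - S m x) ^+ 2)%:E =
    \int[mu]_(x in D) ((\1_A x * (w x - S m x)) ^+ 2)%:E)%E.
    apply: ge0_ae_eq_integral => //.
    - exact/measurable_EFinP/measurable_funX.
    - by apply/measurable_EFinP/measurable_funX; case: sw'.
    - by move=> x _; rewrite lee_fin sqr_ge0.
    - by move=> x _; rewrite lee_fin sqr_ge0.
    - by apply: filterS aeA => x Ah Dx; rewrite indicE mem_set ?mul1r//; exact: Ah.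
  have sws : sqint (fun x => w x - S m x).
    split => //; apply/integrableP; split.
      exact/measurable_EFinP/measurable_funX.
    rewrite (_ : integral _ _ _ = \int[mu]_(x in D) ((w x - S m x) ^+ 2)%:E)%E.
      by rewrite ei -inner_integral// ltry.
    by apply: eq_integral => x _ /=; rewrite ger0_norm ?sqr_ge0.
  by split => //; rewrite -lee_fin inner_integral// ei -inner_integral// lee_fin.
exists w.
  have [sw _] := key 0%N (M 0%N) (leqnn _).
  have := sqintD mD sw (sS (M 0%N)); apply: eq_sqint => // x _.
  by rewrite subrK.
apply/cvgrPdist_le => e e0.
have /cvgrPdist_le/(_ _ e0)[i _ hi] : (4^-1 : R) ^+ i @[i --> \oo] --> 0.
  by apply: cvg_expr; rewrite ger0_norm// invf_lt1// ltr1n.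
exists (M i) => // m /= im; rewrite sub0r normrN ger0_norm ?inner_ge0//.
have [_ /le_trans] := key i m im; apply.
by have := hi i (leqnn i); rewrite sub0r normrN ger0_norm// exprn_ge0.
Qed.

End l2_complete.

(** * Bessel, Riesz-Fischer and Parseval *)

Section orthonormal_system.
Context d (T : measurableType d) (R : realType).
Variables (mu : {measure set T -> \bar R}) (D : set T) (mD : measurable D).
Local Notation sqint := (sqint mu D).
Local Notation inner := (inner mu D).
Variable e : nat -> T -> R.
Hypotheses (se : forall n, sqint (e n))
  (oe : forall m n, inner (e m) (e n) = (m == n)%:R).
Implicit Types (u v w : T -> R) (c : nat -> R).

Definition span c n : T -> R := fun x => \sum_(k < n) c k * e k x.

Lemma sqint_span c n : sqint (span c n).
Proof. exact: (sqint_sum mD _ (fun k : 'I_n => c k) (fun k => se k)). Qed.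

Lemma inner_span u c n : sqint u ->
  inner u (span c n) = \sum_(k < n) c k * inner u (e k).
Proof.
move=> su; rewrite innerC.
rewrite (inner_suml mD _ (fun k : 'I_n => c k) (fun k : 'I_n => se k) su).
by apply: eq_bigr => k _; rewrite innerC.
Qed.

Lemma coef_span c n k : inner (span c n) (e k) = if (k < n)%N then c k else 0.
Proof.
rewrite innerC inner_span//; case: ltnP => [kn|nk].
  rewrite (bigD1 (Ordinal kn))//= oe eqxx mulr1 big1 ?addr0// => i ik.
  rewrite oe (_ : (k == i) = false) ?mulr0//; apply/eqP => ki.
  by move: ik; rewrite -val_eqE/= ki eqxx.
rewrite big1// => i _; rewrite oe (_ : (k == i) = false) ?mulr0//.
by apply/eqP => ki; have := ltn_ord i; rewrite -ki ltnNge nk.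
Qed.

Lemma inner_span2 c n : inner (span c n) (span c n) = \sum_(k < n) c k ^+ 2.
Proof.
rewrite inner_span; last exact: sqint_span.
by apply: eq_bigr => k _; rewrite coef_span ltn_ord expr2.
Qed.

(** Completing the square in each coefficient. Bessel's inequality, the identification of
    coefficients and the computation of near minimizers are all read off from this identity. *)
Lemma inner_sub_span u c n : sqint u ->
  inner (fun x => u x - span c n x) (fun x => u x - span c n x) =
  inner u u - \sum_(k < n) inner u (e k) ^+ 2 +
  \sum_(k < n) (inner u (e k) - c k) ^+ 2.
Proof.
move=> su; rewrite inner_sqrB//; last exact: sqint_span.
rewrite inner_span2 inner_span// -!addrA; congr (_ + _).
rewrite mulr_sumr -!sumrN -!big_split/=.
by apply: eq_bigr => k _; ring.
Qed.

Lemma bessel u n : sqint u -> \sum_(k < n) inner u (e k) ^+ 2 <= inner u u.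
Proof.
move=> su; rewrite -subr_ge0.
have := inner_ge0 mu D (fun x => u x - span (fun k => inner u (e k)) n x).
rewrite inner_sub_span// [X in _ + X]big1 ?addr0// => k _.
by rewrite subrr expr0n.
Qed.

(** For [n > k] the k-th square in [inner_sub_span] is bounded by the whole error, the rest being
    nonnegative by Bessel, and the error tends to 0. *)
Lemma coef_limit w c k : sqint w ->
  inner (fun x => w x - span c n x) (fun x => w x - span c n x) @[n --> \oo] --> 0 ->
  inner w (e k) = c k.
Proof.
move=> sw h; apply/eqP; rewrite -subr_eq0 -sqrf_eq0; apply/eqP/le_anti.
rewrite sqr_ge0 andbT; move/cvg_lim : (h) => <-//.
apply: limr_ge; first by apply/cvg_ex; exists 0.
exists k.+1 => // n /= kn; rewrite inner_sub_span//.
have := bessel n sw; rewrite -subr_ge0 => /ler_wpDl; apply.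
rewrite (bigD1 (Ordinal kn))//= lerDl sumr_ge0// => i _; exact: sqr_ge0.
Qed.

Lemma riesz_fischer c : (\sum_(0 <= k <oo) (c k ^+ 2)%:E < +oo)%E ->
  exists2 w, sqint w &
  inner (fun x => w x - span c n x) (fun x => w x - span c n x) @[n --> \oo] --> 0.
Proof.
move=> cfin; apply: l2_complete => // [n|e0 e0_gt0]; first exact: sqint_span.
have /cvg_ex[l /cvgrPdist_le cs] : cvgn (series (fun k => c k ^+ 2)).
  by apply: nnseries_is_cvg => // i; exact: sqr_ge0.
have key m n : (n <= m)%N -> inner (fun x => span c m x - span c n x)
   (fun x => span c m x - span c n x) =
   series (fun k => c k ^+ 2) m - series (fun k => c k ^+ 2) n.
  move=> nm; rewrite inner_sub_span; last exact: sqint_span.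
  rewrite inner_span2 /series/= !big_mkord [X in _ + X = _]big1 ?addr0.
    congr (_ - _); apply: eq_bigr => k _.
    by rewrite coef_span (leq_trans (ltn_ord k) nm).
  by move=> k _; rewrite coef_span (leq_trans (ltn_ord k) nm) subrr expr0n.
have e2 : 0 < e0 / 2 by rewrite divr_gt0.
have [M _ hM] := cs _ e2; exists M => m n Mm Mn.
wlog nm : m n Mm Mn / (n <= m)%N.
  move=> h; have [nm|/ltnW nm] := leqP n m; first exact: h.
  rewrite (_ : inner _ _ = inner (fun x => span c n x - span c m x)
    (fun x => span c n x - span c m x)); first exact: h.
  by apply: eq_Rintegral => x _; ring.
rewrite key//; have := hM _ Mm; have := hM _ Mn => /=.
rewrite !ler_norml => /andP[h1 h2] /andP[h3 h4]; lra.
Qed.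

Section complete.
Hypothesis ce : forall u, sqint u ->
  inner (fun x => u x - span (fun k => inner u (e k)) n x)
        (fun x => u x - span (fun k => inner u (e k)) n x) @[n --> \oo] --> 0.

Lemma parseval_cvg u : sqint u ->
  \sum_(k < n) inner u (e k) ^+ 2 @[n --> \oo] --> inner u u.
Proof.
move=> su; have := ce su; move=> /cvgrPdist_le h; apply/cvgrPdist_le => e0 e00.
apply: filterS (h _ e00) => n /=; rewrite sub0r normrN inner_sub_span//.
by rewrite [X in _ + X]big1 ?addr0// => k _; rewrite subrr expr0n.
Qed.

Lemma parseval u : sqint u ->
  (\sum_(0 <= k <oo) (inner u (e k) ^+ 2)%:E)%E = (inner u u)%:E.
Proof.
move=> su; apply/cvg_lim => //; under eq_fun do rewrite sumEFin big_mkord.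
by apply: cvg_EFin; [exact: nearW|exact: parseval_cvg].
Qed.

Lemma coef_eq0 u : sqint u -> (forall k, inner u (e k) = 0) -> inner u u = 0.
Proof.
move=> su u0; have := parseval_cvg su.
under eq_fun do under eq_bigr do rewrite u0 expr0n.
under eq_fun do rewrite big1//.
by move=> /cvg_lim <- //; rewrite lim_cst.
Qed.

End complete.
End orthonormal_system.

(** * Powers as superpositions of resolvent weights *)

Section geometric_interpolation.
Variable R : realType.
Implicit Types (x y lam : nat -> R) (s q t mu : R).

(** The multiplier of [L (L + mu)^-1]. It equals the minimum over y of [(1 - y)^2 + (t / mu) y^2],
    attained at [y = mu / (t + mu)]. *)
Definition resolvent_weight mu t := t / (t + mu).

Local Notation rw := resolvent_weight.

Lemma rw_ge0 mu t : 0 <= mu -> 0 <= t -> 0 <= rw mu t.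
Proof. by move=> m0 t0; rewrite /rw divr_ge0// addr_ge0. Qed.

Lemma rw_le1 mu t : 0 <= mu -> 0 < t -> rw mu t <= 1.
Proof. by move=> m0 t0; rewrite /rw ler_pdivrMr ?mul1r ?lerDl// ltr_wpDr. Qed.

Lemma rw_le mu t u : 0 <= mu -> 0 < t -> t <= u -> rw mu t <= rw mu u.
Proof.
move=> m0 t0 tu; have u0 := lt_le_trans t0 tu.
rewrite /rw ler_pdivrMr ?ltr_wpDr// mulrAC ler_pdivlMr ?ltr_wpDr//.
by rewrite !mulrDr mulrC lerD2l// [leRHS]mulrC [leLHS]mulrC ler_wpM2l.
Qed.

Lemma rwM mu t a : 0 < a -> rw (a * mu) (a * t) = rw mu t.
Proof. by move=> a0; rewrite /rw -mulrDr -mulf_div divff ?mul1r// gt_eqF. Qed.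

Lemma rw_leM mu t a : 0 <= mu -> 0 < t -> 1 <= a -> rw mu (a * t) <= a * rw mu t.
Proof.
move=> m0 t0 a1; have a0 : 0 < a by apply: lt_le_trans a1.
rewrite /rw -mulrA ler_wpM2l ?(ltW a0)// ler_pM2l//.
by rewrite lef_pV2 ?posrE ?ltr_wpDr ?mulr_gt0// lerD2r ler_peMl// ltW.
Qed.

Lemma pow1R t : 1 `^ t = 1 :> R.
Proof. by rewrite powR1. Qed.

Section scale.
Variables (q s : R) (q1 : 1 < q) (s01 : 0 < s < 1).

Let p := q `^ s.
Let q0 : 0 < q. Proof. by rewrite (lt_trans _ q1). Qed.
Let p1 : 1 < p.
Proof.
by case/andP: s01 => s0 _; rewrite /p -(pow1R s) gt0_ltr_powR// nnegrE// ltW.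
Qed.
Let p0 : 0 < p. Proof. by rewrite (lt_trans _ p1). Qed.
Let pq : p < q.
Proof.
case/andP: s01 => s0 s1; rewrite -[ltRHS]powRr1 ?(ltW q0)// -(subrK s 1).
rewrite powRD; last by rewrite (gt_eqF q0) implybT.
rewrite -/p ltr_pMl// -[ltLHS](pow1R (1 - s)).
by rewrite gt0_ltr_powR ?subr_gt0// nnegrE// ltW.
Qed.

(* geo t = \sum_(j in Z) q^(s j) t / (t + q^j) satisfies geo (q t) = q^s geo t and
   is monotone, hence equals geo 1 * t^s up to factors that tend to 1 with q. *)
Definition upper t : \bar R := (\sum_(0 <= j <oo) (p ^+ j * rw (q ^+ j) t)%:E)%E.
(** The exponents -1, -2, ...; exponent 0 belongs to [upper]. *)
Definition lower t : \bar R :=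
  (\sum_(0 <= j <oo) (p ^- j.+1 * rw (q ^- j.+1) t)%:E)%E.
Definition geo t := (upper t + lower t)%E.

Let u0 t j : 0 < t -> (0 <= (p ^+ j * rw (q ^+ j) t)%:E :> \bar R)%E.
Proof.
move=> t0; rewrite lee_fin mulr_ge0 ?exprn_ge0 ?(ltW p0)//.
by rewrite rw_ge0 ?exprn_ge0 ?(ltW q0) ?(ltW t0).
Qed.

Let l0 t j : 0 < t -> (0 <= (p ^- j.+1 * rw (q ^- j.+1) t)%:E :> \bar R)%E.
Proof.
move=> t0; rewrite lee_fin mulr_ge0 ?invr_ge0 ?exprn_ge0 ?(ltW p0)//.
by rewrite rw_ge0 ?invr_ge0 ?exprn_ge0 ?(ltW q0) ?(ltW t0).
Qed.

Lemma geo_ge0 t : 0 < t -> (0 <= geo t)%E.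
Proof.
by move=> t0; rewrite adde_ge0//; apply: nneseries_ge0 => j _ _; rewrite ?u0 ?l0.
Qed.

(** Scaling by [q] shifts the summation index by one. The only term that crosses between the two
    halves is exponent 0 of [upper] at [q t], which is [p] times the first term of [lower] at
    [t]. *)
Lemma geoM t : 0 < t -> geo (q * t) = (p%:E * geo t)%E.
Proof.
move=> t0; have qt0 : 0 < q * t by rewrite mulr_gt0.
rewrite /geo muleDr ?ge0_adde_def ?inE ?nneseries_ge0//; [|by move=> j _ _; rewrite ?u0 ?l0..].
rewrite /upper nneseries_recl//; last by move=> j _; rewrite u0.
rewrite /lower -!nneseriesZl; [|by move=> j _; rewrite ?u0 ?l0..].
rewrite [X in _ = (_ + X)%E]nneseries_recl//; last first.
  by move=> j _; rewrite -EFinM lee_fin mulr_ge0 ?(ltW p0)// -lee_fin l0.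
rewrite -addeA addeCA; congr (_ + _)%E.
  rewrite -nneseries_addn; last by move=> j; rewrite u0.
  apply: eq_eseriesr => j _; rewrite -EFinM addn1; congr EFin.
  by rewrite !exprS rwM// -mulrA.
have -> : (p ^+ 0 * rw (q ^+ 0) (q * t))%:E = (p%:E * (p ^- 1 * rw (q ^- 1) t)%:E)%E.
  rewrite !expr0 mul1r -EFinM; congr EFin.
  by rewrite !expr1 mulVKf ?gt_eqF// -(rwM q^-1 _ q0) divff ?gt_eqF.
rewrite -[in RHS]nneseries_addn; last first.
  by move=> j; rewrite -EFinM lee_fin mulr_ge0 ?(ltW p0)// -lee_fin l0.
congr (_ + _)%E.
apply: eq_eseriesr => j _; rewrite -EFinM addn1; congr EFin.
rewrite -(rwM (q ^- j.+2) _ q0) (exprS p j.+1) (exprS q j.+1) !invfM -mulrA.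
by rewrite !mulVKf ?gt_eqF.
Qed.

Lemma geo_le t u : 0 < t -> t <= u -> (geo t <= geo u)%E.
Proof.
move=> t0 tu; apply: leeD; apply: lee_nneseries => [j _ _|j _]; rewrite ?u0 ?l0//.
  by rewrite lee_fin ler_wpM2l ?exprn_ge0 ?(ltW p0)// rw_le// exprn_ge0// ltW.
by rewrite lee_fin ler_wpM2l ?invr_ge0 ?exprn_ge0 ?(ltW p0)// rw_le// invr_ge0 exprn_ge0// ltW.
Qed.

Lemma geo_leM t a : 0 < t -> 1 <= a -> (geo (a * t) <= a%:E * geo t)%E.
Proof.
move=> t0 a1; have a0 : 0 < a by apply: lt_le_trans a1.
have at0 : 0 < a * t by rewrite mulr_gt0.
rewrite /geo muleDr ?ge0_adde_def ?inE ?nneseries_ge0//; [|by move=> j _ _; rewrite ?u0 ?l0..].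
rewrite -!nneseriesZl; [|by move=> j _; rewrite ?u0 ?l0..].
apply: leeD; apply: lee_nneseries => [j _ _|j _]; rewrite ?u0 ?l0//;
  rewrite -EFinM lee_fin [leRHS]mulrCA ler_wpM2l ?invr_ge0 ?exprn_ge0 ?(ltW p0)// rw_leM//
    ?invr_ge0 ?exprn_ge0// ltW//.
Qed.

Lemma geo1_gt0 : (0 < geo 1)%E.
Proof.
apply: (@lt_le_trans _ _ (2^-1)%:E); first by rewrite lte_fin.
rewrite -[leLHS]adde0; apply: leeD; last by apply: nneseries_ge0 => j _ _; rewrite l0.
rewrite /upper nneseries_recl//; last by move=> j _; rewrite u0.
rewrite -[leLHS]adde0; apply: leeD; last by apply: nneseries_ge0 => j _ _; rewrite u0.
by rewrite !expr0 mul1r /rw div1r lee_fin.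
Qed.

Lemma geometric_nneseries (r : R) : 0 <= r < 1 ->
  (\sum_(0 <= j <oo) (r ^+ j)%:E < +oo)%E.
Proof.
move=> /andP[r0 r1]; have := @cvg_geometric_series R 1 r.
rewrite ger0_norm// => /(_ r1) h.
suff -> : (\sum_(0 <= j <oo) (r ^+ j)%:E)%E = (1 * (1 - r)^-1)%:E by rewrite ltry.
apply/cvg_lim => //; under eq_fun do rewrite sumEFin.
apply: cvg_EFin; first exact: nearW.
by move: h; rewrite /series/=; under eq_fun do under eq_bigr do rewrite mul1r.
Qed.

(** Both bounds on [s] enter. The terms of [upper] are at most [(p / q)^j], summable since [s < 1],
    and those of [lower] at most [p^-j], summable since [s > 0]. *)
Lemma geo1_lty : (geo 1 < +oo)%E.
Proof.
rewrite lte_add_pinfty//.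
  have := @geometric_nneseries (p / q).
  rewrite divr_ge0 ?(ltW p0) ?(ltW q0)//= ltr_pdivrMr// mul1r => /(_ pq).
  apply: le_lt_trans; apply: lee_nneseries => [j _ _|j _]; first by rewrite u0.
  rewrite lee_fin expr_div_n ler_wpM2l ?exprn_ge0 ?(ltW p0)// /rw div1r.
  by rewrite lef_pV2 ?posrE ?ltr_wpDr ?exprn_gt0 ?exprn_ge0 ?(ltW q0)// lerDr.
have := @geometric_nneseries p^-1; rewrite invr_ge0 (ltW p0) invf_lt1// => /(_ p1).
apply: le_lt_trans; apply: lee_nneseries => [j _ _|j _]; first by rewrite l0.
rewrite lee_fin exprVn (@le_trans _ _ (p ^- j.+1))//.
  by rewrite ler_piMr ?rw_le1 ?invr_ge0 ?exprn_ge0 ?(ltW p0) ?(ltW q0).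
by rewrite lef_pV2 ?posrE ?exprn_gt0// exprS ler_peMl ?exprn_ge0 ?(ltW p0)// ltW.
Qed.

Lemma geoXn t n : 0 < t -> geo (q ^+ n * t) = ((p ^+ n)%:E * geo t)%E.
Proof.
move=> t0; elim: n => [|n IH]; first by rewrite !expr0 mul1r mul1e.
rewrite !exprS -mulrA geoM ?mulr_gt0 ?exprn_gt0// IH muleA -EFinM//.
Qed.

Lemma expr_unbounded (a : R) : exists n : nat, a <= q ^+ n.
Proof.
have a0 : 0 < `|a| + 1 by rewrite ltr_wpDl.
have : (q^-1) ^+ n @[n --> \oo] --> 0.
  by apply: cvg_expr; rewrite ger0_norm ?invr_ge0 ?(ltW q0)// invf_lt1.
move=> /cvgrPdist_lt /(_ (`|a| + 1)^-1); rewrite invr_gt0 => /(_ a0)[n _ hn].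
exists n; have := hn n (leqnn n); rewrite sub0r normrN ger0_norm; last first.
  by rewrite exprn_ge0// invr_ge0 ltW.
rewrite exprVn ltf_pV2 ?posrE ?exprn_gt0// => h.
by rewrite (le_trans (ler_norm a))// ltW// (lt_trans _ h)// ltrDl.
Qed.

(** Two natural exponents stand for one integer: [j] lifts [t] above 1, then [i] removes powers of
    [q] until the remainder lies between 1 and [q]. *)
Lemma geo_decomp t : 0 < t -> exists i j : nat, exists2 r,
  1 <= r <= q & q ^+ j * t = q ^+ i * r.
Proof.
move=> t0; have [j hj] := expr_unbounded t^-1; set t' := q ^+ j * t.
have t'1 : 1 <= t' by rewrite /t' -ler_pdivrMr// div1r.
have [n0 hn] := expr_unbounded t'.
have [|n hn1 hn2] := @ex_minnP (fun n => t' <= q ^+ n); first by exists n0.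
case: n hn1 hn2 => [|n] hn1 hn2.
  exists 0%N, j, 1; first by rewrite lexx ltW.
  by apply/eqP; rewrite eq_le expr0 mulr1 t'1 andbT -[leRHS](expr0 q).
exists n, j, (t' / q ^+ n); last by rewrite [RHS]mulrC divfK// gt_eqF// exprn_gt0.
rewrite ler_pdivlMr ?exprn_gt0// mul1r ler_pdivrMr ?exprn_gt0// -exprS hn1 andbT.
by rewrite leNgt; apply/negP => /ltW /hn2; rewrite ltnn.
Qed.

Lemma powRXn n : (q ^+ n) `^ s = p ^+ n.
Proof.
rewrite /p -(powR_mulrn n (ltW q0)) -(powR_mulrn n (ltW p0)) /p.
by rewrite -!powRrM mulrC.
Qed.

(** On [[1, q]] the function [geo] stays between [geo 1] and [q] times [geo 1], while [t^s] stays
    between 1 and [p]. Multiplying [t] by [q] scales both by [p], which carries the comparison to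
    all [t]. *)
Lemma geo_powR t : 0 < t ->
  ((t `^ s)%:E * geo 1 <= p%:E * geo t)%E /\
  (geo t <= (q * t `^ s)%:E * geo 1)%E.
Proof.
move=> t0; have [i [j [r /andP[r1 rq] tr]]] := geo_decomp t0.
have r0 : 0 < r by apply: lt_le_trans r1.
have hp : p ^+ j * t `^ s = p ^+ i * r `^ s.
  rewrite -!powRXn -!powRM ?exprn_ge0 ?(ltW q0) ?(ltW t0) ?(ltW r0)//.
  by rewrite tr.
have hg : ((p ^+ j)%:E * geo t = (p ^+ i)%:E * geo r)%E by rewrite -!geoXn// tr.
have pj : 0 < p ^+ j by rewrite exprn_gt0.
have pi0 : 0 < p ^+ i by rewrite exprn_gt0.
have s0 : 0 <= s by case/andP: s01 => /ltW.
have [g g0 Eg] : exists2 g, 0 <= g & geo 1 = g%:E.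
  by exists (fine (geo 1)); rewrite ?fine_ge0 ?fineK ?geo_ge0// ge0_fin_numE ?geo_ge0// geo1_lty.
have gr1 : (g%:E <= geo r)%E by rewrite -Eg geo_le.
have grq : (geo r <= (q * g)%:E)%E.
  have := geo_leM (t := 1) ltr01 r1; rewrite mulr1 Eg => /le_trans; apply.
  by rewrite -EFinM lee_fin ler_wpM2r.
have [h Eh] : exists h, geo r = h%:E.
  exists (fine (geo r)); rewrite fineK// ge0_fin_numE ?geo_ge0//.
  by rewrite (le_lt_trans grq)// ltry.
have [k Ek] : exists k, geo t = k%:E.
  have := geo_ge0 t0; case E : (geo t) => [k| |] // _; first by exists k.
  by move: hg; rewrite E Eh gt0_muley ?lte_fin// => /esym; rewrite -EFinM.
move: hg gr1 grq; rewrite Eg Eh Ek -!EFinM !lee_fin => -[hg] gr1 grq.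
have rs1 : 1 <= r `^ s by rewrite -[leLHS](pow1R s) ge0_ler_powR// nnegrE// ltW.
have rsp : r `^ s <= p by rewrite /p ge0_ler_powR// nnegrE// ltW.
split; rewrite -(ler_pM2l pj).
  rewrite mulrA hp (mulrCA _ p) hg (mulrCA p) -mulrA ler_pM2l//.
  by rewrite ler_pM// ?powR_ge0.
rewrite hg !mulrA (mulrC (p ^+ j)) -(mulrA q) hp mulrCA -2!mulrA ler_pM2l//.
rewrite mulrA (le_trans grq)// mulrAC ler_peMr// mulr_ge0// ltW//.
Qed.
Section sum_le.
Variables (lam x y : nat -> R).
Hypotheses (lam0 : forall n, 0 < lam n) (x0 : forall n, 0 <= x n)
  (y0 : forall n, 0 <= y n).
Hypothesis rw_xy : forall mu, 0 < mu ->
  (\sum_(0 <= n <oo) (rw mu (lam n) * x n)%:E <=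
   \sum_(0 <= n <oo) (rw mu (lam n) * y n)%:E)%E.

(** Tonelli's theorem for a double series of nonnegative terms. *)
Let weighted_sum_le (c m : nat -> R) (z : nat -> R) :
  (forall j, 0 <= c j) -> (forall j, 0 < m j) -> (forall n, 0 <= z n) ->
  (\sum_(0 <= n <oo) ((\sum_(0 <= j <oo) (c j * rw (m j) (lam n))%:E) * (z n)%:E) =
  \sum_(0 <= j <oo) ((c j)%:E * \sum_(0 <= n <oo) (rw (m j) (lam n) * z n)%:E))%E.
Proof.
move=> c0 m0 z0; have r0 j n : 0 <= rw (m j) (lam n) by rewrite rw_ge0// ltW.
transitivity (\sum_(0 <= n <oo) \sum_(0 <= j <oo)
    (c j * (rw (m j) (lam n) * z n))%:E)%E.
  apply: eq_eseriesr => n _; rewrite muleC -nneseriesZl.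
    by apply: eq_eseriesr => j _; rewrite -EFinM mulrC mulrA.
  by move=> j _; rewrite lee_fin mulr_ge0.
rewrite nneseries_interchange; last first.
  by move=> n j; rewrite lee_fin mulr_ge0// mulr_ge0.
apply: eq_eseriesr => j _; rewrite -nneseriesZl.
  by apply: eq_eseriesr => n _; rewrite EFinM.
by move=> n _; rewrite lee_fin mulr_ge0// mulr_ge0.
Qed.

Lemma geo_sum_le : (\sum_(0 <= n <oo) geo (lam n) * (x n)%:E <=
  \sum_(0 <= n <oo) geo (lam n) * (y n)%:E)%E.
Proof.
have uz n z : (forall n, 0 <= z n) -> (0 <= upper (lam n) * (z n)%:E)%E.
  move=> z0; apply: mule_ge0; last by rewrite lee_fin.
  by apply: nneseries_ge0 => j _ _; exact: u0.
have lz n z : (forall n, 0 <= z n) -> (0 <= lower (lam n) * (z n)%:E)%E.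
  move=> z0; apply: mule_ge0; last by rewrite lee_fin.
  by apply: nneseries_ge0 => j _ _; exact: l0.
have split z : (forall n, 0 <= z n) ->
    (\sum_(0 <= n <oo) geo (lam n) * (z n)%:E =
     \sum_(0 <= n <oo) upper (lam n) * (z n)%:E +
     \sum_(0 <= n <oo) lower (lam n) * (z n)%:E)%E.
  move=> z0; rewrite -nneseriesD; [|by move=> n _ _; exact: uz|by move=> n _ _; exact: lz].
  apply: eq_eseriesr => n _; apply: ge0_muleDl.
    by apply: nneseries_ge0 => j _ _; exact: u0.
  by apply: nneseries_ge0 => j _ _; exact: l0.
have cu j : 0 <= p ^+ j by rewrite exprn_ge0// ltW.
have mu j : 0 < q ^+ j by rewrite exprn_gt0.
have cl j : 0 <= p ^- j.+1 by rewrite invr_ge0 exprn_ge0// ltW.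
have ml j : 0 < q ^- j.+1 by rewrite invr_gt0 exprn_gt0.
have r0 m n z : 0 < m -> (forall n, 0 <= z n) -> (0 <= (rw m (lam n) * z n)%:E)%E.
  by move=> m0 z0; rewrite lee_fin mulr_ge0// rw_ge0// ltW.
rewrite (split x x0) (split y y0) /upper /lower.
rewrite (weighted_sum_le cu mu x0) (weighted_sum_le cl ml x0).
rewrite (weighted_sum_le cu mu y0) (weighted_sum_le cl ml y0).
apply: leeD; apply: lee_nneseries => [j _ _|j _].
- apply: mule_ge0; first by rewrite lee_fin.
  by apply: nneseries_ge0 => n _ _; exact: r0.
- by apply: lee_wpmul2l; [rewrite lee_fin|exact: rw_xy].
- apply: mule_ge0; first by rewrite lee_fin.
  by apply: nneseries_ge0 => n _ _; exact: r0.
- by apply: lee_wpmul2l; [rewrite lee_fin|exact: rw_xy].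
Qed.

(** The two halves of [geo_powR] lose the factors [p] and [q], and [p <= q]. The resulting [q^2]
    disappears when [q] tends to 1. *)
Lemma powR_sum_le_scale :
  (\sum_(0 <= n <oo) (lam n `^ s * x n)%:E <=
   (q ^+ 2)%:E * \sum_(0 <= n <oo) (lam n `^ s * y n)%:E)%E.
Proof.
have [g g0 Eg] : exists2 g, 0 < g & geo 1 = g%:E.
  have := geo1_gt0; have := geo1_lty; case: (geo 1) => // g _.
  by rewrite lte_fin => g0; exists g.
have h0 n z : (forall n, 0 <= z n) -> (0 <= (lam n `^ s * z n)%:E)%E.
  by move=> z0; rewrite lee_fin mulr_ge0// powR_ge0.
have gz n z : (forall n, 0 <= z n) -> (0 <= geo (lam n) * (z n)%:E)%E.
  by move=> z0; rewrite mule_ge0 ?geo_ge0 ?lee_fin.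
have g0' : (0 < g%:E)%E by rewrite lte_fin.
suff : (g%:E * \sum_(0 <= n <oo) (lam n `^ s * x n)%:E <=
    g%:E * ((q ^+ 2)%:E * \sum_(0 <= n <oo) (lam n `^ s * y n)%:E))%E.
  by rewrite lee_pmul2l.
have p0' : (0 <= p%:E)%E by rewrite lee_fin ltW.
have gs0 : (0 <= \sum_(0 <= n <oo) geo (lam n) * (x n)%:E)%E.
  by apply: nneseries_ge0 => n _ _; exact: gz.
apply: (@le_trans _ _ (p%:E * \sum_(0 <= n <oo) geo (lam n) * (x n)%:E)%E).
  rewrite -nneseriesZl; last by move=> n _; exact: (h0 n x x0).
  rewrite -nneseriesZl; last by move=> n _; exact: (gz n x x0).
  apply: lee_nneseries => [n _ _|n _].
    by apply: mule_ge0; [exact: ltW|exact: (h0 n x x0)].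
  have [+ _] := geo_powR (lam0 n); rewrite Eg => h.
  rewrite EFinM !muleA; apply: lee_wpmul2r; first by rewrite lee_fin.
  by rewrite muleC.
apply: (@le_trans _ _ (q%:E * \sum_(0 <= n <oo) geo (lam n) * (y n)%:E)%E).
  apply: lee_pmul => //; first by rewrite lee_fin ltW.
  exact: geo_sum_le.
have q0' : (0 <= q%:E)%E by rewrite lee_fin ltW.
rewrite expr2 EFinM (muleCA g%:E) -muleA; apply: lee_wpmul2l => //.
rewrite -nneseriesZl; last by move=> n _; exact: (h0 n y y0).
rewrite -nneseriesZl; last first.
  by move=> n _; apply: mule_ge0; [exact: ltW|exact: (h0 n y y0)].
apply: lee_nneseries => [n _ _|n _]; first exact: (gz n y y0).
have [_] := geo_powR (lam0 n); rewrite Eg => h.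
rewrite (EFinM (lam n `^ s)) !muleA; apply: lee_wpmul2r; first by rewrite lee_fin.
by apply: (le_trans h); rewrite EFinM muleAC.
Qed.

End sum_le.

End scale.

Lemma powR_sum_le s lam x y : 0 < s < 1 ->
  (forall n, 0 < lam n) -> (forall n, 0 <= x n) -> (forall n, 0 <= y n) ->
  (forall mu, 0 < mu ->
    (\sum_(0 <= n <oo) (rw mu (lam n) * x n)%:E <=
     \sum_(0 <= n <oo) (rw mu (lam n) * y n)%:E)%E) ->
  (\sum_(0 <= n <oo) (lam n `^ s * x n)%:E <=
   \sum_(0 <= n <oo) (lam n `^ s * y n)%:E)%E.
Proof.
move=> s01 lam0 x0 y0 h.
have [->|] := eqVneq (\sum_(0 <= n <oo) (lam n `^ s * y n)%:E)%E +oo%E.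
  by rewrite leey.
rewrite -ltey => yfin.
have Y0 : (0 <= \sum_(0 <= n <oo) (lam n `^ s * y n)%:E)%E.
  by apply: nneseries_ge0 => n _ _; rewrite lee_fin mulr_ge0// powR_ge0.
have key := fun q (q1 : 1 < q) => powR_sum_le_scale q1 s01 lam0 x0 y0 h.
set Y := (\sum_(0 <= n <oo) (lam n `^ s * y n)%:E)%E in yfin Y0 key *.
have [r Er] : exists r, Y = r%:E by exists (fine Y); rewrite fineK// ge0_fin_numE.
rewrite Er; move: Y0; rewrite Er lee_fin => r0.
apply/lee_addgt0Pr => e e0; have er : 0 < e / (3 * (r + 1)).
  by rewrite divr_gt0// mulr_gt0// ltr_wpDl.
(* The ratio used is [q = 1 + t]. As [t <= 1], [(1 + t)^2 <= 1 + 3 t], which explains the 3; the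
   [+ 1] guards against [r = 0]. *)
pose t := Num.min 1 (e / (3 * (r + 1))).
have t0 : 0 < t by rewrite lt_min ltr01.
have t1 : t <= 1 by rewrite ge_min lexx.
have tr : t * (3 * (r + 1)) <= e.
  by rewrite -ler_pdivlMr ?mulr_gt0 ?ltr_wpDl// /t ge_min lexx orbT.
apply: le_trans (key (1 + t) _) _; first by rewrite ltrDl.
rewrite Er -EFinM -EFinD lee_fin; nra.
Qed.

End geometric_interpolation.

(** * Lebesgue measure on row vectors *)

Section row_topology.
Context {R : realType} {n : nat}.
Local Notation E := 'rV[R]_n.

Lemma measurable_row_box (A : 'I_n -> set (measurableTypeR R)) :
  (forall i, measurable (A i)) ->
  measurable [set v : E | forall i, A i (v ord0 i)].
Proof.
move=> mA.
rewrite [X in measurable X](_ : _ =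
    \big[setI/setT]_(i < n) (row_coord i @^-1` A i)).
  elim/big_ind : _ => //; first exact: measurableI.
  move=> i _; rewrite -[X in measurable X]setTI.
  exact: (@measurable_row_coord _ (measurableTypeR R) n i measurableT _ (mA i)).
apply/seteqP; split => v /=.
  by move=> h; elim/big_ind : _ => // i _; exact: h.
move=> + i; rewrite (bigD1 i)//= => -[+ _]; exact.
Qed.

(** This ties the topology to the sigma-algebra generated by coordinates: an open set is the union
    of those boxes of rational centre and radius [1 / (k + 1)] that it contains, a countable family
    enumerated by [unpickle]. *)
Lemma open_measurable_row (A : set E) : open A -> measurable A.
Proof.
move=> oA; pose box (ck : 'rV[rat]_n * nat) : set E :=
  [set v | forall i, (ball (ratr (ck.1 ord0 i) : R) ck.2.+1%:R^-1) (v ord0 i)].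
pose F j : set E := if unpickle j is Some ck then
   (if `[< box ck `<=` A >] then box ck else set0) else set0.
rewrite (_ : A = \bigcup_j F j).
  apply: bigcupT_measurable => j; rewrite /F; case: unpickle => [ck|]//.
  case: asboolP => // _.
  apply: (@measurable_row_box (fun i => ball (ratr (ck.1 ord0 i) : R) ck.2.+1%:R^-1)) => i.
  exact: measurable_ball.
apply/seteqP; split => [v Av|v [j _]]; last first.
  by rewrite /F; case: unpickle => [ck|]//; case: asboolP => // + bv; exact.
have /nbhs_ballP[e /= e0 be] := oA v Av.
have [k hk] : exists k : nat, k.+1%:R^-1 < e / 2.
  have e2 : 0 < (e / 2)^-1 by rewrite invr_gt0 divr_gt0.
  have := archi_boundP (ltW e2); set k := Num.bound _ => hk; exists k.
  rewrite -[ltRHS]invrK ltf_pV2 ?posrE//.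
  by rewrite (lt_trans hk)// ltr_nat.
have k0 : 0 < k.+1%:R^-1 :> R by rewrite invr_gt0.
have /choice[c hc] : forall i : 'I_n, exists q : rat, `|v ord0 i - ratr q| < k.+1%:R^-1.
  move=> i; have [|q] := @rat_in_itvoo R (v ord0 i - k.+1%:R^-1) (v ord0 i + k.+1%:R^-1).
    by rewrite ltrD2l gtrN.
  rewrite in_itv/= => /andP[h1 h2]; exists q.
  rewrite ltr_norml; apply/andP; split.
    by rewrite ltrBrDr addrC ltrBlDr.
  by rewrite ltrBlDr -ltrBlDl.
pose ck := (\row_i c i, k) : 'rV[rat]_n * nat.
exists (pickle ck) => //; rewrite /F pickleK; case: asboolP => [_|].
  by move=> i /=; rewrite mxE /ball/= distrC.
case=> w bw; apply: be; split => // i j; rewrite ord1.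
have := bw j; rewrite /ball/= mxE => h1; have h2 := hc j.
rewrite -(subrK (ratr (c j)) (v _ j)) -addrA (le_lt_trans (ler_normD _ _))//.
by rewrite (splitr e) ltrD// (lt_trans _ hk).
Qed.

Lemma continuous_measurable_row (f : E -> R) : continuous f ->
  measurable_fun setT (f : E -> measurableTypeR R).
Proof.
move=> cf; apply: (measurability _ (RGenOpens.measurableE R)) => //.
move=> _ [_ [a [b ->] <-]]; rewrite setTI; apply: open_measurable_row.
by move/continuousP : cf; apply; exact: interval_open.
Qed.

Lemma cvg_row (T : Type) (F : set_system T) {FF : Filter F} (g : T -> E) (v : E) :
  (forall i, g x ord0 i @[x --> F] --> v ord0 i) -> g x @[x --> F] --> v.
Proof.
move=> h A [P nP PA].
have : F [set x | forall i, P ord0 i (g x ord0 i)].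
  by apply: filter_forall => i; exact: (h i _ (nP ord0 i)).
move=> key; suff : F (g @^-1` A) by [].
apply: (filterS _ key) => x hx; apply: PA => i j.
by rewrite ord1; exact: hx.
Qed.

End row_topology.

(** * Iterated integrals in the first coordinate *)

Section borel_lebesgue_theory.
Context {R : realType}.
Local Notation leb := (@lebesgue_measure R).
Local Notation bl n := (@borel_lebesgue R n).

Lemma ge0_integral_borel_lebesgueS n (f : 'rV[R]_n.+1 -> \bar R) :
  measurable_fun setT f -> (forall x, 0 <= f x)%E ->
  (\int[bl n.+1]_v f v = \int[leb]_x \int[bl n]_w f (row_cons (x, w)))%E /\
  (\int[bl n.+1]_v f v = \int[bl n]_w \int[leb]_x f (row_cons (x, w)))%E.
Proof.
move=> mf f0; have mc := @measurable_row_cons R n.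
have -> : (\int[bl n.+1]_v f v = \int[leb \x bl n]_z (f \o @row_cons R n) z)%E.
  by rewrite -[LHS]/(integral (pushforward (leb \x bl n)%E (@row_cons R n)) _ _)
    ge0_integral_pushforward.
have mfc : measurable_fun setT (f \o @row_cons R n) by exact: measurableT_comp.
have fc0 z : (0 <= (f \o @row_cons R n) z)%E by exact: f0.
by split; [rewrite fubini_tonelli1|rewrite fubini_tonelli2].
Qed.

Lemma integral_borel_lebesgueS n (f : 'rV[R]_n.+1 -> \bar R) :
  (bl n.+1).-integrable setT f ->
  (\int[bl n.+1]_v f v = \int[leb]_x \int[bl n]_w f (row_cons (x, w)))%E /\
  (\int[bl n.+1]_v f v = \int[bl n]_w \int[leb]_x f (row_cons (x, w)))%E.
Proof.
move=> fi; have /integrableP[mf _] := fi; have mc := @measurable_row_cons R n.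
have fic : (leb \x bl n)%E.-integrable setT (f \o @row_cons R n).
  apply/integrableP; split; first exact: measurableT_comp.
  have /integrableP[_] := fi.
  rewrite -[X in (X < _)%E -> _]/(integral (pushforward (leb \x bl n)%E (@row_cons R n)) _ _).
  by rewrite ge0_integral_pushforward//; exact: measurableT_comp.
have -> : (\int[bl n.+1]_v f v = \int[leb \x bl n]_z (f \o @row_cons R n) z)%E.
  by rewrite -[LHS]/(integral (pushforward (leb \x bl n)%E (@row_cons R n)) _ _)
    integral_pushforward.
by split; [rewrite -integral12_prod_meas1|rewrite -integral21_prod_meas1].
Qed.

Definition cube n (M : R) : set 'rV[R]_n := [set v | forall i, `|v ord0 i| <= M].

Arguments cube n M : clear implicits.

Lemma measurable_cube n M : measurable (cube n M).
Proof.
apply: (@measurable_row_box _ _ (fun=> [set x | `|x| <= M])) => i.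
rewrite (_ : [set x | _] = `[- M, M]%classic)//.
by apply/seteqP; split => x /=; rewrite in_itv/= ler_norml.
Qed.

Lemma row_cons_cube n M (x : R) (w : 'rV[R]_n) :
  cube n.+1 M (row_cons (x, w)) <-> `|x| <= M /\ cube n M w.
Proof.
split=> [h|[xM wM] i]; last first.
  rewrite mxE; case: unliftP => [j _|_] //=; exact: wM.
split; first by have := h ord0; rewrite mxE unlift_none.
by move=> j; have := h (lift ord0 j); rewrite mxE liftK.
Qed.

Lemma cube_lty n M : (bl n (cube n M) < +oo)%E.
Proof.
elim: n => [|n IH]; first by rewrite /= /dirac indicE; case: (_ \in _); rewrite ltry.
rewrite -[X in (X < _)%E]/((leb \x bl n)%E (@row_cons R n @^-1` cube n.+1 M)).
rewrite (_ : _ @^-1` _ = `[- M, M]%classic `*` cube n M).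
  rewrite product_measure1E//; last exact: measurable_cube.
  apply: lte_mul_pinfty => //; rewrite ge0_fin_numE//.
  suff: (leb (`[(- M)%R, M]%classic : set R) < +oo)%E by [].
  by rewrite lebesgue_measure_itv/=; case: ifP; rewrite ?ltry.
apply/seteqP; split => [[x w] /row_cons_cube[]|[x w] [/= xM wM]] /=.
  by rewrite in_itv/= ler_norml => ->.
by apply/row_cons_cube; split => //; move: xM; rewrite in_itv/= -ler_norml.
Qed.

End borel_lebesgue_theory.
Arguments cube {R} n M _.

(** * Transfer between the Borel measure and its completion *)

Section lebesgue_borel.
Context {R : realType} {N : nat}.
Local Notation mu := (@lebesgue_n R N).
Local Notation bl := (@borel_lebesgue R N).

Lemma borel_measurable_lebesgue (A : set 'rV[R]_N) :
  measurable A -> measurable (A : set (lebesgue_space R N)).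
Proof. by move=> mA; apply: sub_caratheodory; exact: sub_sigma_algebra. Qed.

Lemma lebesgue_nE (A : set 'rV[R]_N) : measurable A -> mu A = bl A.
Proof. by move=> mA; rewrite /lebesgue_n /completed_measure_extension measurable_mu_extE. Qed.

(** The identity, named so that it can serve as a measurable map: the pushforward of Lebesgue
    measure along it is the Borel measure, and integrals are transferred by the change of variables
    formula. *)
Definition to_borel : lebesgue_space R N -> 'rV[R]_N := id.

Lemma measurable_to_borel : measurable_fun setT to_borel.
Proof. by move=> _ A mA; rewrite setTI; exact: borel_measurable_lebesgue. Qed.

Lemma borel_measurable_fun_lebesgue d (T : measurableType d) (f : 'rV[R]_N -> T) :
  measurable_fun setT f -> measurable_fun setT (f : lebesgue_space R N -> T).
Proof. by move=> mf; exact: (measurableT_comp mf measurable_to_borel). Qed.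

Lemma ge0_integral_lebesgue_n (f : 'rV[R]_N -> \bar R) :
  measurable_fun setT f -> (forall x, 0 <= f x)%E ->
  (\int[mu]_x f x = \int[bl]_x f x)%E.
Proof.
move=> mf f0; rewrite -[LHS]/(\int[mu]_(x in to_borel @^-1` setT) (f \o to_borel) x)%E.
rewrite -(ge0_integral_pushforward measurable_to_borel)//.
apply: eq_measure_integral; first exact: measurable_to_borel.
by move=> mid A mA _; exact: (lebesgue_nE mA).
Qed.

Lemma integral_lebesgue_n (f : 'rV[R]_N -> \bar R) : bl.-integrable setT f ->
  mu.-integrable setT f /\ (\int[mu]_x f x = \int[bl]_x f x)%E.
Proof.
move=> /integrableP[mf fi].
have fmu : mu.-integrable setT f.
  apply/integrableP; split; first exact: borel_measurable_fun_lebesgue.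
  by rewrite ge0_integral_lebesgue_n//; exact: measurableT_comp.
split => //; rewrite -[LHS]/(\int[mu]_(x in to_borel @^-1` setT) (f \o to_borel) x)%E.
rewrite -(integral_pushforward measurable_to_borel)//.
apply: eq_measure_integral; first exact: measurable_to_borel.
by move=> mid A mA _; exact: (lebesgue_nE mA).
Qed.

End lebesgue_borel.

Lemma derive_near0 {R : numFieldType} {V : normedModType R} (g : V -> R) (v w : V) :
  (\forall y \near v, g y = 0) -> 'D_w g v = 0.
Proof.
move=> g0; rewrite (@near_eq_derive _ _ _ g (cst 0)); first exact: derive_cst.
exact: g0.
Qed.

Section calculus1.
Context {R : realType}.
Local Notation leb := (@lebesgue_measure R).
Implicit Types g : R -> R.

Lemma FTC2 g (a b : R) : a <= b -> (forall x, derivable g x 1) ->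
  continuous ('D_1 g) ->
  (\int[leb]_(x in `[a, b]) ('D_1 g x)%:E = (g b - g a)%:E)%E.
Proof.
move=> ab dg cg; have [->|ab'] := eqVneq a b.
  by rewrite subrr set_itv1 integral_set1.
have gc x : g y @[y --> x] --> g x.
  by apply: differentiable_continuous; exact/derivable1_diffP.
rewrite (@continuous_FTC2 _ _ g)//.
- by rewrite lt_neqAle ab' ab.
- by apply: continuous_subspaceT => x; exact: cg.
- split => //; first by apply: cvg_at_right_filter; exact: gc.
  by apply: cvg_at_left_filter; exact: gc.
- by move=> x _; rewrite derive1E.
Qed.

Lemma integral_derive_compact g (M : R) : (forall x, derivable g x 1) ->
  continuous ('D_1 g) -> (forall x, M < `|x| -> g x = 0) ->
  (\int[leb]_x ('D_1 g x)%:E = 0)%E.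
Proof.
move=> dg cg g0; pose K := `|M| + 1.
have MK : M < K by rewrite (le_lt_trans (ler_norm M))// ltrDl.
have K0 : 0 <= K by rewrite addr_ge0.
transitivity (\int[leb]_(x in `[(- K)%R, K]) ('D_1 g x)%:E)%E; last first.
  by rewrite FTC2 ?ge0_cp// !g0 ?subrr// ?normrN ger0_norm.
rewrite [RHS]integral_mkcond; apply: eq_integral => x _; rewrite patchE.
case: ifPn => // /negP; rewrite inE/= in_itv/= -ler_norml => /negP.
rewrite -ltNge => Kx; congr EFin; apply: derive_near0.
near=> y; apply: g0; rewrite (lt_trans MK)//; near: y.
have : `|y| @[y --> x] --> `|x| by apply: norm_continuous.
by move=> /cvgr_gt; apply.
Unshelve. all: by end_near. Qed.

End calculus1.

Section slices.
Context {R : realType} {n : nat}.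
Implicit Types (h : 'rV[R]_n.+1 -> R) (x : R) (w : 'rV[R]_n).

Lemma row_cons_shift0 (t x : R) w :
  t *: delta_mx 0 ord0 + row_cons (x, w) = row_cons (t *: 1 + x, w).
Proof.
apply/rowP => i; rewrite !mxE /=; case: (unliftP ord0 i) => [j ->|->] /=.
  by rewrite mulr0 add0r.
by [].
Qed.

Lemma row_cons_shiftS (t x : R) w (j : 'I_n) :
  t *: delta_mx 0 (lift ord0 j) + row_cons (x, w) = row_cons (x, t *: delta_mx 0 j + w).
Proof.
apply/rowP => i; rewrite !mxE /=; case: (unliftP ord0 i) => [k ->|->] /=.
  by rewrite !mxE (inj_eq (@lift_inj _ ord0)).
by rewrite mulr0 add0r.
Qed.

Lemma derive_row0 h x w :
  (derivable h (row_cons (x, w)) (delta_mx 0 ord0) <->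
   derivable (fun t => h (row_cons (t, w))) x 1) /\
  'D_(delta_mx 0 ord0) h (row_cons (x, w)) = 'D_1 (fun t => h (row_cons (t, w))) x.
Proof.
rewrite /derivable /derive.
have E : (fun t : R => t^-1 *: ((h \o shift (row_cons (x, w))) (t *: delta_mx 0 ord0) -
     h (row_cons (x, w)))) =
   (fun t : R => t^-1 *: (((fun t => h (row_cons (t, w))) \o shift x) (t *: (1 : R)) -
     h (row_cons (x, w)))).
  by apply/funext => t; rewrite /= row_cons_shift0.
by split; rewrite E.
Qed.

Lemma derive_rowS h x w (j : 'I_n) :
  (derivable h (row_cons (x, w)) (delta_mx 0 (lift ord0 j)) <->
   derivable (fun v => h (row_cons (x, v))) w (delta_mx 0 j)) /\
  'D_(delta_mx 0 (lift ord0 j)) h (row_cons (x, w)) =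
  'D_(delta_mx 0 j) (fun v => h (row_cons (x, v))) w.
Proof.
rewrite /derivable /derive.
have E : (fun t : R => t^-1 *: ((h \o shift (row_cons (x, w)))
     (t *: delta_mx 0 (lift ord0 j)) - h (row_cons (x, w)))) =
   (fun t : R => t^-1 *: (((fun v => h (row_cons (x, v))) \o shift w)
     (t *: delta_mx 0 j) - h (row_cons (x, w)))).
  by apply/funext => t; rewrite /= row_cons_shiftS.
by split; rewrite E.
Qed.

Lemma continuous_row_consr h x : continuous h ->
  continuous (fun w : 'rV[R]_n => h (row_cons (x, w))).
Proof.
move=> ch w; apply: (@continuous_comp _ _ _ (fun w => row_cons (x, w)) h); last exact: ch.
apply: (cvg_row (FF := nbhs_filter w)) => i; rewrite mxE; case: (unliftP ord0 i) => [j ->|->] /=.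
  by under eq_fun do rewrite mxE liftK/=; exact: coord_continuous.
by under eq_fun do rewrite mxE unlift_none/=; exact: cvg_cst.
Qed.

Lemma continuous_row_consl h w : continuous h ->
  continuous (fun x : R => h (row_cons (x, w))).
Proof.
move=> ch x; apply: (@continuous_comp _ _ _ (fun x => row_cons (x, w)) h); last exact: ch.
apply: (cvg_row (FF := nbhs_filter x)) => i; rewrite mxE; case: (unliftP ord0 i) => [j ->|->] /=.
  by under eq_fun do rewrite mxE liftK/=; exact: cvg_cst.
by under eq_fun do rewrite mxE unlift_none/=; exact: cvg_id.
Qed.

End slices.

(** * Compactly supported functions and vanishing of the integral of a derivative *)

Section compact_support.
Context {R : realType}.
Local Notation bl n := (@borel_lebesgue R n).

Definition Cc n (g : 'rV[R]_n -> R) :=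
  continuous g /\ exists M, forall v, ~ cube n M v -> g v = 0.

(** Only first derivatives and no reference to a domain, so that slices remain in the class and
    inductions on the dimension go through. *)
Definition C1c n (h : 'rV[R]_n -> R) := [/\ Cc h,
  forall i x, derivable h x (delta_mx 0 i) & forall i, continuous (partial i h)].

Lemma compact_cube n M : compact (cube n M : set 'rV[R]_n).
Proof.
have := @rV_compact _ n (fun=> `[(- M), M]%classic).
rewrite (_ : [set v | _] = cube n M); last first.
  by apply/seteqP; split => v h i; have := h i; rewrite /= in_itv/= ler_norml.
by apply => _; exact: segment_compact.
Qed.

Lemma Cc_bounded n (g : 'rV[R]_n -> R) : Cc g -> exists B, forall v, `|g v| <= B.
Proof.
move=> [cg [M g0]].
have /compact_bounded[B [_ hB]] : compact (g @` cube n M).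
  by apply: continuous_compact; [exact: continuous_subspaceT|exact: compact_cube].
exists (`|B| + 1) => v; have [Mv|/g0->] := pselect (cube n M v).
  by apply: hB; [rewrite (le_lt_trans (ler_norm B))// ltrDl|exists v].
by rewrite normr0 addr_ge0.
Qed.

Lemma Cc_integrable n (g : 'rV[R]_n -> R) : Cc g ->
  (bl n).-integrable setT (EFin \o g).
Proof.
move=> cg; have [B hB] := Cc_bounded cg; case: cg => cg [M g0].
have mc := @measurable_cube R n M.
have -> : EFin \o g = (EFin \o g) \_ (cube n M).
  apply/funext => v; rewrite patchE; case: ifPn => // /negP; rewrite inE => /g0.
  by move=> /= ->.
apply: (proj1 (@integrable_mkcond _ _ _ (bl n) (cube n M) (EFin \o g) mc)).
apply: (@measurable_bounded_integrable _ _ _ (bl n) g) => //.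
- exact: cube_lty.
- by apply: measurable_funTS; exact: continuous_measurable_row.
- exists B; split; first exact: num_real.
  by move=> x Bx v _ /=; rewrite (le_trans (hB v))// ltW.
Qed.

Lemma open_notcube n M : open (~` (cube n M : set 'rV[R]_n)).
Proof. by rewrite openC; apply: compact_closed; [exact: norm_hausdorff|exact: compact_cube]. Qed.

Lemma Cc_partial n (h : 'rV[R]_n -> R) i : C1c h -> Cc (partial i h).
Proof.
move=> [[ch [M h0]] dh cph]; split; first exact: cph.
exists M => v nv; apply: derive_near0.
have : nbhs v (~` (cube n M)) by apply: open_nbhs_nbhs; split => //; exact: open_notcube.
by apply: filterS => y; exact: h0.
Qed.

Lemma C1c_slice n (h : 'rV[R]_n.+1 -> R) x : C1c h ->
  C1c (fun w => h (row_cons (x, w))).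
Proof.
move=> [[ch [M h0]] dh cph]; split.
- split; first exact: continuous_row_consr.
  by exists M => w nw; apply: h0 => /row_cons_cube[].
- by move=> i w; apply/(derive_rowS h x w i).1; exact: dh.
- move=> i; have -> : partial i (fun w => h (row_cons (x, w))) =
      (fun w => partial (lift ord0 i) h (row_cons (x, w))).
    by apply/funext => w; rewrite /partial (derive_rowS h x w i).2.
  exact: continuous_row_consr.
Qed.

Lemma C1c_slice0 n (h : 'rV[R]_n.+1 -> R) w : C1c h ->
  [/\ forall x, derivable (fun t => h (row_cons (t, w))) x 1,
      continuous ('D_1 (fun t => h (row_cons (t, w)))) &
      forall x, 'D_1 (fun t => h (row_cons (t, w))) x = partial ord0 h (row_cons (x, w))].
Proof.
move=> [[ch _] dh cph]; split.
- by move=> x; apply/(derive_row0 h x w).1; exact: dh.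
- have <- : (fun x => partial ord0 h (row_cons (x, w))) = 'D_1 (fun t => h (row_cons (t, w))).
    by apply/funext => x; rewrite /partial (derive_row0 h x w).2.
  exact: continuous_row_consl.
- by move=> x; rewrite /partial (derive_row0 h x w).2.
Qed.

(** Induction on the dimension. For the first coordinate, integrate that coordinate first and apply
    the fundamental theorem of calculus; for any other one, integrate the first coordinate last and
    apply the induction hypothesis to slices. *)
Lemma integral_partial n (h : 'rV[R]_n -> R) i : C1c h ->
  (\int[bl n]_v (partial i h v)%:E = 0)%E.
Proof.
elim: n h i => [|n IH] h i Ch; first by case: i.
have [ip1 ip2] := integral_borel_lebesgueS (Cc_integrable (Cc_partial i Ch)).
case: (unliftP ord0 i) ip1 ip2 => [j ->|->] ip1 ip2.
  rewrite [LHS]ip1 integral0_eq// => x _.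
  rewrite -[RHS](IH (fun w => h (row_cons (x, w))) j (C1c_slice x Ch)).
  by apply: eq_integral => w _ /=; rewrite /partial (derive_rowS h x w j).2.
rewrite [LHS]ip2 integral0_eq// => w _.
have [dw cw E] := C1c_slice0 w Ch.
case: Ch => -[ch [M h0]] dh cph.
rewrite -[RHS](integral_derive_compact (M := M) dw cw).
  by apply: eq_integral => x _ /=; rewrite E.
by move=> x Mx; apply: h0 => /row_cons_cube[]; rewrite leNgt Mx.
Qed.

End compact_support.

(** * Nash's inequality *)

(** Straight from the definition of the integral as a supremum over simple functions below. It can
    thus be applied to inner integrals before their measurability is established. *)
Lemma le_nnintegral d (T : measurableType d) (R : realType)
    (mu : {measure set T -> \bar R}) (D : set T) (f1 f2 : T -> \bar R) :
  (forall x, D x -> 0 <= f1 x)%E -> (forall x, D x -> f1 x <= f2 x)%E ->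
  (\int[mu]_(x in D) f1 x <= \int[mu]_(x in D) f2 x)%E.
Proof.
move=> f0 f12; rewrite integral_mkcond [leRHS]integral_mkcond.
have g0 x : (0 <= (f1 \_ D) x)%E.
  by rewrite patchE; case: ifPn => //; rewrite inE; exact: f0.
have g12 x : ((f1 \_ D) x <= (f2 \_ D) x)%E.
  by rewrite !patchE; case: ifPn => //; rewrite inE; exact: f12.
rewrite !ge0_integralTE//; last by move=> x; exact: le_trans (g12 x).
apply: le_ereal_sup => _ [h hf1 <-]; exists h => // x.
exact: le_trans (hf1 x) (g12 x).
Qed.

(** * Averaging kernel over cubes *)

Section kernel.
Context {R : realType}.
Local Notation leb := (@lebesgue_measure R).
Local Notation bl n := (@borel_lebesgue R n).
Variable r : R.
Hypothesis r0 : 0 < r.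

(** A one-sided window: it has mass [r] in each variable, and [x <= y] allows increments to be
    written as integrals over [[x, y]]. The product [kern] inherits this coordinate by
    coordinate. *)
Definition kern1 (x y : R) : R := ((x <= y) && (y <= x + r))%:R.

Definition kern n (x y : 'rV[R]_n) : R := \prod_(i < n) kern1 (x ord0 i) (y ord0 i).

Lemma kern1_ge0 x y : 0 <= kern1 x y. Proof. by rewrite /kern1 ler0n. Qed.

Lemma kern1_le1 x y : kern1 x y <= 1.
Proof. by rewrite /kern1 lern1 leq_b1. Qed.

Lemma kern_ge0 n (x y : 'rV[R]_n) : 0 <= kern x y.
Proof. by apply: prodr_ge0 => i _; exact: kern1_ge0. Qed.

Lemma kern_le1 n (x y : 'rV[R]_n) : kern x y <= 1.
Proof. by apply: prodr_ile1 => i; rewrite kern1_ge0 kern1_le1. Qed.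

Lemma kern_cons n (x y : R) (w v : 'rV[R]_n) :
  kern (row_cons (x, w)) (row_cons (y, v)) = kern1 x y * kern w v.
Proof.
rewrite /kern big_ord_recl !mxE !unlift_none/=; congr (_ * _).
by apply: eq_bigr => i _; rewrite !mxE !liftK.
Qed.

Lemma measurable_kern1 d (T : measurableType d) (f g : T -> R) :
  measurable_fun setT f -> measurable_fun setT g ->
  measurable_fun setT (fun t => kern1 (f t) (g t)).
Proof.
move=> mf mg; rewrite (_ : (fun t => _) =
    (fun t => if (f t <= g t) && (g t <= f t + r) then 1 else 0)).
  apply: measurable_fun_ifT => //; apply: measurable_and.
    exact: measurable_fun_ler.
  by apply: measurable_fun_ler => //; exact: measurable_funD.
by apply/funext => t; rewrite /kern1; case: (_ && _).
Qed.

Lemma measurable_kern n d (T : measurableType d) (f g : T -> 'rV[R]_n) :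
  measurable_fun setT f -> measurable_fun setT g ->
  measurable_fun setT (fun t => kern (f t) (g t)).
Proof.
move=> mf mg; apply: measurable_prod => i _; apply: measurable_kern1.
  by apply: (measurableT_comp (@measurable_row_coord _ (measurableTypeR R) n i)).
by apply: (measurableT_comp (@measurable_row_coord _ (measurableTypeR R) n i)).
Qed.

Lemma integral_kern1 (x : R) : (\int[leb]_y (kern1 x y)%:E = r%:E)%E /\
  (\int[leb]_y (kern1 y x)%:E = r%:E)%E.
Proof.
have itv (a : R) : (\int[leb]_y (\1_(`[a, (a + r)%R]) y)%:E = r%:E)%E.
  rewrite integral_indic// setIT.
  suff: (leb (`[a, (a + r)%R]%classic : set R) = r%:E)%E by [].
  rewrite lebesgue_measure_itv/= lte_fin ltrDl r0 -EFinB; congr EFin; lra.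
split; [rewrite -(itv x)|rewrite -(itv (x - r))]; apply: eq_integral => y _;
    rewrite /kern1 indicE; congr (_%:R%:E).
  by rewrite mem_setE in_itv.
by rewrite mem_setE in_itv /= subrK lerBlDr andbC.
Qed.

Lemma integral_kern n (x : 'rV[R]_n) : (\int[bl n]_y (kern x y)%:E = (r ^+ n)%:E)%E /\
  (\int[bl n]_y (kern y x)%:E = (r ^+ n)%:E)%E.
Proof.
elim: n x => [|n IH] x.
  rewrite /= /kern !integral_dirac//=; last 2 first.
  - by under eq_fun do rewrite big_ord0; exact: measurable_cst.
  - by under eq_fun do rewrite big_ord0; exact: measurable_cst.
  by rewrite diracT !big_ord0 mul1e expr0.
have kE : x = row_cons (row_uncons x) by rewrite row_unconsK.
set a := (row_uncons x).1; set w := (row_uncons x).2.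
have mk (f g : 'rV[R]_n.+1 -> 'rV[R]_n.+1) : measurable_fun setT f -> measurable_fun setT g ->
    measurable_fun setT (fun t => (kern (f t) (g t))%:E).
  by move=> mf mg; apply/measurable_EFinP; exact: measurable_kern.
have k0 (y z : 'rV[R]_n.+1) : (0 <= (kern y z)%:E)%E by rewrite lee_fin kern_ge0.
have [k1 k2] := integral_kern1 a; have [l1 l2] := IH w.
have m1 (f g : measurableTypeR R -> R) : measurable_fun setT f -> measurable_fun setT g ->
    measurable_fun setT (fun t => (kern1 (f t) (g t))%:E : \bar R).
  by move=> mf mg; apply/measurable_EFinP; exact: measurable_kern1.
split.
- rewrite (ge0_integral_borel_lebesgueS (mk _ _ (measurable_cst _) (@measurable_id _ _ _)) (k0 x)).1.
  transitivity (\int[leb]_y ((kern1 a y)%:E * (r ^+ n)%:E))%E.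
    apply: eq_integral => y _; rewrite -l1 -ge0_integralZl_EFin//.
    + by apply: eq_integral => v _; rewrite -EFinM -kern_cons /a /w -surjective_pairing -kE.
    + by move=> v _; rewrite lee_fin kern_ge0.
    + by apply/measurable_EFinP; apply: measurable_kern => //; exact: measurable_cst.
  rewrite ge0_integralZr//; first by rewrite k1 exprS.
  + by apply: m1 => //; exact: measurable_cst.
  + by move=> y _; rewrite lee_fin kern1_ge0.
  + by rewrite lee_fin exprn_ge0// ltW.
- rewrite (ge0_integral_borel_lebesgueS (mk _ _ (@measurable_id _ _ _) (measurable_cst _)) (k0 ^~ x)).1.
  transitivity (\int[leb]_y ((kern1 y a)%:E * (r ^+ n)%:E))%E.
    apply: eq_integral => y _; rewrite -l2 -ge0_integralZl_EFin//.
    + by apply: eq_integral => v _; rewrite -EFinM -kern_cons /a /w -surjective_pairing -kE.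
    + by move=> v _; rewrite lee_fin kern_ge0.
    + by apply/measurable_EFinP; apply: measurable_kern => //; exact: measurable_cst.
  rewrite ge0_integralZr//; first by rewrite k2 exprS.
  + by apply: m1 => //; exact: measurable_cst.
  + by move=> y _; rewrite lee_fin kern1_ge0.
  + by rewrite lee_fin exprn_ge0// ltW.
Qed.

End kernel.

(** * Averaged squared increments are bounded by the gradient *)

Section kernel_energy.
Context {R : realType}.
Local Notation leb := (@lebesgue_measure R).
Variable r : R.
Hypothesis r0 : 0 < r.
Local Notation kern1 := (kern1 r).
Local Notation kern := (kern r).

Lemma sqr_increment_le (g : R -> R) (x y : R) : x <= y ->
  (forall t, derivable g t 1) -> continuous ('D_1 g) ->
  (((g x - g y) ^+ 2)%:E <=
    (y - x)%:E * \int[leb]_(t in `[x, y]) ('D_1 g t ^+ 2)%:E)%E.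
Proof.
move=> xy dg cg.
have mD : measurable (`[x, y]%classic : set (measurableTypeR R)) by [].
have int (h : R -> R) : continuous h -> leb.-integrable `[x, y] (EFin \o h).
  move=> ch; apply: continuous_compact_integrable; first exact: segment_compact.
  exact: continuous_subspaceT.
have sg : sqint leb `[x, y] ('D_1 g).
  split; first by apply: measurable_funTS; exact: continuous_measurable_fun.
  by apply: (int (fun t => 'D_1 g t ^+ 2)) => t; apply: cvgM; exact: cg.
have s1 : sqint leb `[x, y] (fun=> 1).
  split; first exact: measurable_cst.
  by apply: (int (fun=> 1 ^+ 2)) => t; exact: cvg_cst.
have := cauchy_schwarz mD sg s1.
have -> : inner leb `[x, y] ('D_1 g) (fun=> 1) = g y - g x.
  rewrite /inner; under eq_Rintegral do rewrite mulr1.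
  by rewrite /Rintegral FTC2.
have -> : inner leb `[x, y] (fun=> 1) (fun=> 1) = y - x.
  rewrite /inner; under eq_Rintegral do rewrite mulr1.
  rewrite Rintegral_cst// mul1r.
  suff: fine (leb (`[x, y]%classic : set R)) = y - x by [].
  by rewrite lebesgue_measure_itv/= lte_fin; move: xy; rewrite le_eqVlt
    => /predU1P[->|->]//; rewrite ltxx subrr.
rewrite -lee_fin => /le_trans; rewrite -sqrrN opprB; apply.
by rewrite mulrC EFinM -(inner_integral mD sg).
Qed.

(** By Cauchy-Schwarz a squared increment is at most [r] times [J x], the integral of the squared
    derivative over the window starting at [x]. One further [r] comes from integrating the kernel in
    [y], the third from integrating it in [x] after exchanging the integrals. *)
Lemma kernel_energy1 (g : R -> R) :
  (forall t, derivable g t 1) -> continuous ('D_1 g) ->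
  (\int[leb]_x \int[leb]_y (kern1 x y * (g x - g y) ^+ 2)%:E <=
   (r ^+ 3)%:E * \int[leb]_x ('D_1 g x ^+ 2)%:E)%E.
Proof.
move=> dg cg; pose J x : \bar R := (\int[leb]_t (kern1 x t * 'D_1 g t ^+ 2)%:E)%E.
have mg : measurable_fun setT ('D_1 g : measurableTypeR R -> R).
  exact: continuous_measurable_fun.
have J0 x : (0 <= J x)%E.
  by apply: integral_ge0 => t _; rewrite lee_fin mulr_ge0 ?kern1_ge0 ?sqr_ge0.
have key x y : ((kern1 x y * (g x - g y) ^+ 2)%:E <= (kern1 x y)%:E * (r%:E * J x))%E.
  rewrite EFinM; have := kern1_ge0 r x y; rewrite {1 2 3}/kern1.
  case: (boolP (_ && _)) => [/andP[xy yx] _|]; last by rewrite !mul0e.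
  rewrite !mul1e; apply: le_trans (sqr_increment_le xy dg cg) _.
  apply: lee_pmul; rewrite ?lee_fin ?subr_ge0//.
  - by apply: integral_ge0 => t _; rewrite lee_fin sqr_ge0.
  - by rewrite lerBlDl.
  rewrite integral_mkcond; apply: le_nnintegral => [t _|t _].
    by rewrite patchE; case: ifP => // _; rewrite lee_fin sqr_ge0.
  rewrite patchE; case: ifPn; last by rewrite lee_fin mulr_ge0 ?kern1_ge0 ?sqr_ge0.
  rewrite inE/= in_itv/= => /andP[xt ty]; rewrite /kern1 xt (le_trans ty)// mul1r//.
have mk x : measurable_fun setT (fun y : measurableTypeR R => (kern1 x y)%:E : \bar R).
  by apply/measurable_EFinP; apply: measurable_kern1 => //; exact: measurable_cst.
have mJ : measurable_fun setT (fun z : measurableTypeR R * measurableTypeR R =>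
     (kern1 z.1 z.2 * 'D_1 g z.2 ^+ 2)%:E : \bar R).
  apply/measurable_EFinP; apply: measurable_funM; first exact: measurable_kern1.
  by apply: measurable_funX; exact: (measurableT_comp mg).
have kJ z : (0 <= (kern1 z.1 z.2 * 'D_1 g z.2 ^+ 2)%:E :> \bar R)%E.
  by rewrite lee_fin mulr_ge0 ?kern1_ge0 ?sqr_ge0.
apply: (@le_trans _ _ (\int[leb]_x (r%:E * (r%:E * J x)))%E).
  apply: le_nnintegral => [x _|x _].
    by apply: integral_ge0 => y _; rewrite lee_fin mulr_ge0 ?kern1_ge0 ?sqr_ge0.
  apply: (@le_trans _ _ (\int[leb]_y ((kern1 x y)%:E * (r%:E * J x)))%E).
    apply: le_nnintegral => [y _|y _]; last exact: key.
    by rewrite lee_fin mulr_ge0 ?kern1_ge0 ?sqr_ge0.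
  rewrite ge0_integralZr//; last 2 first.
  - by move=> y _; rewrite lee_fin kern1_ge0.
  - by rewrite mule_ge0// lee_fin ltW.
  by rewrite (integral_kern1 r0 x).1.
have mJ1 : measurable_fun setT J by exact: (measurable_fun_fubini_tonelli_F (m2 := leb) _ mJ kJ).
rewrite ge0_integralZl//; last 3 first.
- exact: measurable_funeM.
- by move=> x _; rewrite mule_ge0// lee_fin ltW.
- by rewrite lee_fin ltW.
rewrite ge0_integralZl//; last by rewrite lee_fin ltW.
rewrite /J (fubini_tonelli (m1 := leb) (m2 := leb) _ mJ kJ)/=.
rewrite (_ : (\int[leb]_y \int[leb]_x _ = r%:E * \int[leb]_x ('D_1 g x ^+ 2)%:E)%E).
  by rewrite !muleA -!EFinM !exprS expr0 mulr1 mulrA.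
rewrite -ge0_integralZl//; last 3 first.
- by apply/measurable_EFinP; exact: measurable_funX.
- by move=> x _; rewrite lee_fin sqr_ge0.
- by rewrite lee_fin ltW.
apply: eq_integral => y _.
rewrite -(integral_kern1 r0 y).2 -ge0_integralZr//.
- by apply/measurable_EFinP; apply: measurable_kern1 => //; exact: measurable_cst.
- by move=> x _; rewrite lee_fin kern1_ge0.
- by rewrite lee_fin sqr_ge0.
Qed.

End kernel_energy.

Section kernel_energy_row.
Context {R : realType}.
Local Notation leb := (@lebesgue_measure R).
Local Notation bl n := (@borel_lebesgue R n).
Variable r : R.
Hypothesis r0 : 0 < r.
Local Notation kern1 := (kern1 r).
Local Notation kern := (kern r).

(** Induction on the dimension: the increment from [(a, w)] to [(b, v)] is split at [(b, w)], and
    [(A + B)^2 <= 2 A^2 + 2 B^2] costs a factor 2 per coordinate. The first leg is one-dimensional,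
    the second lies in the slice at [b]. *)
Lemma kernel_energy n (h : 'rV[R]_n -> R) : C1c h ->
  (\int[bl n]_x \int[bl n]_y (kern x y * (h x - h y) ^+ 2)%:E <=
   (2 ^+ n * r ^+ n.+2)%:E * \int[bl n]_x (\sum_(i < n) partial i h x ^+ 2)%:E)%E.
Proof.
elim: n h => [|n IH] h Ch.
  rewrite [leLHS]integral0_eq ?mule_ge0//; last first.
    move=> x _; apply: integral0_eq => y _; rewrite (_ : y = x).
      by rewrite subrr expr0n mulr0.
    by apply/rowP => -[].
  - by apply: integral_ge0 => x _; rewrite lee_fin sumr_ge0// => i _; rewrite sqr_ge0.
  - by rewrite lee_fin mulr_ge0 ?exprn_ge0// ltW.
have [[ch _] dh cph] := Ch.
have mh : measurable_fun setT (h : 'rV[R]_n.+1 -> measurableTypeR R).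
  exact: continuous_measurable_row.
have mrc := @measurable_row_cons R n.
have k0 m (x y : 'rV[R]_m) z : (0 <= (kern x y * z ^+ 2)%:E :> \bar R)%E.
  by rewrite lee_fin mulr_ge0 ?kern_ge0 ?sqr_ge0.
have k10 x y z : (0 <= (kern1 x y * z ^+ 2)%:E :> \bar R)%E.
  by rewrite lee_fin mulr_ge0 ?kern1_ge0 ?sqr_ge0.
have mF : measurable_fun setT (fun z : 'rV[R]_n.+1 * 'rV[R]_n.+1 =>
    (kern z.1 z.2 * (h z.1 - h z.2) ^+ 2)%:E : \bar R).
  apply/measurable_EFinP; apply: measurable_funM; first exact: measurable_kern.
  by apply: measurable_funX; apply: measurable_funB; exact: (measurableT_comp mh).
(* At [(b, w)], [G] averages the increments from [w] within the slice at [b]. Below, [T1] averages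
   those of the first coordinate, and [T2] averages [G] over the window of [b]. *)
pose G p : \bar R := (\int[bl n]_v (kern p.2 v *
   (h (row_cons p) - h (row_cons (p.1, v))) ^+ 2)%:E)%E.
have G0 p : (0 <= G p)%E by apply: integral_ge0.
have mG : measurable_fun setT (G : measurableTypeR R * 'rV[R]_n -> \bar R).
  pose f (p : (measurableTypeR R * 'rV[R]_n) * 'rV[R]_n) : \bar R :=
    (kern p.1.2 p.2 * (h (row_cons p.1) - h (row_cons (p.1.1, p.2))) ^+ 2)%:E.
  apply: (measurable_fun_fubini_tonelli_F (m2 := bl n) f) => [|p]; last exact: k0.
  apply/measurable_EFinP; apply: measurable_funM.
    by apply: measurable_kern => //; exact: measurableT_comp.
  apply: measurable_funX; apply: measurable_funB; apply: (measurableT_comp mh).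
    by apply: (measurableT_comp mrc).
  apply: (measurableT_comp mrc); apply: measurable_fun_pair => //.
  exact: measurableT_comp.
pose T1 p : \bar R := (\int[leb]_b (kern1 p.1 b *
   (h (row_cons p) - h (row_cons (b, p.2))) ^+ 2)%:E)%E.
have T10 p : (0 <= T1 p)%E by apply: integral_ge0.
have mT1 : measurable_fun setT (T1 : measurableTypeR R * 'rV[R]_n -> \bar R).
  pose f (p : (measurableTypeR R * 'rV[R]_n) * measurableTypeR R) : \bar R :=
    (kern1 p.1.1 p.2 * (h (row_cons p.1) - h (row_cons (p.2, p.1.2))) ^+ 2)%:E.
  apply: (measurable_fun_fubini_tonelli_F (m2 := leb) f) => [|p]; last exact: k10.
  apply/measurable_EFinP; apply: measurable_funM.
    by apply: measurable_kern1 => //; exact: measurableT_comp.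
  apply: measurable_funX; apply: measurable_funB; apply: (measurableT_comp mh).
    by apply: (measurableT_comp mrc).
  apply: (measurableT_comp mrc); apply: measurable_fun_pair => //.
  exact: measurableT_comp.
pose T2 p : \bar R := (\int[leb]_b ((kern1 p.1 b)%:E * G (b, p.2)))%E.
have kG0 x y p : (0 <= (kern1 x y)%:E * G p)%E by rewrite mule_ge0 ?lee_fin ?kern1_ge0.
have T20 p : (0 <= T2 p)%E by apply: integral_ge0.
have mT2 : measurable_fun setT (T2 : measurableTypeR R * 'rV[R]_n -> \bar R).
  pose f (p : (measurableTypeR R * 'rV[R]_n) * measurableTypeR R) : \bar R :=
    ((kern1 p.1.1 p.2)%:E * G (p.2, p.1.2))%E.
  apply: (measurable_fun_fubini_tonelli_F (m2 := leb) f) => [|p]; last exact: kG0.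
  apply: emeasurable_funM.
    by apply/measurable_EFinP; apply: measurable_kern1 => //; exact: measurableT_comp.
  apply: (measurableT_comp mG); apply: measurable_fun_pair => //.
  exact: measurableT_comp.
have mk1 a : measurable_fun setT (fun b : measurableTypeR R => (kern1 a b)%:E : \bar R).
  by apply/measurable_EFinP; apply: measurable_kern1 => //; exact: measurable_cst.
have mk1' b : measurable_fun setT (fun a : measurableTypeR R => (kern1 a b)%:E : \bar R).
  by apply/measurable_EFinP; apply: measurable_kern1 => //; exact: measurable_cst.
pose c1 : R := 2 * r ^+ n.
have c10 : 0 <= c1 by rewrite /c1 mulr_ge0// exprn_ge0// ltW.
(* The first leg does not depend on [v], so integrating over [v] leaves the mass [r^n] of the
   kernel: hence [c1 = 2 r^n]. *)
have claim1 a w : (\int[bl n.+1]_Y (kern (row_cons (a, w)) Y * (h (row_cons (a, w)) - h Y) ^+ 2)%:E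
    <= c1%:E * T1 (a, w) + 2%:E * T2 (a, w))%E.
  have mFX : measurable_fun setT (fun Y : 'rV[R]_n.+1 =>
      (kern (row_cons (a, w)) Y * (h (row_cons (a, w)) - h Y) ^+ 2)%:E : \bar R).
    exact: (measurableT_comp mF (measurable_pair1 (row_cons (a, w)))).
  rewrite (ge0_integral_borel_lebesgueS mFX (fun Y => k0 _ _ _ _)).1.
  have mb1 : measurable_fun setT (fun b : measurableTypeR R => (kern1 a b *
      (h (row_cons (a, w)) - h (row_cons (b, w))) ^+ 2)%:E : \bar R).
    apply/measurable_EFinP; apply: measurable_funM.
      by apply: measurable_kern1 => //; exact: measurable_cst.
    apply: measurable_funX; apply: measurable_funB; first exact: measurable_cst.
    by apply: (measurableT_comp mh); apply: (measurableT_comp mrc).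
  have mb2 : measurable_fun setT (fun b : measurableTypeR R => (kern1 a b)%:E * G (b, w))%E.
    by apply: emeasurable_funM => //; apply: (measurableT_comp mG).
  rewrite /T1 /T2 -!ge0_integralZl//.
  rewrite -ge0_integralD//; last 4 first.
  - by move=> b _; rewrite mule_ge0.
  - exact: measurable_funeM.
  - by move=> b _; rewrite mule_ge0.
  - exact: measurable_funeM.
  apply: le_nnintegral => [b _|b _]; first exact: integral_ge0.
  pose D := h (row_cons (a, w)) - h (row_cons (b, w)).
  have mv : measurable_fun setT (fun v : 'rV[R]_n => (kern w v *
      (h (row_cons (b, w)) - h (row_cons (b, v))) ^+ 2)%:E : \bar R).
    apply/measurable_EFinP; apply: measurable_funM.
      by apply: measurable_kern => //; exact: measurable_cst.
    apply: measurable_funX; apply: measurable_funB; first exact: measurable_cst.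
    by apply: (measurableT_comp mh); apply: (measurableT_comp mrc).
  have mkv : measurable_fun setT (fun v : 'rV[R]_n => (kern w v)%:E : \bar R).
    by apply/measurable_EFinP; apply: measurable_kern => //; exact: measurable_cst.
  have kk0 : 0 <= 2 * kern1 a b by rewrite mulr_ge0 ?kern1_ge0.
  have kD0 : 0 <= 2 * (kern1 a b * D ^+ 2) by rewrite mulr_ge0// mulr_ge0 ?kern1_ge0 ?sqr_ge0.
  apply: (@le_trans _ _ (\int[bl n]_v ((2 * (kern1 a b * D ^+ 2))%:E * (kern w v)%:E +
     (2 * kern1 a b)%:E *
      (kern w v * (h (row_cons (b, w)) - h (row_cons (b, v))) ^+ 2)%:E))%E).
    apply: le_nnintegral => [v _|v _]; first exact: k0.
    rewrite kern_cons -!EFinM -EFinD lee_fin.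
    have -> : 2 * (kern1 a b * D ^+ 2) * kern w v + 2 * kern1 a b * (kern w v *
      (h (row_cons (b, w)) - h (row_cons (b, v))) ^+ 2) =
      (kern1 a b * kern w v) * (2 * D ^+ 2 + 2 *
      (h (row_cons (b, w)) - h (row_cons (b, v))) ^+ 2) by ring.
    rewrite ler_wpM2l ?mulr_ge0 ?kern_ge0 ?kern1_ge0// /D.
    have := sqr_ge0 ((h (row_cons (a, w)) - h (row_cons (b, w))) -
      (h (row_cons (b, w)) - h (row_cons (b, v)))).
    rewrite -subr_ge0 => hh; rewrite -subr_ge0; apply: le_trans hh _.
    by rewrite le_eqVlt; apply/orP; left; apply/eqP; ring.
  rewrite ge0_integralD//; last 4 first.
  - by move=> v _; rewrite mule_ge0// lee_fin kern_ge0.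
  - exact: measurable_funeM.
  - by move=> v _; rewrite mule_ge0.
  - exact: measurable_funeM.
  rewrite !ge0_integralZl//; last first.
    by move=> v _; rewrite lee_fin kern_ge0.
  rewrite (integral_kern r0 w).1 /c1 -!EFinM muleA -EFinM -/(G (b, w)).
  apply: leeD => //; rewrite lee_fin /D le_eqVlt; apply/orP; left; apply/eqP; ring.
have mPhi : measurable_fun setT (fun X : 'rV[R]_n.+1 =>
    \int[bl n.+1]_Y (kern X Y * (h X - h Y) ^+ 2)%:E)%E.
  exact: (measurable_fun_fubini_tonelli_F (m2 := bl n.+1) _ mF (fun z => k0 _ _ _ _)).
have Phi0 (X : 'rV[R]_n.+1) : (0 <= \int[bl n.+1]_Y (kern X Y * (h X - h Y) ^+ 2)%:E)%E.
  exact: integral_ge0.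
have [_ ->] := ge0_integral_borel_lebesgueS mPhi Phi0.
pose D0 w : \bar R := (\int[leb]_a (partial ord0 h (row_cons (a, w)) ^+ 2)%:E)%E.
pose Gw w : \bar R := (\int[leb]_b G (b, w))%E.
have mp i : measurable_fun setT (partial i h : 'rV[R]_n.+1 -> measurableTypeR R).
  exact: continuous_measurable_row.
have mD0 : measurable_fun setT D0.
  pose f (p : measurableTypeR R * 'rV[R]_n) : \bar R := (partial ord0 h (row_cons p) ^+ 2)%:E.
  apply: (measurable_fun_fubini_tonelli_G (m1 := leb) f) => [|p].
    by apply/measurable_EFinP; apply: measurable_funX; exact: (measurableT_comp (mp _)).
  by rewrite lee_fin sqr_ge0.
have mGw : measurable_fun setT Gw.
  exact: (measurable_fun_fubini_tonelli_G (m1 := leb) _ mG G0).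
have D00 w : (0 <= D0 w)%E by apply: integral_ge0 => a _; rewrite lee_fin sqr_ge0.
have Gw0 w : (0 <= Gw w)%E by apply: integral_ge0.
have r30 : 0 <= c1 * r ^+ 3 by rewrite mulr_ge0// exprn_ge0// ltW.
have r20 : 0 <= 2 * r by rewrite mulr_ge0// ltW.
(* The [T1] term is [kernel_energy1] on the line through [w]; in the [T2] term, integrating the
   window over [a] leaves the factor [r]. *)
apply: (@le_trans _ _ (\int[bl n]_w ((c1 * r ^+ 3)%:E * D0 w + (2 * r)%:E * Gw w))%E).
  apply: le_nnintegral => [w _|w _].
    by apply: integral_ge0 => a _; apply: integral_ge0.
  apply: (@le_trans _ _ (\int[leb]_a (c1%:E * T1 (a, w) + 2%:E * T2 (a, w)))%E).
    by apply: le_nnintegral => [a _|a _]; [exact: integral_ge0|exact: claim1].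
  have mT1w : measurable_fun setT (fun a : measurableTypeR R => T1 (a, w)).
    exact: (measurableT_comp mT1).
  have mT2w : measurable_fun setT (fun a : measurableTypeR R => T2 (a, w)).
    exact: (measurableT_comp mT2).
  rewrite ge0_integralD//; last 4 first.
  - by move=> a _; rewrite mule_ge0.
  - exact: measurable_funeM.
  - by move=> a _; rewrite mule_ge0.
  - exact: measurable_funeM.
  rewrite !ge0_integralZl//; apply: leeD.
    rewrite (EFinM c1) -muleA; apply: lee_wpmul2l; first by rewrite lee_fin.
    have [dw cw E] := C1c_slice0 w Ch.
    apply: le_trans (kernel_energy1 r0 dw cw) _.
    apply: lee_wpmul2l; first by rewrite lee_fin exprn_ge0// ltW.
    apply: le_nnintegral => [a _|a _]; first by rewrite lee_fin sqr_ge0.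
    by rewrite E.
  rewrite (EFinM 2) -muleA; apply: lee_wpmul2l; first by rewrite lee_fin.
  pose f (p : measurableTypeR R * measurableTypeR R) : \bar R :=
    ((kern1 p.1 p.2)%:E * G (p.2, w))%E.
  have mf : measurable_fun setT f.
    apply: emeasurable_funM.
      by apply/measurable_EFinP; apply: measurable_kern1.
    by apply: (measurableT_comp mG); apply: measurable_fun_pair.
  have f0 p : (0 <= f p)%E by exact: kG0.
  rewrite /T2 (fubini_tonelli (m1 := leb) (m2 := leb) f mf f0)/= /Gw.
  rewrite -ge0_integralZl//; last 2 first.
  - exact: (measurableT_comp mG).
  - by rewrite lee_fin ltW.
  apply: le_nnintegral => [b _|b _]; first by apply: integral_ge0 => a _; exact: f0.
  rewrite /f/= ge0_integralZr// ?(integral_kern1 r0 b).2//.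
  by move=> a _; rewrite lee_fin kern1_ge0.
rewrite ge0_integralD//; last 4 first.
- by move=> w _; rewrite mule_ge0.
- exact: measurable_funeM.
- by move=> w _; rewrite mule_ge0.
- exact: measurable_funeM.
rewrite !ge0_integralZl//.
have mpi i : measurable_fun setT (fun X : 'rV[R]_n.+1 => (partial i h X ^+ 2)%:E : \bar R).
  by apply/measurable_EFinP; apply: measurable_funX; exact: mp.
have mps : measurable_fun setT (fun X : 'rV[R]_n.+1 =>
    (\sum_(j < n) partial (lift ord0 j) h X ^+ 2)%:E : \bar R).
  by apply/measurable_EFinP; apply: measurable_sum => j; apply: measurable_funX; exact: mp.
have ps0 X : (0 <= (\sum_(j < n) partial (lift ord0 j) h X ^+ 2)%:E :> \bar R)%E.
  by rewrite lee_fin sumr_ge0// => j _; rewrite sqr_ge0.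
have p20 i X : (0 <= (partial i h X ^+ 2)%:E :> \bar R)%E by rewrite lee_fin sqr_ge0.
have -> : (\int[bl n]_w D0 w = \int[bl n.+1]_X (partial ord0 h X ^+ 2)%:E)%E.
  by rewrite (ge0_integral_borel_lebesgueS (mpi ord0) (p20 ord0)).2.
have hG : (\int[bl n]_w Gw w <= (2 ^+ n * r ^+ n.+2)%:E *
    \int[bl n.+1]_X (\sum_(j < n) partial (lift ord0 j) h X ^+ 2)%:E)%E.
  rewrite /Gw -(fubini_tonelli (m1 := leb) (m2 := bl n) _ mG G0).
  have cc0 : 0 <= 2 ^+ n * r ^+ n.+2 by rewrite mulr_ge0 ?exprn_ge0// ltW.
  rewrite (ge0_integral_borel_lebesgueS mps ps0).1 -ge0_integralZl//; last 2 first.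
  - pose f (p : measurableTypeR R * 'rV[R]_n) : \bar R :=
      (\sum_(j < n) partial (lift ord0 j) h (row_cons p) ^+ 2)%:E.
    apply: (measurable_fun_fubini_tonelli_F (m2 := bl n) f) => [|p]; last exact: ps0.
    exact: (measurableT_comp mps).
  - by move=> x _; apply: integral_ge0.
  apply: le_nnintegral => [b _|b _]; first exact: integral_ge0.
  have := IH _ (C1c_slice b Ch); rewrite /G/= => /le_trans; apply.
  apply: lee_wpmul2l; first by rewrite lee_fin.
  apply: le_nnintegral => [w _|w _].
    by rewrite lee_fin sumr_ge0// => j _; rewrite sqr_ge0.
  rewrite lee_fin le_eqVlt; apply/orP; left; apply/eqP; apply: eq_bigr => j _.
  by rewrite /partial (derive_rowS h b w j).2.
have -> : (\int[bl n.+1]_x (\sum_(i < n.+1) partial i h x ^+ 2)%:E =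
   \int[bl n.+1]_X (partial ord0 h X ^+ 2)%:E +
   \int[bl n.+1]_X (\sum_(j < n) partial (lift ord0 j) h X ^+ 2)%:E)%E.
  rewrite -ge0_integralD//; apply: eq_integral => X _.
  by rewrite big_ord_recl EFinD.
set A := (\int[bl n.+1]_X (partial ord0 h X ^+ 2)%:E)%E.
set B := (\int[bl n.+1]_X _%:E)%E in hG *.
have A0 : (0 <= A)%E by apply: integral_ge0.
have B0 : (0 <= B)%E by apply: integral_ge0.
rewrite [leRHS]ge0_muleDr//; apply: leeD.
  apply: lee_wpmul2r => //; rewrite lee_fin.
  have -> : 2 ^+ n.+1 * r ^+ n.+3 = 2 ^+ n * (c1 * r ^+ 3).
    by rewrite /c1 (exprS 2 n) -addn3 exprD; ring.
  by rewrite ler_peMl ?exprn_ege1 ?ler1n.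
apply: (@le_trans _ _ ((2 * r)%:E * ((2 ^+ n * r ^+ n.+2)%:E * B))%E).
  by apply: lee_wpmul2l; first by rewrite lee_fin.
rewrite muleA -EFinM; apply: lee_wpmul2r => //; rewrite lee_fin.
rewrite le_eqVlt; apply/orP; left; apply/eqP.
by rewrite (exprS 2 n) (exprS r n.+2); ring.
Qed.

End kernel_energy_row.

(** * Nash's inequality with a smooth competitor *)

Section nash.
Context {R : realType} {N : nat}.
Local Notation mu := (@lebesgue_n R N).
Local Notation bl := (@borel_lebesgue R N).
Local Notation L := (lebesgue_space R N).
Variable r : R.
Hypothesis r0 : 0 < r.
Local Notation kern := (kern r).

Let measurable_kernL d (T : measurableType d) (f g : T -> L) :
  measurable_fun setT f -> measurable_fun setT g ->
  measurable_fun setT (fun t => kern (f t : 'rV[R]_N) (g t)).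
Proof.
move=> mf mg; apply: measurable_kern.
  exact: (measurableT_comp measurable_to_borel mf).
exact: (measurableT_comp measurable_to_borel mg).
Qed.

Let kern_mass (x : L) : (\int[mu]_y (kern x y)%:E = (r ^+ N)%:E)%E /\
  (\int[mu]_y (kern y x)%:E = (r ^+ N)%:E)%E.
Proof.
have [k1 k2] := integral_kern r0 (x : 'rV[R]_N).
split; rewrite (ge0_integral_lebesgue_n (f := fun y => _))//;
  try by move=> y; rewrite lee_fin kern_ge0.
- by apply/measurable_EFinP; apply: measurable_kern => //; exact: measurable_cst.
- by apply/measurable_EFinP; apply: measurable_kern => //; exact: measurable_cst.
Qed.

Let measurable_k1 (x : L) : measurable_fun setT (fun y : L => (kern x y)%:E : \bar R).
Proof.
by apply/measurable_EFinP; apply: measurable_kernL => //; exact: measurable_cst.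
Qed.

Let measurable_k2 (x : L) : measurable_fun setT (fun y : L => (kern y x)%:E : \bar R).
Proof.
by apply/measurable_EFinP; apply: measurable_kernL => //; exact: measurable_cst.
Qed.

(** Each square meets the kernel mass [r^N] in the other variable, for [w y ^+ 2] after exchanging
    the integrals. *)
Let kern_int (w : L -> R) : measurable_fun setT w ->
  (\int[mu]_x \int[mu]_y (kern x y * (w x ^+ 2 + w y ^+ 2))%:E =
   (2 * r ^+ N)%:E * \int[mu]_x (w x ^+ 2)%:E)%E.
Proof.
move=> mw; have rN : 0 <= r ^+ N by rewrite exprn_ge0// ltW.
have w0 x : (0 <= (w x ^+ 2)%:E :> \bar R)%E by rewrite lee_fin sqr_ge0.
have mw2 : measurable_fun setT (fun x => (w x ^+ 2)%:E : \bar R).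
  by apply/measurable_EFinP; exact: measurable_funX.
have kw0 x y z : (0 <= (kern (x : L) y * w z ^+ 2)%:E :> \bar R)%E.
  by rewrite lee_fin mulr_ge0 ?kern_ge0 ?sqr_ge0.
have m2 : measurable_fun setT (fun z : L * L => (kern z.1 z.2 * w z.2 ^+ 2)%:E : \bar R).
  apply/measurable_EFinP; apply: measurable_funM; first exact: measurable_kernL.
  by apply: measurable_funX; exact: (measurableT_comp mw).
transitivity (\int[mu]_x ((r ^+ N)%:E * (w x ^+ 2)%:E +
    \int[mu]_y (kern x y * w y ^+ 2)%:E))%E.
  apply: eq_integral => x _; rewrite -(kern_mass x).1.
  rewrite -ge0_integralZr//; last by move=> y _; rewrite lee_fin kern_ge0.
  rewrite -ge0_integralD.
  - by apply: eq_integral => y _; rewrite -EFinM -EFinD mulrDr.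
  - exact: measurableT.
  - by move=> y _; rewrite -EFinM.
  - exact: emeasurable_funM.
  - by move=> y _; exact: kw0.
  - exact: (measurableT_comp m2 (measurable_pair1 x)).
rewrite ge0_integralD; first last.
- exact: (measurable_fun_fubini_tonelli_F (m2 := mu) _ m2 (fun z => kw0 _ _ _)).
- by move=> x _; apply: integral_ge0 => y _; exact: kw0.
- exact: measurable_funeM.
- by move=> x _; rewrite mule_ge0.
- exact: measurableT.
- rewrite ge0_integralZl; [|exact: measurableT|exact: mw2|by move=> x _; exact: w0|by rewrite lee_fin].
  rewrite (fubini_tonelli (m1 := mu) (m2 := mu)
    (fun z : L * L => (kern z.1 z.2 * w z.2 ^+ 2)%:E) m2 (fun z => kw0 _ _ _))/=.
  have -> : (\int[mu]_y \int[mu]_x (kern x y * w y ^+ 2)%:E =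
      (r ^+ N)%:E * \int[mu]_y (w y ^+ 2)%:E)%E.
    rewrite -ge0_integralZl//; apply: eq_integral => y _.
    rewrite -(kern_mass y).2 -ge0_integralZr//.
    by move=> x _; rewrite lee_fin kern_ge0.
  by rewrite -ge0_muleDl ?lee_fin// -EFinD; congr (_%:E * _)%E; ring.
Qed.

Let kernel_energyL (h : 'rV[R]_N -> R) : C1c h ->
  (\int[mu]_x \int[mu]_y (kern x y * (h x - h y) ^+ 2)%:E <=
   (2 ^+ N * r ^+ N.+2)%:E * \int[mu]_x (\sum_(i < N) partial i h x ^+ 2)%:E)%E.
Proof.
move=> Ch; have [[ch _] dh cph] := Ch.
have mh : measurable_fun setT (h : 'rV[R]_N -> measurableTypeR R).
  exact: continuous_measurable_row.
have k0 (x y : 'rV[R]_N) : (0 <= (kern x y * (h x - h y) ^+ 2)%:E :> \bar R)%E.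
  by rewrite lee_fin mulr_ge0 ?kern_ge0 ?sqr_ge0.
have mF : measurable_fun setT (fun z : 'rV[R]_N * 'rV[R]_N =>
    (kern z.1 z.2 * (h z.1 - h z.2) ^+ 2)%:E : \bar R).
  apply/measurable_EFinP; apply: measurable_funM; first exact: measurable_kern.
  by apply: measurable_funX; apply: measurable_funB; exact: (measurableT_comp mh).
have -> : (\int[mu]_x (\sum_(i < N) partial i h x ^+ 2)%:E =
    \int[bl]_x (\sum_(i < N) partial i h x ^+ 2)%:E)%E.
  rewrite (ge0_integral_lebesgue_n (f := fun x => (\sum_(i < N) partial i h x ^+ 2)%:E))//.
    apply/measurable_EFinP; apply: measurable_sum => i; apply: measurable_funX.
    exact: continuous_measurable_row.
  by move=> x; rewrite lee_fin sumr_ge0// => i _; rewrite sqr_ge0.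
have -> : (\int[mu]_x \int[mu]_y (kern x y * (h x - h y) ^+ 2)%:E =
    \int[bl]_x \int[bl]_y (kern x y * (h x - h y) ^+ 2)%:E)%E.
  rewrite -ge0_integral_lebesgue_n.
  - apply: eq_integral => x _.
    rewrite (ge0_integral_lebesgue_n (f := fun y => (kern x y * (h x - h y) ^+ 2)%:E))//.
    exact: (measurableT_comp mF (measurable_pair1 (x : 'rV[R]_N))).
  - exact: (measurable_fun_fubini_tonelli_F (m2 := bl) _ mF (fun z => k0 _ _)).
  - by move=> x; exact: integral_ge0.
exact: kernel_energy.
Qed.

(** Integrate [u(x)^2 + u(y)^2 = (u(x) - u(y))^2 + 2 u(x) u(y)] against the kernel. The product
    gives the squared L^1 norm since the kernel is at most 1. In the difference, [u] is replaced by
    [h] at both points: three summands, hence the 3, of which only the increment of [h] calls for a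
    gradient. *)
Lemma nash_setT (u : L -> R) (h : 'rV[R]_N -> R) : C1c h -> measurable_fun setT u ->
  ((2 * r ^+ N)%:E * \int[mu]_x (u x ^+ 2)%:E <=
   3%:E * ((2 * r ^+ N)%:E * \int[mu]_x ((u x - h x) ^+ 2)%:E +
     (2 ^+ N * r ^+ N.+2)%:E * \int[mu]_x (\sum_(i < N) partial i h x ^+ 2)%:E) +
   2%:E * (\int[mu]_x `|u x|%:E * \int[mu]_x `|u x|%:E))%E.
Proof.
move=> Ch mu_u; have [[ch _] dh cph] := Ch.
have mh : measurable_fun setT (h : L -> R).
  by apply: borel_measurable_fun_lebesgue; exact: continuous_measurable_row.
have muh : measurable_fun setT (fun x => u x - h x) by exact: measurable_funB.
have k0 (x y : L) z : 0 <= z -> (0 <= (kern x y * z)%:E :> \bar R)%E.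
  by move=> z0; rewrite lee_fin mulr_ge0 ?kern_ge0.
pose A (z : L * L) := (kern (z.1 : L) z.2 * ((u z.1 - h z.1) ^+ 2 + (u z.2 - h z.2) ^+ 2))%:E : \bar R.
pose B (z : L * L) := (kern (z.1 : L) z.2 * (h z.1 - h z.2) ^+ 2)%:E : \bar R.
pose C (z : L * L) := (`|u z.1| * `|u z.2|)%:E : \bar R.
have A0 z : (0 <= A z)%E by apply: k0; apply: addr_ge0; exact: sqr_ge0.
have B0 z : (0 <= B z)%E by apply: k0; exact: sqr_ge0.
have C0 z : (0 <= C z)%E by rewrite lee_fin mulr_ge0.
have mA : measurable_fun setT A.
  apply/measurable_EFinP; apply: measurable_funM; first exact: measurable_kernL.
  by apply: measurable_funD; apply: measurable_funX; exact: (measurableT_comp muh).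
have mB : measurable_fun setT B.
  apply/measurable_EFinP; apply: measurable_funM; first exact: measurable_kernL.
  by apply: measurable_funX; apply: measurable_funB; exact: (measurableT_comp mh).
have mC : measurable_fun setT C.
  apply/measurable_EFinP; apply: measurable_funM; apply: measurableT_comp => //;
    exact: (measurableT_comp mu_u).
have sec (f : L * L -> \bar R) x : measurable_fun setT f -> measurable_fun setT (fun y : L => f (x, y) : \bar R).
  by move=> mf; exact: (measurableT_comp mf (measurable_pair1 x)).
have intF (f : L * L -> \bar R) : measurable_fun setT f -> (forall z : L * L, 0 <= f z)%E ->
    measurable_fun setT (fun x => \int[mu]_y (f (x, y) : \bar R))%E.
  by move=> mf f0; exact: (measurable_fun_fubini_tonelli_F (m2 := mu) f mf f0).
rewrite -kern_int//.
apply: (@le_trans _ _ (\int[mu]_x \int[mu]_y (3%:E * (A (x, y) + B (x, y)) + 2%:E * C (x, y)))%E).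
  apply: le_nnintegral => [x _|x _].
    by apply: integral_ge0 => y _; apply: k0; apply: addr_ge0; exact: sqr_ge0.
  apply: le_nnintegral => [y _|y _]; first by apply: k0; apply: addr_ge0; exact: sqr_ge0.
  suff : kern x y * (u x ^+ 2 + u y ^+ 2) <=
    3 * (kern x y * ((u x - h x) ^+ 2 + (u y - h y) ^+ 2) + kern x y * (h x - h y) ^+ 2) +
    2 * (`|u x| * `|u y|) by rewrite -lee_fin.
  have k1 := kern_le1 r (x : 'rV[R]_N) y; have k00 := kern_ge0 r (x : 'rV[R]_N) y.
  set k := kern x y in k1 k00 *; set a := u x - h x; set b := u y - h y.
  have h1 : (u x - u y) ^+ 2 <= 3 * (a ^+ 2 + b ^+ 2 + (h x - h y) ^+ 2).
    have -> : u x - u y = a - b + (h x - h y) by rewrite /a /b; ring.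
    set c := h x - h y.
    have := sqr_ge0 (a + b); have := sqr_ge0 (a - c); have := sqr_ge0 (b + c); nra.
  have h2 : k * (u x * u y) <= `|u x| * `|u y|.
    have a0 : 0 <= `|u x| * `|u y| by rewrite mulr_ge0.
    apply: le_trans (_ : k * (`|u x| * `|u y|) <= _); last by rewrite ler_piMl.
    by apply: ler_wpM2l => //; rewrite -normrM ler_norm.
  have h3 := ler_wpM2l k00 h1.
  have -> : k * (u x ^+ 2 + u y ^+ 2) = k * (u x - u y) ^+ 2 + 2 * (k * (u x * u y)) by ring.
  apply: le_trans (lerD h3 (ler_wpM2l _ h2)) _ => //.
  by rewrite le_eqVlt; apply/orP; left; apply/eqP; ring.
have three : (0 <= 3%:E :> \bar R)%E by rewrite lee_fin.
have two : (0 <= 2%:E :> \bar R)%E by rewrite lee_fin.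
have AB0 z : (0 <= A z + B z)%E by rewrite adde_ge0.
have mAB : measurable_fun setT (fun z => A z + B z)%E by exact: emeasurable_funD.
have -> : (\int[mu]_x \int[mu]_y (3%:E * (A (x, y) + B (x, y)) + 2%:E * C (x, y)) =
   3%:E * (\int[mu]_x \int[mu]_y A (x, y) + \int[mu]_x \int[mu]_y B (x, y)) +
   2%:E * \int[mu]_x \int[mu]_y C (x, y))%E.
  rewrite -ge0_integralD; last 5 first.
  - exact: measurableT.
  - by move=> x _; exact: integral_ge0.
  - exact: intF.
  - by move=> x _; exact: integral_ge0.
  - exact: intF.
  have mAB1 : measurable_fun setT
    (fun x => \int[mu]_y A (x, y) + \int[mu]_y B (x, y))%E.
    by apply: emeasurable_funD; exact: intF.
  rewrite -(@ge0_integralZl _ _ _ mu _ measurableT _ mAB1 3%:E); last 2 first.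
  - by move=> x _; rewrite adde_ge0//; exact: integral_ge0.
  - exact: three.
  rewrite -(@ge0_integralZl _ _ _ mu _ measurableT _ (intF _ mC C0) 2%:E); last 2 first.
  - by move=> x _; exact: integral_ge0.
  - exact: two.
  rewrite -ge0_integralD; last 5 first.
  - exact: measurableT.
  - by move=> x _; rewrite mule_ge0// adde_ge0//; exact: integral_ge0.
  - exact: measurable_funeM.
  - by move=> x _; rewrite mule_ge0//; exact: integral_ge0.
  - by apply: measurable_funeM; exact: intF.
  apply: eq_integral => x _.
  rewrite ge0_integralD; last 5 first.
  - exact: measurableT.
  - by move=> y _; rewrite mule_ge0.
  - by apply: measurable_funeM; exact: (sec _ x mAB).
  - by move=> y _; rewrite mule_ge0.
  - by apply: measurable_funeM; exact: sec.
  rewrite ge0_integralZl; [|exact: measurableT|exact: (sec _ x mAB)|by move=> y _; exact: AB0|exact: three].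
  rewrite ge0_integralZl; [|exact: measurableT|exact: (sec _ x mC)|by move=> y _; exact: C0|exact: two].
  rewrite ge0_integralD; [by []|exact: measurableT|by move=> y _; exact: A0|exact: (sec _ x mA)|by move=> y _; exact: B0|exact: (sec _ x mB)].
apply: leeD.
  apply: lee_wpmul2l; first exact: three.
  apply: leeD; first by rewrite /A/= kern_int.
  by rewrite /B/=; exact: (kernel_energyL Ch).
apply: lee_wpmul2l; first exact: two.
rewrite /C/= le_eqVlt; apply/orP; left; apply/eqP.
have mabs : measurable_fun setT (fun x => `|u x|%:E : \bar R).
  by apply/measurable_EFinP; exact: measurableT_comp.
rewrite -ge0_integralZr; [|exact: measurableT|exact: mabs|by []|exact: integral_ge0].
apply: eq_integral => x _.
rewrite -ge0_integralZl; [|exact: measurableT|exact: mabs|by []|by []].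
by apply: eq_integral => y _; rewrite EFinM.
Qed.

End nash.

(** * Truncations, test functions and the quadratic form *)

Section lnorm.
Context d (T : measurableType d) (R : realType).
Variables (mu : {measure set T -> \bar R}) (D : set T) (mD : measurable D).
Implicit Types u v : T -> R.

Local Notation norm p u := ('N[mu]_p[EFin \o (u \_ D)])%E.

Let integral_pow u (p : R) : 0 < p ->
  (\int[mu]_x (`|(EFin \o (u \_ D)) x| `^ p) = \int[mu]_(x in D) (`|u x| `^ p)%:E)%E.
Proof.
move=> p0; rewrite [RHS]integral_mkcond; apply: eq_integral => x _ /=.
rewrite !patchE; case: ifP => _ //.
by congr EFin; rewrite normr0 powR0 ?gt_eqF.
Qed.

Lemma sqint_Lnorm2 u : sqint mu D u ->
  norm 2%:E u = (Num.sqrt (inner mu D u u))%:E.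
Proof.
move=> su; rewrite unlock integral_pow//.
rewrite (_ : (\int[mu]_(x in D) _)%E = (inner mu D u u)%:E).
  by rewrite poweR_EFin powR12_sqrt// inner_ge0.
rewrite inner_integral//; apply: eq_integral => x _.
by rewrite powR_mulrn// real_normK// num_real.
Qed.

Lemma Lnorm2_sqint u : measurable_fun D u -> (norm 2%:E u < +oo)%E -> sqint mu D u.
Proof.
move=> mu_ h; split => //; apply/integrableP; split.
  by apply/measurable_EFinP; exact: measurable_funX.
move: h; rewrite unlock integral_pow// => h.
rewrite (_ : integral _ _ _ = \int[mu]_(x in D) (`|u x| `^ 2)%:E)%E.
  rewrite ltey; apply/eqP => E; move: h; rewrite E.
  by rewrite poweRyr ?invr_eq0// ltxx.
apply: eq_integral => x _; rewrite powR_mulrn//= normrX//.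
Qed.

Lemma Lnormoo_ae u : (norm +oo u < +oo)%E ->
  {ae mu, forall x, D x -> `|u x| <= fine (norm +oo u)}.
Proof.
move=> h; have [mu0|mu0] := ltP 0%E (mu setT).
  have E : norm +oo%E u = ess_sup mu (abse \o (EFin \o (u \_ D))).
    by rewrite unlock mu0.
  have := ess_sup_ge mu (abse \o (EFin \o (u \_ D))); rewrite -E.
  apply: filterS => x + Dx; rewrite /= patchE mem_set// => hx.
  rewrite -lee_fin fineK//; rewrite ge0_fin_numE//; exact: Lnorm_ge0.
(* When the whole space is null the norm is not defined as an essential supremum, but then every
   property holds almost everywhere. *)
exists setT; split => //; apply/eqP; rewrite eq_le mu0 measure_ge0//.
Qed.

Lemma ae_Lnormoo u (c : R) : 0 <= c ->
  {ae mu, forall x, D x -> `|u x| <= c} -> (norm +oo u <= c%:E)%E.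
Proof.
move=> c0 uc; rewrite unlock; case: ifPn => // mu0.
apply/ess_supP; apply: filterS uc => x h /=; rewrite patchE.
case: ifPn => [/set_mem Dx|_].
  by rewrite -[X in (X <= _)%E]/(`|u x|%:E) lee_fin h.
by rewrite -[X in (X <= _)%E]/(`|0 : R|%:E) normr0 lee_fin.
Qed.

Lemma sqint_ae_le u v (M : R) : measurable_fun D u -> sqint mu D v -> 0 <= M ->
  {ae mu, forall x, D x -> `|u x| <= M * `|v x|} ->
  sqint mu D u /\ inner mu D u u <= M ^+ 2 * inner mu D v v.
Proof.
move=> mu_ sv M0 uv; have [mv iv] := sv.
have h : (\int[mu]_(x in D) (u x ^+ 2)%:E <= (M ^+ 2 * inner mu D v v)%:E)%E.
  rewrite EFinM inner_integral// -ge0_integralZl_EFin//; last 3 first.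
  - by move=> x _; rewrite lee_fin sqr_ge0.
  - by apply/measurable_EFinP; exact: measurable_funX.
  - exact: sqr_ge0.
  apply: ae_ge0_le_integral => //.
  - by move=> x _; rewrite lee_fin sqr_ge0.
  - by apply/measurable_EFinP; exact: measurable_funX.
  - by move=> x _; rewrite -EFinM lee_fin mulr_ge0 ?sqr_ge0.
  - by apply: measurable_funeM; apply/measurable_EFinP; exact: measurable_funX.
  apply: filterS uv => x xuv Dx; rewrite -EFinM lee_fin -exprMn.
  rewrite -(real_normK (num_real (u x))) -(real_normK (num_real (M * _))).
  by rewrite ler_pXn2r ?nnegrE// normrM (ger0_norm M0) xuv.
have su : sqint mu D u.
  split => //; apply/integrableP; split.
    by apply/measurable_EFinP; exact: measurable_funX.
  apply: le_lt_trans (ltry (M ^+ 2 * inner mu D v v)); apply: le_trans h.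
  by apply: le_nnintegral => x _ //=; rewrite lee_fin ger0_norm// sqr_ge0.
by split => //; rewrite -lee_fin inner_integral.
Qed.

Lemma ae_inner u u' v v' : sqint mu D u -> sqint mu D v -> sqint mu D u' ->
  sqint mu D v' -> {ae mu, forall x, D x -> u x * v x = u' x * v' x} ->
  inner mu D u v = inner mu D u' v'.
Proof.
move=> su sv su' sv' h; congr fine; apply: ae_eq_integral => //.
- by have /integrableP[] := sqint_mul mD su sv.
- by have /integrableP[] := sqint_mul mD su' sv'.
- by apply: filterS h => x xh Dx; rewrite xh.
Qed.

Lemma inner_eq0 u v : sqint mu D u -> sqint mu D v -> inner mu D u u = 0 ->
  inner mu D u v = 0.
Proof.
move=> su sv u0; have := cauchy_schwarz mD su sv.
rewrite u0 mul0r => h; apply/eqP; rewrite -sqrf_eq0; apply/eqP/le_anti.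
by rewrite h sqr_ge0.
Qed.

End lnorm.

Lemma derive_path {R : realType} {V : normedModType R} (f : V -> R) (x v : V) :
  (derivable f x v <-> derivable (fun t : R => f (t *: v + x)) 0 1) /\
  'D_v f x = 'D_1 (fun t : R => f (t *: v + x)) 0.
Proof.
rewrite /derivable /derive.
have -> : (fun t : R => t^-1 *: (((fun t => f (t *: v + x)) \o shift 0) (t *: (1 : R)) -
     f (0 *: v + x))) = (fun t : R => t^-1 *: ((f \o shift x) (t *: v) - f x)).
  by apply/funext => t; rewrite /= scale0r add0r addr0 -[t *: 1]/(t * 1) mulr1.
by [].
Qed.

(** Only derivability along one direction is at hand, not differentiability, so the chain rule is
    reduced to one variable along the line through [x]. *)
Lemma derive_chain {R : realType} {V : normedModType R} (f : V -> R) (g : R -> R)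
    (x v : V) (dg : R) : derivable f x v -> is_derive (f x) 1 g dg ->
  derivable (fun y => g (f y)) x v /\ 'D_v (fun y => g (f y)) x = dg * 'D_v f x.
Proof.
move=> df dgf; have [[h1 _] e1] := derive_path f x v.
have [[_ h2] e2] := derive_path (fun y => g (f y)) x v.
pose p t := f (t *: v + x).
have p0 : p 0 = f x by rewrite /p scale0r add0r.
have dp : is_derive (0 : R) 1 p ('D_1 p 0) by apply: DeriveDef => //; exact: h1.
have dgp : is_derive (p 0) 1 g dg by rewrite p0.
have [d3 e3] := @is_derive1_comp R g p 0 dg ('D_1 p 0) dgp dp.
by split; [apply: h2|rewrite e2 e1].
Qed.

(** * Stability of smooth functions under algebraic operations and square roots *)

Section smooth_algebra.
Context {R : realType} {N : nat}.
Local Notation E := 'rV[R]_N.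
Implicit Types f g : E -> R.

(** [smooth] quantifies over sequences of directions. Splitting off the derivative taken first gives
    a recursion on the order, so that products and compositions are treated by induction on [k]. *)
Fixpoint smoothn k f : Prop := continuous f /\
  if k is k'.+1 then forall i : 'I_N,
    (forall x, derivable f x (delta_mx 0 i)) /\ smoothn k' (partial i f)
  else True.

Lemma smoothn_continuous k f : smoothn k f -> continuous f.
Proof. by case: k => [|k] []. Qed.

Lemma smoothnP f : smooth f <-> forall k, smoothn k f.
Proof.
split=> [sf k|].
  elim: k f sf => [|k IH] f sf; first by split => //; exact: (sf [::]).1.
  split=> [|i]; first exact: (sf [::]).1.
  split=> [x|]; first exact: (sf [::]).2.
  by apply: IH => s; have := sf (rcons s i); rewrite foldr_rcons.
move=> sf s; elim/last_ind: s f sf => [|s i IH] f sf.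
  split=> /=; first exact: (sf 0%N).1.
  by move=> i x; have [_ /(_ i)[]] := sf 1%N.
by rewrite foldr_rcons; apply: IH => k; have [_ /(_ i)[]] := sf k.+1.
Qed.

Lemma smoothnS k f : smoothn k.+1 f -> smoothn k f.
Proof.
elim: k f => [|k IH] f [cf df]; split => // i.
by have [d1 d2] := df i; split => //; exact: IH.
Qed.

Lemma smoothn_cst k (c : R) : smoothn k (fun=> c).
Proof.
have cc (c' : R) : continuous (fun _ : E => c') by exact: cst_continuous.
elim: k c => [|k IH] c; first by split.
split=> [|i]; first exact: cc.
split=> [x|]; first exact: derivable_cst.
have -> : partial i (fun _ : E => c) = fun=> 0; last exact: IH.
by apply/funext => x; exact: derive_cst.
Qed.

Lemma smoothnD k f g : smoothn k f -> smoothn k g -> smoothn k (fun x => f x + g x).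
Proof.
have cD (f' g' : E -> R) : continuous f' -> continuous g' -> continuous (fun x => f' x + g' x).
  by move=> hf hg x; exact: (cvgD (hf x) (hg x)).
elim: k f g => [|k IH] f g [cf df] [cg dg]; first by split => //; exact: cD.
split=> [|i]; first exact: cD.
have [d1 d2] := df i; have [d3 d4] := dg i.
split=> [x|]; first exact: derivableD.
have -> : partial i (fun x => f x + g x) = fun x => partial i f x + partial i g x.
  by apply/funext => x; exact: deriveD.
exact: IH.
Qed.

Lemma smoothnM k f g : smoothn k f -> smoothn k g -> smoothn k (fun x => f x * g x).
Proof.
have cM (f' g' : E -> R) : continuous f' -> continuous g' -> continuous (fun x => f' x * g' x).
  by move=> hf hg x; exact: (cvgM (hf x) (hg x)).
elim: k f g => [|k IH] f g sf sg.
  by split => //; apply: cM; [exact: (smoothn_continuous sf)|exact: (smoothn_continuous sg)].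
split=> [|i].
  by apply: cM; [exact: (smoothn_continuous sf)|exact: (smoothn_continuous sg)].
have [_ /(_ i)[d1 d2]] := sf; have [_ /(_ i)[d3 d4]] := sg.
split=> [x|]; first exact: derivableM.
have -> : partial i (fun x => f x * g x) =
    fun x => f x * partial i g x + g x * partial i f x.
  by apply/funext => x; exact: deriveM.
by apply: smoothnD; apply: IH => //; exact: smoothnS.
Qed.

(** The derivative is a polynomial in [rsqrt] itself, so the induction on the order of smoothness
    closes. The square root is then recovered as [t] times [rsqrt t]. *)
Definition rsqrt (t : R) := (Num.sqrt t)^-1.

Lemma is_derive_rsqrt (t : R) : 0 < t -> is_derive t 1 rsqrt (- 2^-1 * rsqrt t ^+ 3).
Proof.
move=> t0; have st0 : Num.sqrt t != 0 by rewrite gt_eqF// sqrtr_gt0.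
apply: is_derive_eq; first exact: (is_deriveV st0 (is_derive1_sqrt t0)).
rewrite /rsqrt -[_ *: _]/(_ * _); field; exact: st0.
Qed.

Lemma smoothn_rsqrt k f : (forall x, 0 < f x) -> smoothn k f ->
  smoothn k (fun x => rsqrt (f x)).
Proof.
move=> f0; have cr (h : E -> R) : continuous h -> (forall x, 0 < h x) ->
    continuous (fun x => rsqrt (h x)).
  move=> ch h0 x; have s0 : Num.sqrt (h x) != 0 by rewrite gt_eqF// sqrtr_gt0.
  exact: (cvgV s0 (continuous_comp (ch x) (@sqrt_continuous R (h x)))).
elim: k => [|k IH] sf; first by split => //; apply: cr => //; exact: smoothn_continuous sf.
split=> [|i]; first by apply: cr => //; exact: smoothn_continuous sf.
have [_ /(_ i)[d1 d2]] := sf.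
split=> [x|]; first exact: (derive_chain (d1 x) (is_derive_rsqrt (f0 x))).1.
have -> : partial i (fun x => rsqrt (f x)) =
    fun x => - 2^-1 * (rsqrt (f x) * (rsqrt (f x) * rsqrt (f x))) * partial i f x.
  apply/funext => x; rewrite /partial (derive_chain (d1 x) (is_derive_rsqrt (f0 x))).2.
  by congr (_ * _); rewrite !exprS expr0 mulr1.
have sr := IH (smoothnS sf).
apply: smoothnM => //; apply: smoothnM; first exact: smoothn_cst.
by apply: smoothnM => //; exact: smoothnM.
Qed.

Lemma smoothn_sqrt k f : (forall x, 0 < f x) -> smoothn k f ->
  smoothn k (fun x => Num.sqrt (f x)).
Proof.
move=> f0 sf; have -> : (fun x => Num.sqrt (f x)) = fun x => f x * rsqrt (f x).
  apply/funext => x; rewrite /rsqrt -{2}[f x](sqr_sqrtr (ltW (f0 x))) expr2 mulfK//.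
  by rewrite gt_eqF// sqrtr_gt0.
by apply: smoothnM => //; exact: smoothn_rsqrt.
Qed.

End smooth_algebra.

(** * Truncation at a level and its smooth approximation *)

Section clamp.
Context {R : realType}.
Implicit Types (k e t u : R).

(** For [k >= 0] this is the projection onto [[-k, k]]. Written with absolute values it is smoothed
    by replacing each [|a|] with [sqrt(a^2 + e^2)], which yields [sclamp]. *)
Definition clamp k t : R := (`|t + k| - `|t - k|) / 2.

Definition sclamp k e t : R :=
  (Num.sqrt ((t + k) ^+ 2 + e ^+ 2) - Num.sqrt ((t - k) ^+ 2 + e ^+ 2)) / 2.

Lemma clamp_cases k t : 0 <= k ->
  [\/ t < - k /\ clamp k t = - k, - k <= t <= k /\ clamp k t = t |
      k < t /\ clamp k t = k].
Proof.
move=> k0; rewrite /clamp; have [tk|tk] := ltP t (- k).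
  by constructor 1; split => //; rewrite (ltr0_norm (x := t + k)) ?(ltr0_norm (x := t - k)); lra.
have [kt|kt] := leP t k.
  constructor 2; split; first by apply/andP; split.
  by rewrite (ger0_norm (x := t + k)) ?(ler0_norm (x := t - k)); lra.
by constructor 3; split => //; rewrite (ger0_norm (x := t + k)) ?(gtr0_norm (x := t - k)); lra.
Qed.

Lemma clamp_lipschitz k t u : 0 <= k -> `|clamp k t - clamp k u| <= `|t - u|.
Proof.
move=> k0; wlog tu : t u / u <= t.
  move=> h; have [/h//|/ltW/h] := leP u t.
  by rewrite distrC (distrC u).
rewrite (ger0_norm (x := t - u)) ?subr_ge0//.
have [[h ->]|[/andP[h h'] ->]|[h ->]] := clamp_cases t k0;
have [[g ->]|[/andP[g g'] ->]|[g ->]] := clamp_cases u k0;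
rewrite ler_norml; apply/andP; split; lra.
Qed.

Lemma sqrt_dist (a e : R) : 0 <= e -> `|a| <= Num.sqrt (a ^+ 2 + e ^+ 2) <= `|a| + e.
Proof.
move=> e0; have s0 : 0 <= a ^+ 2 + e ^+ 2 by rewrite addr_ge0 ?sqr_ge0.
rewrite -{1}(sqrtr_sqr a) ler_sqrt// lerDl sqr_ge0/=.
rewrite -(ler_pXn2r (n := 2)) ?nnegrE ?sqrtr_ge0 ?addr_ge0// sqr_sqrtr//.
rewrite sqrrD real_normK ?num_real// lerD2r lerDl mulrn_wge0// mulr_ge0//.
Qed.

Lemma sclamp_dist k e t : 0 <= e -> `|sclamp k e t - clamp k t| <= e.
Proof.
move=> e0; have /andP[a1 a2] := sqrt_dist (t + k) e0.
have /andP[b1 b2] := sqrt_dist (t - k) e0.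
rewrite /sclamp /clamp; set s1 := Num.sqrt _ in a1 a2 *; set s2 := Num.sqrt _ in b1 b2 *.
rewrite ler_norml; apply/andP; split; lra.
Qed.

Lemma sclamp0 k e : sclamp k e 0 = 0.
Proof. by rewrite /sclamp add0r sub0r sqrrN subrr mul0r. Qed.

(** The derivative is half the difference of two numbers of absolute value at most 1. This bound is
    what makes the form decrease. *)
Lemma is_derive_sclamp k e t : 0 < e ->
  exists2 d, `|d| <= 1 & is_derive t 1 (sclamp k e) d.
Proof.
move=> e0; pose q (b : R) := (t + b) ^+ 2 + e ^+ 2.
have q0 b : 0 < q b by rewrite ltr_wpDl ?sqr_ge0 ?exprn_gt0.
have dq b : is_derive t 1 (fun s : R => Num.sqrt ((s + b) ^+ 2 + e ^+ 2))
    ((t + b) / Num.sqrt (q b)).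
  have d1 : is_derive t 1 (fun s : R => (s + b) ^+ 2 + e ^+ 2) (2 * (t + b)).
    by apply: is_derive_eq; rewrite !addr0 -[(t + b) *: 1]/((t + b) * 1); ring.
  pose p (s : R) := (s + b) ^+ 2 + e ^+ 2.
  have d2 : is_derive (p t) 1 Num.sqrt (2 * Num.sqrt (q b))^-1.
    exact: is_derive1_sqrt (q0 b).
  have d3 := @is_derive1_comp R Num.sqrt p t _ _ d2 d1.
  apply: is_derive_eq d3 _; field.
  by rewrite gt_eqF// sqrtr_gt0.
exists (((t + k) / Num.sqrt (q k) - (t - k) / Num.sqrt (q (- k))) / 2).
  have b1 b : `|(t + b) / Num.sqrt (q b)| <= 1.
    rewrite normrM normfV (ger0_norm (sqrtr_ge0 _)) ler_pdivrMr ?sqrtr_gt0// mul1r.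
    by have /andP[] := sqrt_dist (t + b) (ltW e0).
  have := b1 k; have := b1 (- k); rewrite !ler_norml => /andP[h1 h2] /andP[h3 h4].
  apply/andP; split; lra.
have := is_deriveB (dq k) (dq (- k)) => db.
rewrite /sclamp.
have := is_deriveZ (2^-1 : R) db => dz.
have -> : (fun t0 : R => (Num.sqrt ((t0 + k) ^+ 2 + e ^+ 2) -
   Num.sqrt ((t0 - k) ^+ 2 + e ^+ 2)) / 2) = (2^-1 \*: ((fun s : R => Num.sqrt ((s + k) ^+ 2 + e ^+ 2)) - (fun s : R => Num.sqrt ((s - k) ^+ 2 + e ^+ 2)))).
  by apply/funext => s; rewrite mulrC.
by apply: is_derive_eq dz _; rewrite -[_ *: _]/(_ * _) mulrC.
Qed.

End clamp.

(** * Test functions and integration by parts *)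

Section test_functions.
Context {R : realType} {N : nat}.
Local Notation E := 'rV[R]_N.
Local Notation mu := (@lebesgue_n R N).
Variable Omega : set E.
Implicit Types (f g h : E -> R).

Lemma ler_row_norm (v : E) i : `|v ord0 i| <= `|v|.
Proof.
by rewrite [leRHS]/Num.norm /= mx_normrE; apply/bigmax_geP; right; exists (ord0, i).
Qed.

Lemma bounded_sub_cube (K : set E) : bounded_set K -> exists M, K `<=` cube N M.
Proof.
move=> [M [_ hM]]; exists (`|M| + 1) => v Kv i; apply: le_trans (ler_row_norm v i) _.
by apply: hM => //; rewrite (le_lt_trans (ler_norm M))// ltrDl.
Qed.

Lemma Cc_sqint f (D : set E) : measurable (D : set (lebesgue_space R N)) ->
  Cc f -> sqint mu D f.
Proof.
move=> mD Cf; have [cf [M f0]] := Cf.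
have C2 : Cc (fun x => f x ^+ 2).
  split; last by exists M => v /f0 ->; rewrite expr0n.
  by move=> x; exact: (cvgM (cf x) (cf x)).
split.
  apply: measurable_funTS; apply: borel_measurable_fun_lebesgue.
  exact: continuous_measurable_row.
have [i2 _] := integral_lebesgue_n (Cc_integrable C2).
by apply: integrableS i2.
Qed.

Lemma C1cM f g : C1c f -> C1c g -> C1c (fun x => f x * g x).
Proof.
move=> [[cf [M f0]] df cpf] [[cg _] dg cpg].
split; first split.
- by move=> x; exact: (cvgM (cf x) (cg x)).
- by exists M => v /f0 ->; rewrite mul0r.
- by move=> i x; exact: derivableM.
move=> i; have -> : partial i (fun x => f x * g x) =
    fun x => f x * partial i g x + g x * partial i f x.
  by apply/funext => x; exact: deriveM.
move=> x; exact: (cvgD (cvgM (cf x) (cpg i x)) (cvgM (cg x) (cpf i x))).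
Qed.

Lemma test_out f x : test_function Omega f -> ~ Omega x -> f x = 0.
Proof.
move=> [_ _ sO] nOx; apply: contrapT => /eqP fx; apply: nOx; apply: sO.
exact: subset_closure.
Qed.

Lemma test_partial_out f i x : test_function Omega f -> ~ Omega x -> partial i f x = 0.
Proof.
move=> [_ _ sO] nOx; apply: derive_near0.
have : nbhs x (~` closure [set y | f y != 0]).
  apply: open_nbhs_nbhs; split; first by rewrite openC; exact: closed_closure.
  by move=> /sO.
apply: filterS => y ny; apply: contrapT => /eqP fy; apply: ny.
exact: subset_closure.
Qed.

Lemma test_C1c f : test_function Omega f -> C1c f.
Proof.
move=> [sf cf _]; have [M hM] := bounded_sub_cube (compact_bounded cf).
split; first split.
- exact: (sf [::]).1.
- exists M => v nv; apply: contrapT => /eqP fv; apply: nv; apply: hM.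
  exact: subset_closure.
- by move=> i x; exact: (sf [::]).2.
- by move=> i; exact: (sf [:: i]).1.
Qed.

Lemma test_sub f g : test_function Omega g -> smooth f ->
  (forall x, g x = 0 -> f x = 0) -> test_function Omega f.
Proof.
move=> [_ cg sg] sf fg; have sub : closure [set x | f x != 0] `<=` closure [set x | g x != 0].
  apply: closure_subset => x /=; apply: contraNN => /eqP /fg ->//.
split => //; last exact: subset_trans sg.
by apply: subclosed_compact sub => //; exact: closed_closure.
Qed.

Lemma test0 : test_function Omega (fun=> 0).
Proof.
have E0 : [set x : E | (fun=> 0 : R) x != 0] = set0.
  by apply/seteqP; split => x //=; rewrite eqxx.
split; first by apply/smoothnP => k; exact: smoothn_cst.
- by rewrite E0 closure0; exact: compact0.
- by rewrite E0 closure0.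
Qed.

Lemma test_lin (a b : R) f g : test_function Omega f -> test_function Omega g ->
  test_function Omega (fun x => a * f x + b * g x).
Proof.
move=> [sf cf of_] [sg cg og].
have sub : closure [set x | a * f x + b * g x != 0] `<=`
    closure [set x | f x != 0] `|` closure [set x | g x != 0].
  rewrite -closureU; apply: closure_subset => x /= h.
  have [f0|f0] := eqVneq (f x) 0; last by left.
  have [g0|g0] := eqVneq (g x) 0; last by right.
  by move: h; rewrite f0 g0 !mulr0 addr0 eqxx.
split.
- apply/smoothnP => k; apply: smoothnD; apply: smoothnM; try exact: smoothn_cst.
  + by move/smoothnP : sf.
  + by move/smoothnP : sg.
- apply: (subclosed_compact _ (compactU cf cg) sub); exact: closed_closure.
- by apply: subset_trans sub _ => x [/of_|/og].
Qed.

Lemma partial_lin (a b : R) f g i x : C1c f -> C1c g ->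
  partial i (fun x => a * f x + b * g x) x = a * partial i f x + b * partial i g x.
Proof.
move=> [_ df _] [_ dg _]; rewrite /partial.
have -> : (fun x => a * f x + b * g x) = (a \*: f) + (b \*: g) by [].
by rewrite deriveD ?deriveZ//; exact: derivableZ.
Qed.

Hypotheses (oO : open Omega) (bO : bounded_set Omega).

Lemma measurable_Omega : measurable (Omega : set (lebesgue_space R N)).
Proof. by apply: borel_measurable_lebesgue; exact: open_measurable_row. Qed.

Lemma Omega_lty : (mu Omega < +oo)%E.
Proof.
have [M hM] := bounded_sub_cube bO.
rewrite lebesgue_nE; last exact: open_measurable_row.
apply: le_lt_trans (cube_lty N M); apply: le_measure => //.
- by rewrite inE; exact: open_measurable_row.
- by rewrite inE; exact: measurable_cube.
Qed.

Lemma test_sqint f : test_function Omega f -> sqint mu Omega f.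
Proof. by move=> /test_C1c[Cf _ _]; apply: Cc_sqint => //; exact: measurable_Omega. Qed.

Lemma test_partial_sqint f i : test_function Omega f -> sqint mu Omega (partial i f).
Proof.
by move=> /test_C1c Cf; apply: Cc_sqint; [exact: measurable_Omega|exact: Cc_partial].
Qed.

Lemma test_ibp f g i : test_function Omega f -> test_function Omega g ->
  inner mu Omega f (partial i g) = - inner mu Omega (partial i f) g.
Proof.
move=> tf tg; have mO := measurable_Omega.
have Cfg := C1cM (test_C1c tf) (test_C1c tg).
have [_ df _] := test_C1c tf; have [_ dg _] := test_C1c tg.
have [_ E0] := integral_lebesgue_n (Cc_integrable (Cc_partial i Cfg)).
rewrite integral_partial// in E0.
apply/eqP; rewrite -addr_eq0 /inner -RintegralD//; last 2 first.
- exact: (sqint_mul mO (test_sqint tf) (test_partial_sqint i tg)).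
- exact: (sqint_mul mO (test_partial_sqint i tf) (test_sqint tg)).
apply/eqP; rewrite -[RHS]/(fine 0%E) -E0 /Rintegral integral_mkcond; congr fine.
have P x : partial i (fun x => f x * g x) x = f x * partial i g x + partial i f x * g x.
  by rewrite [LHS]deriveM// (mulrC (partial i f x)).
apply: eq_integral => x _; rewrite patchE [RHS]/= P; case: ifPn => // /negP.
by rewrite inE => nOx; rewrite (test_out tf nOx) (test_out tg nOx) mul0r mulr0 addr0.
Qed.

End test_functions.

Section inner_extra.
Context d (T : measurableType d) (R : realType).
Variables (mu : {measure set T -> \bar R}) (D : set T) (mD : measurable D).
Local Notation sq := (sqint mu D).
Local Notation ip := (inner mu D).
Implicit Types u v w : T -> R.

Lemma inner_null u v w : sq u -> sq v -> sq w ->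
  ip (fun x => u x - v x) (fun x => u x - v x) = 0 -> ip u w = ip v w.
Proof.
move=> su sv sw h; apply/eqP; rewrite -subr_eq0 -innerBl//.
by apply/eqP; apply: inner_eq0 => //; exact: sqintB.
Qed.

Lemma inner_null2 u v : sq u -> sq v ->
  ip (fun x => u x - v x) (fun x => u x - v x) = 0 -> ip u u = ip v v.
Proof. by move=> su sv h; rewrite (inner_null su sv su h) innerC (inner_null su sv sv h). Qed.

Lemma inner_sub_tri u v w (e : R) : 0 < e -> sq u -> sq v -> sq w ->
  ip (fun x => u x - w x) (fun x => u x - w x) <=
  (1 + e) * ip (fun x => u x - v x) (fun x => u x - v x) +
  (1 + e^-1) * ip (fun x => v x - w x) (fun x => v x - w x).
Proof.
move=> e0 su sv sw; have := inner_sqrD_le mD e0 (sqintB mD su sv) (sqintB mD sv sw).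
apply: le_trans; rewrite le_eqVlt; apply/orP; left; apply/eqP.
by apply: eq_Rintegral => x _; ring.
Qed.

Lemma inner_le_half u v : sq u -> sq v -> ip u v <= (ip u u + ip v v) / 2.
Proof.
move=> su sv; have := inner_ge0 mu D (fun x => u x - v x).
rewrite inner_sqrB//; lra.
Qed.

Lemma ae_Rintegral_ge0 (f : T -> R) : mu.-integrable D (fun x => (f x)%:E) ->
  {ae mu, forall x, D x -> 0 <= f x} -> 0 <= \int[mu]_(x in D) f x.
Proof.
move=> fi f0; rewrite (_ : \int[mu]_(x in D) f x = \int[mu]_(x in D) `|f x|).
  by apply: Rintegral_ge0 => x _.
congr fine; have /integrableP[mf _] := fi.
apply: ae_eq_integral => //.
  apply/measurable_EFinP; apply: measurableT_comp => //; exact/measurable_EFinP.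
by apply: filterS f0 => x h Dx; rewrite ger0_norm//; exact: h.
Qed.

Lemma EFin_integrable_sum (I : Type) (r : seq I) (F : I -> T -> R) :
  (forall i, mu.-integrable D (fun x => (F i x)%:E)) ->
  mu.-integrable D (fun x => (\sum_(i <- r) F i x)%:E) /\
  \int[mu]_(x in D) (\sum_(i <- r) F i x) = \sum_(i <- r) \int[mu]_(x in D) F i x.
Proof.
move=> iF; elim: r => [|i r [IH1 IH2]].
  split.
    by apply: eq_integrable (integrable0 mu D) => // x _; rewrite big_nil.
  rewrite big_nil; under eq_Rintegral do rewrite big_nil.
  by rewrite Rintegral_cst// mul0r.
split.
  apply: eq_integrable (EFin_integrableD mD (iF i) IH1) => // x _.
  by rewrite big_cons.
rewrite big_cons -IH2 -RintegralD; [|exact: mD|exact: iF i|exact: IH1].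
by apply: eq_Rintegral => x _; rewrite big_cons.
Qed.

End inner_extra.

Lemma ae_sub d (T : measurableType d) (R : realType) (mu : {measure set T -> \bar R})
    (P Q : T -> Prop) : (forall x, P x -> Q x) ->
  {ae mu, forall x, P x} -> {ae mu, forall x, Q x}.
Proof. by move=> PQ; apply: filterS. Qed.

Lemma ae_and d (T : measurableType d) (R : realType) (mu : {measure set T -> \bar R})
    (P Q : T -> Prop) : {ae mu, forall x, P x} -> {ae mu, forall x, Q x} ->
  {ae mu, forall x, P x /\ Q x}.
Proof. by move=> hP hQ; apply: filterS2 hP hQ => x. Qed.

(** Supplies the weight for [inner_sqrD_le] and its variants that enlarges the leading square [X] by
    at most [e]. *)
Lemma exists_slack (R : realFieldType) (X e : R) : 0 <= X -> 0 < e ->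
  exists2 d, 0 < d & (1 + d) * X <= X + e.
Proof.
move=> X0 e0; exists (e / (X + 1)); first by rewrite divr_gt0// ltr_wpDl.
rewrite mulrDl mul1r lerD2l mulrAC ler_pdivrMr ?ltr_wpDl// ler_pM2l// lerDl//.
Qed.

(** * The local quadratic form on vector fields *)

Section form.
Context {R : realType} {N : nat}.
Local Notation E := 'rV[R]_N.
Local Notation mu := (@lebesgue_n R N).
Variables (Omega : set E) (a : 'I_N -> 'I_N -> E -> R).
Hypotheses (oO : open Omega) (bO : bounded_set Omega)
  (ella : elliptic_coefficients Omega a).
Local Notation sq := (sqint mu Omega).
Local Notation ip := (inner mu Omega).
Implicit Types (G H K : 'I_N -> E -> R).

Let mO := measurable_Omega oO.

Lemma L2_sqint (u : E -> R) : L2 Omega u <-> sq u.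
Proof.
split=> [[mu_ fu]|su]; first exact: Lnorm2_sqint.
split; first by case: su.
by rewrite /Lpnorm (sqint_Lnorm2 mO su) ltry.
Qed.

Lemma coefficient_bound : exists2 M : R, 0 <= M &
  forall i j, {ae mu, forall x, Omega x -> `|a i j x| <= M}.
Proof.
have [aoo _ _] := ella.
pose B i j := fine (Lpnorm Omega +oo%E (a i j)).
have B0 i j : 0 <= B i j by apply: fine_ge0; exact: Lnorm_ge0.
exists (\sum_i \sum_j B i j); first by rewrite !sumr_ge0// => i _; rewrite sumr_ge0.
move=> i j; have [_ /Lnormoo_ae] := aoo i j.
apply: filterS => x h Ox; apply: le_trans (h Ox) _.
rewrite (bigD1 i)//= (bigD1 j)//= -/(B i j) -addrA lerDl addr_ge0// sumr_ge0//.
by move=> k _; rewrite sumr_ge0.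
Qed.

Lemma coefficient_mul : exists2 M : R, 0 <= M & forall i j g, sq g ->
  sq (fun x => a i j x * g x) /\
  ip (fun x => a i j x * g x) (fun x => a i j x * g x) <= M ^+ 2 * ip g g.
Proof.
have [M M0 hM] := coefficient_bound; exists M; first exact: M0.
move=> i j g sg; have [aoo _ _] := ella.
have mag : measurable_fun (Omega : set (lebesgue_space R N)) (fun x => a i j x * g x).
  by apply: measurable_funM; [case: (aoo i j)|case: sg].
apply: (sqint_ae_le mO mag sg M0).
by move: (hM i j); apply: ae_sub => x h Ox; rewrite normrM ler_wpM2r//; exact: h.
Qed.

Lemma sq_coefficient i j g : sq g -> sq (fun x => a i j x * g x).
Proof. by move=> sg; have [M _ h] := coefficient_mul; have [] := h i j g sg. Qed.

(** Defined on tuples of square-integrable functions and not on functions through their gradients: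
    classical gradients of test functions and chosen weak derivatives can be mixed, and [form_null]
    identifies fields equal up to null sets. *)
Definition form G H : R := \sum_i \sum_j ip (fun x => a i j x * G i x) (H j).

Definition sqf G := forall i, sq (G i).

Definition fnorm G : R := \sum_i ip (G i) (G i).

Lemma fnorm_ge0 G : 0 <= fnorm G.
Proof. by apply: sumr_ge0 => i _; exact: inner_ge0. Qed.

Lemma form_linl (b c : R) G H K : sqf G -> sqf H -> sqf K ->
  form (fun i x => b * G i x + c * H i x) K = b * form G K + c * form H K.
Proof.
move=> sG sH sK; rewrite /form !mulr_sumr -big_split/=; apply: eq_bigr => i _.
rewrite !mulr_sumr -big_split/=; apply: eq_bigr => j _.
have sGi := sq_coefficient i j (sG i); have sHi := sq_coefficient i j (sH i).
rewrite -inner_linl//; apply: eq_inner => x _ //; ring.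
Qed.

Lemma form0l G K : sqf K -> (forall i x, G i x = 0) -> form G K = 0.
Proof.
move=> sK G0; rewrite /form big1// => i _; rewrite big1// => j _.
rewrite -[RHS](mul0r (ip (K j) (K j))) -innerZl//.
by apply: eq_inner => x _ //; rewrite G0 mulr0 mul0r.
Qed.

Lemma form_sym G H : sqf G -> sqf H -> form G H = form H G.
Proof.
move=> sG sH; rewrite /form exchange_big/=; apply: eq_bigr => i _.
apply: eq_bigr => j _; rewrite innerC; have [_ asym _] := ella.
have sGj := sq_coefficient j i (sG j); have sHi := sq_coefficient i j (sH i).
apply: ae_inner => //; move: (asym j i); apply: ae_sub => x h Ox.
rewrite h//; ring.
Qed.

Lemma form_linr (b c : R) G H K : sqf G -> sqf H -> sqf K ->
  form K (fun i x => b * G i x + c * H i x) = b * form K G + c * form K H.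
Proof.
move=> sG sH sK; have sl : sqf (fun i x => b * G i x + c * H i x).
  by move=> i; exact: sqint_lin.
by rewrite form_sym// form_linl// !(form_sym sK).
Qed.

Lemma form_null G H K : sqf G -> sqf H -> sqf K ->
  (forall i, ip (fun x => G i x - H i x) (fun x => G i x - H i x) = 0) ->
  form G K = form H K.
Proof.
move=> sG sH sK h; apply: eq_bigr => i _; apply: eq_bigr => j _.
have [M M0 hM] := coefficient_mul.
have [sGi _] := hM i j _ (sG i); have [sHi _] := hM i j _ (sH i).
apply: inner_null => //.
have [_] := hM i j _ (sqintB mO (sG i) (sH i)); rewrite h mulr0 => le0.
apply/le_anti; rewrite inner_ge0 andbT; apply: le_trans le0.
by rewrite le_eqVlt; apply/orP; left; apply/eqP; apply: eq_Rintegral => x _; ring.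
Qed.

Let form_int G H : sqf G -> sqf H ->
  mu.-integrable Omega (fun x => (\sum_i \sum_j a i j x * G i x * H j x)%:E) /\
  form G H = \int[mu]_(x in Omega) (\sum_i \sum_j a i j x * G i x * H j x).
Proof.
move=> sG sH; have i2 i j := sqint_mul mO (sq_coefficient i j (sG i)) (sH j).
have i1 i := EFin_integrable_sum mO (index_enum 'I_N) (i2 i).
have [i0 e0] := EFin_integrable_sum mO (index_enum 'I_N) (fun i => (i1 i).1).
split=> //; rewrite e0; apply: eq_bigr => i _.
by rewrite (i1 i).2.
Qed.

Let form_le_int G H (c : E -> R) : sqf G -> sqf H ->
  (forall x, Omega x -> 0 <= c x) ->
  mu.-integrable Omega (fun x => (c x)%:E) ->
  {ae mu, forall x, Omega x -> \sum_i \sum_j a i j x * G i x * G j x + c x <=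
     \sum_i \sum_j a i j x * H i x * H j x} ->
  form G G + \int[mu]_(x in Omega) c x <= form H H.
Proof.
move=> sG sH c0 ic h; have [iG ->] := form_int sG sG; have [iH ->] := form_int sH sH.
rewrite -RintegralD// -subr_ge0 -RintegralB//; last exact: EFin_integrableD.
apply: ae_Rintegral_ge0 => //.
  have := integrableB mO iH (EFin_integrableD mO iG ic).
  by apply: eq_integrable => // x _.
by move: h; apply: ae_sub => x h Ox; rewrite subr_ge0; exact: h.
Qed.

Lemma form_coercive : exists2 gamma : R, 0 < gamma &
  forall G, sqf G -> gamma * fnorm G <= form G G.
Proof.
have [_ _ [g g0 hg]] := ella; exists g => // G sG.
have s0 : sqf (fun _ _ => 0) by move=> i; exact: sqint0.
have iG i : mu.-integrable Omega (fun x => (G i x * G i x)%:E) by exact: sqint_mul.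
have [iS eS] := EFin_integrable_sum mO (index_enum 'I_N) iG.
have := @form_le_int (fun _ _ => 0) G (fun x => g * \sum_i G i x * G i x) s0 sG.
rewrite (form0l s0)// add0r RintegralZl// eS; apply.
- by move=> x _; rewrite mulr_ge0// ?(ltW g0)// sumr_ge0// => i _; rewrite -expr2 sqr_ge0.
- exact: EFin_integrableZ.
- move: hg; apply: ae_sub => x h Ox.
  have -> : \sum_i \sum_j a i j x * 0 * 0 = 0.
    by rewrite big1// => i _; rewrite big1// => j _; rewrite mulr0.
  have := h Ox (\row_i G i x); rewrite add0r.
  have -> : \sum_(i < N) (\row_i G i x) 0 i ^+ 2 = \sum_i G i x * G i x.
    by apply: eq_bigr => i _; rewrite mxE expr2.
  move=> /le_trans; apply; rewrite le_eqVlt; apply/orP; left; apply/eqP.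
  by apply: eq_bigr => i _; apply: eq_bigr => j _; rewrite !mxE.
Qed.

Lemma form_ge0 G : sqf G -> 0 <= form G G.
Proof.
move=> sG; have [g g0 h] := form_coercive; apply: le_trans (h G sG).
by rewrite mulr_ge0 ?fnorm_ge0// ltW.
Qed.

Lemma form_bounded : exists2 A : R, 0 <= A &
  forall G, sqf G -> form G G <= A * fnorm G.
Proof.
have [M M0 hM] := coefficient_mul.
exists (N%:R * (M ^+ 2 + 1)); first by rewrite mulr_ge0// addr_ge0// sqr_ge0.
move=> G sG; apply: (@le_trans _ _ (\sum_(i < N) \sum_(j < N)
    (M ^+ 2 * ip (G i) (G i) + ip (G j) (G j)))).
  apply: ler_sum => i _; apply: ler_sum => j _; have [s1 h1] := hM i j _ (sG i).
  apply: le_trans (inner_le_half mO s1 (sG j)) _.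
  rewrite ler_pdivrMr// mulr_natr mulr2n.
  have := inner_ge0 mu Omega (G j); have := inner_ge0 mu Omega (G i).
  have := sqr_ge0 M; nra.
under eq_bigr do rewrite big_split/= sumr_const card_ord -/(fnorm G).
rewrite big_split/= sumr_const card_ord sumrMnl -mulr_sumr -/(fnorm G).
rewrite le_eqVlt; apply/orP; left; apply/eqP.
rewrite -[X in _ + X]mulr_natr -[X in X + _]mulr_natr; ring.
Qed.

(** The form is local: at almost every point the elliptic quadratic form of [G] is [c^2 <= 1] times
    that of [H]. By the chain rule, the gradient of a smoothly truncated test function is such a
    [G]. *)
Lemma form_contraction G H : sqf G -> sqf H ->
  (forall x, Omega x -> exists2 c, `|c| <= 1 & forall i, G i x = c * H i x) ->
  form G G <= form H H.
Proof.
move=> sG sH h; rewrite -[leLHS]addr0.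
have -> : 0 = \int[mu]_(x in Omega) (0 : R) by rewrite Rintegral_cst// mul0r.
have [_ _ [g g0 hg]] := ella.
apply: form_le_int => //; first exact: (integrable0 mu Omega).
move: hg; apply: ae_sub => x hx Ox; rewrite addr0.
have [c c1 hc] := h x Ox; have := hx Ox (\row_i H i x).
set q := \sum_(i < N) \sum_(j < N) _ => gq.
have q0 : 0 <= q.
  apply: le_trans gq; rewrite mulr_ge0 ?(ltW g0)// sumr_ge0// => i _.
  exact: sqr_ge0.
have -> : \sum_i \sum_j a i j x * H i x * H j x = q.
  by apply: eq_bigr => i _; apply: eq_bigr => j _; rewrite !mxE.
have -> : \sum_i \sum_j a i j x * G i x * G j x = c ^+ 2 * q.
  rewrite mulr_sumr; apply: eq_bigr => i _; rewrite mulr_sumr.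
  by apply: eq_bigr => j _; rewrite !hc !mxE; ring.
by rewrite ler_piMl// -(real_normK (num_real c)) expr_le1.
Qed.

(** Continuity of the form, uniform over [form G G <= X]. Half of [e] pays for the weight [1 + c] on
    [X], the other half for the form of [H - G]. *)
Lemma form_perturb (X e : R) : 0 <= X -> 0 < e -> exists2 d, 0 < d &
  forall G H, sqf G -> sqf H -> form G G <= X ->
  fnorm (fun i x => H i x - G i x) <= d -> form H H <= X + e.
Proof.
move=> X0 e0; have [A A0 hA] := form_bounded.
have e2 : 0 < e / 2 by rewrite divr_gt0.
have [c c0 hc] := exists_slack X0 e2.
pose B := (1 + c^-1) * A; have B0 : 0 <= B by rewrite mulr_ge0// addr_ge0// invr_ge0 ltW.
exists (e / 2 / (B + 1)); first by rewrite divr_gt0// ltr_wpDl.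
move=> G H sG sH GX HG; pose K i x := H i x - G i x.
have sK : sqf K by move=> i; exact: sqintB.
have HE : form H H = form (fun i x => 1 * G i x + 1 * K i x) (fun i x => 1 * G i x + 1 * K i x).
  by congr form; apply/funext => i; apply/funext => x; rewrite /K; ring.
have sL : sqf (fun i x => 1 * G i x + 1 * K i x) by move=> i; exact: sqint_lin.
have sM : sqf (fun i x => c * G i x + (-1) * K i x) by move=> i; exact: sqint_lin.
have := form_ge0 sM; rewrite form_linl// !form_linr// (form_sym sK sG) => h1.
rewrite HE form_linl// !form_linr// (form_sym sK sG).
have hK : form K K <= A * (e / 2 / (B + 1)).
  by apply: le_trans (hA _ sK) _; rewrite ler_wpM2l.
apply: (@le_trans _ _ ((1 + c) * form G G + (1 + c^-1) * form K K)).
  rewrite -subr_ge0.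
  have -> : (1 + c) * form G G + (1 + c^-1) * form K K -
    (1 * (1 * form G G + 1 * form G K) + 1 * (1 * form G K + 1 * form K K)) =
    c^-1 * (c * (c * form G G + -1 * form G K) + -1 * (c * form G K + -1 * form K K)).
    by field; rewrite gt_eqF.
  by rewrite mulr_ge0// invr_ge0 ltW.
have h2 : (1 + c) * form G G <= (1 + c) * X by rewrite ler_wpM2l// addr_ge0// ltW.
have h3 : (1 + c^-1) * form K K <= e / 2.
  apply: (@le_trans _ _ (B * (e / 2 / (B + 1)))).
    by rewrite /B -mulrA ler_wpM2l// addr_ge0// invr_ge0 ltW.
  rewrite mulrA ler_pdivrMr ?ltr_wpDl// mulrC ler_wpM2l ?(ltW e2)// lerDl//.
lra.
Qed.

End form.

(** * Eigenfunction expansions *)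

Section eigen.
Context {R : realType} {N : nat}.
Local Notation E := 'rV[R]_N.
Local Notation mu := (@lebesgue_n R N).
Variables (Omega : set E) (a : 'I_N -> 'I_N -> E -> R) (lam : nat -> R)
  (phi : nat -> E -> R).
Hypotheses (oO : open Omega) (bO : bounded_set Omega)
  (ella : elliptic_coefficients Omega a) (eb : eigenbasis Omega a lam phi).
Local Notation sq := (sqint mu Omega).
Local Notation ip := (inner mu Omega).
Local Notation form := (form Omega a).
Local Notation sqf := (sqf Omega).

Let mO := measurable_Omega oO.

Lemma inner_sqrZ (c : R) u : sq u ->
  ip (fun x => c * u x) (fun x => c * u x) = c ^+ 2 * ip u u.
Proof.
move=> su; have scu : sq (fun x => c * u x) by exact: sqintZ.
rewrite (innerZl mO c su scu) (innerC _ _ u) (innerZl mO c su su).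
by rewrite expr2 mulrA.
Qed.

Lemma eigenfunction_H10 n : H10 Omega (phi n).
Proof. by have [] := eigenbasis_eigen eb n. Qed.

Lemma eigenfunction_sqint n : sq (phi n).
Proof. by apply/(L2_sqint oO); case: (eigenfunction_H10 n) => -[]. Qed.

Let se := eigenfunction_sqint.

Lemma eigenfunction_orthonormal m n : ip (phi m) (phi n) = (m == n)%:R.
Proof. exact: eigenbasis_orthonormal eb m n. Qed.

Let oe := eigenfunction_orthonormal.

Lemma Lpnorm_cvg0 (u : nat -> E -> R) : (forall n, sq (u n)) ->
  Lpnorm Omega 2%:E (u n) @[n --> \oo] --> 0%E ->
  ip (u n) (u n) @[n --> \oo] --> 0.
Proof.
move=> su; rewrite /Lpnorm; under eq_fun do rewrite sqint_Lnorm2//.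
move=> /fine_cvg/= h.
have {}h : Num.sqrt (ip (u n) (u n)) @[n --> \oo] --> 0 by exact: h.
have -> : (fun n => ip (u n) (u n)) =
    (fun n => Num.sqrt (ip (u n) (u n)) * Num.sqrt (ip (u n) (u n))).
  by apply/funext => n; rewrite -expr2 sqr_sqrtr ?inner_ge0.
by have := cvgM h h; rewrite mulr0; apply.
Qed.

Lemma eigenfunction_complete u : sq u ->
  ip (fun x => u x - span phi (fun k => ip u (phi k)) n x)
     (fun x => u x - span phi (fun k => ip u (phi k)) n x) @[n --> \oo] --> 0.
Proof.
move=> su; apply: Lpnorm_cvg0.
  by move=> n; apply: sqintB => //; exact: sqint_span.
by have := eigenbasis_complete eb (proj2 (L2_sqint oO u) su).
Qed.

Let ce := eigenfunction_complete.

Lemma H1norm_ge u : H1 Omega u -> (ip u u <= H1norm Omega u ^+ 2) /\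
  forall i, ip (wpartial Omega i u) (wpartial Omega i u) <= H1norm Omega u ^+ 2.
Proof.
move=> _; have E1 (v : E -> R) : Lint Omega (fun x => v x ^+ 2) = ip v v.
  by apply: eq_Rintegral => x _; rewrite expr2.
have s0 : 0 <= \sum_(i < N) ip (wpartial Omega i u) (wpartial Omega i u).
  by apply: sumr_ge0 => i _; exact: inner_ge0.
rewrite /H1norm E1; under eq_bigr do rewrite E1.
rewrite sqr_sqrtr; last by rewrite addr_ge0// inner_ge0.
split; first by rewrite lerDl.
move=> i; apply: ler_wpDl; first exact: inner_ge0.
rewrite (bigD1 i)//= lerDl; apply: sumr_ge0 => j _; exact: inner_ge0.
Qed.

Lemma wpartialP u i : H1 Omega u -> is_weak_partial Omega i u (wpartial Omega i u).
Proof. by move=> [_ /(_ i)[g hg]]; rewrite /wpartial; apply: (xgetPex _ (ex_intro _ g hg)). Qed.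

Lemma eigenfunction_test_approx n (e : R) : 0 < e ->
  exists2 psi, test_function Omega psi & H1norm Omega (phi n \- psi) ^+ 2 <= e.
Proof.
move=> e0; have [_ h] := eigenfunction_H10 n.
have [psi tpsi hp] := h (Num.sqrt e) ltac:(by rewrite sqrtr_gt0).
exists psi => //; rewrite -[leRHS](sqr_sqrtr (ltW e0)).
by rewrite ler_pXn2r ?nnegrE ?sqrtr_ge0// ltW.
Qed.

Lemma weak_partial_sqint u i g : is_weak_partial Omega i u g -> sq g.
Proof. by move=> [/(L2_sqint oO)]. Qed.

Lemma weak_partial_inner u i g psi : is_weak_partial Omega i u g ->
  test_function Omega psi -> ip u (partial i psi) = - ip g psi.
Proof. by move=> [_ h] /h. Qed.

Lemma weak_partial_lin (b c : R) u v g h i : sq u -> sq v ->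
  is_weak_partial Omega i u g -> is_weak_partial Omega i v h ->
  is_weak_partial Omega i (fun x => b * u x + c * v x) (fun x => b * g x + c * h x).
Proof.
move=> su sv wg wh; have sg := weak_partial_sqint wg; have sh := weak_partial_sqint wh.
split; first by apply/(L2_sqint oO); exact: sqint_lin.
move=> psi tpsi; have sp := test_sqint oO tpsi; have spi := test_partial_sqint oO i tpsi.
rewrite -[LHS]/(ip _ (partial i psi)) -[X in _ = - X]/(ip _ psi) !inner_linl//.
by rewrite (weak_partial_inner wg)// (weak_partial_inner wh)//; ring.
Qed.

Lemma test_weak_partial psi i : test_function Omega psi ->
  is_weak_partial Omega i psi (partial i psi).
Proof.
move=> tpsi; split; first by apply/(L2_sqint oO); exact: test_partial_sqint.
by move=> psi' tpsi'; exact: test_ibp.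
Qed.

Lemma H1_test_sub n psi : test_function Omega psi -> H1 Omega (phi n \- psi).
Proof.
move=> tpsi; have [H1n _] := eigenfunction_H10 n.
have -> : phi n \- psi = (fun x => 1 * phi n x + (-1) * psi x).
  by apply/funext => x /=; rewrite mul1r mulN1r.
split; first by apply/(L2_sqint oO); apply: sqint_lin => //; exact: test_sqint.
move=> i; eexists; apply: weak_partial_lin => //; first exact: test_sqint.
  exact: (wpartialP i H1n).
exact: test_weak_partial.
Qed.

Lemma inner_zero (u : E -> R) : (forall x, u x = 0) -> ip u u = 0.
Proof.
move=> u0; rewrite /inner; under eq_Rintegral do rewrite u0 mul0r.
by rewrite Rintegral_cst// mul0r.
Qed.

(** The shape in which [inner_sqrD_le] with weight 1 leaves two errors. *)
Let quarters (e x y : R) : x <= e / 4 -> y <= e / 4 ->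
  (1 + 1) * x + (1 + 1) * y <= e.
Proof. by move=> ? ?; lra. Qed.

(** Density comes from the eigenbasis: eigenfunctions lie in the closure of the test functions, and
    their finite combinations approximate every square-integrable function. *)
Lemma test_dense u (e : R) : sq u -> 0 < e -> exists2 psi, test_function Omega psi &
  ip (fun x => u x - psi x) (fun x => u x - psi x) <= e.
Proof.
have spanh c m (e' : R) : 0 < e' -> exists2 psi, test_function Omega psi &
    ip (fun x => span phi c m x - psi x) (fun x => span phi c m x - psi x) <= e'.
  elim: m e' => [|m IH] e' e0.
    exists (fun=> 0); first exact: test0.
    by rewrite inner_zero ?(ltW e0)// => x; rewrite /span big_ord0 subrr.
  have e2 : 0 < e' / 2 by rewrite divr_gt0.
  have e4 : 0 < e' / 4 by rewrite divr_gt0.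
  have [psi tpsi hpsi] := IH _ e4.
  (* The new error is multiplied by [c m ^+ 2]; dividing by [c m ^+ 2 + 1] keeps it below [e' / 4]
     even for a zero coefficient. *)
  have d0 : 0 < e' / 4 / (c m ^+ 2 + 1) by rewrite divr_gt0// ltr_wpDl ?sqr_ge0.
  have [chi tchi hchi] := eigenfunction_test_approx m d0.
  have [h1 _] := H1norm_ge (H1_test_sub m tchi).
  have sp := test_sqint oO tpsi; have sc := test_sqint oO tchi.
  have ss := sqint_span mO se c m.
  exists (fun x => 1 * psi x + c m * chi x); first exact: test_lin.
  have s1 : sq (fun x => span phi c m x - psi x) by exact: sqintB.
  have s3 : sq (phi m \- chi) by exact: sqintB.
  have s2 : sq (fun x => c m * (phi m \- chi) x) by exact: sqintZ.
  have E1 : ip (fun x => span phi c m.+1 x - (1 * psi x + c m * chi x))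
     (fun x => span phi c m.+1 x - (1 * psi x + c m * chi x)) =
     ip (fun x => (span phi c m x - psi x) + c m * (phi m \- chi) x)
        (fun x => (span phi c m x - psi x) + c m * (phi m \- chi) x).
    by apply: eq_inner => x _; rewrite /span big_ord_recr /=; ring.
  rewrite E1; apply: le_trans (inner_sqrD_le mO ltr01 s1 s2) _.
  rewrite inner_sqrZ//.
  have h2 : c m ^+ 2 * ip (phi m \- chi) (phi m \- chi) <= e' / 4.
    have c0 : 0 <= c m ^+ 2 := sqr_ge0 _.
    apply: (@le_trans _ _ (c m ^+ 2 * (e' / 4 / (c m ^+ 2 + 1)))).
      by rewrite ler_wpM2l// (le_trans h1).
    rewrite mulrA ler_pdivrMr ?ltr_wpDl// mulrC ler_wpM2l ?(ltW e4)// lerDl//.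
  by rewrite invr1; exact: (quarters hpsi h2).
move=> su e0; have e4 : 0 < e / 4 by rewrite divr_gt0.
have [m _ hm] := cvgr_le _ (eigenfunction_complete su) (e / 4) e4.
have := hm m (leqnn m) => /= {}hm.
have [psi tpsi hpsi] := spanh (fun k => ip u (phi k)) m _ e4.
exists psi => //; have sp := test_sqint oO tpsi.
have ss := sqint_span mO se (fun k => ip u (phi k)) m.
apply: le_trans (inner_sub_tri mO ltr01 su ss sp) _.
by rewrite invr1; exact: (quarters hm hpsi).
Qed.

(** Needed since [wpartial] is an arbitrary choice. The difference is orthogonal to every test
    function, so its norm is at most its distance to any of them, which can be made small. *)
Lemma weak_partial_unique u i g h : is_weak_partial Omega i u g ->
  is_weak_partial Omega i u h -> ip (fun x => g x - h x) (fun x => g x - h x) = 0.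
Proof.
move=> wg wh; have sg := weak_partial_sqint wg; have sh := weak_partial_sqint wh.
pose v x := g x - h x; have sv : sq v by exact: sqintB.
have ort psi : test_function Omega psi -> ip v psi = 0.
  move=> tpsi; rewrite innerBl//; last exact: test_sqint.
  apply/eqP; rewrite subr_eq0 -eqr_opp; apply/eqP.
  by rewrite -(weak_partial_inner wg tpsi) -(weak_partial_inner wh tpsi).
apply/le_anti; rewrite inner_ge0 andbT; apply/ler_addgt0Pr => e e0; rewrite add0r.
have [psi tpsi hpsi] := test_dense sv e0.
have sp := test_sqint oO tpsi.
move: hpsi; rewrite inner_sqrB// (ort _ tpsi) mulr0 subr0.
by apply: le_trans; rewrite lerDl inner_ge0.
Qed.

Lemma weak_partial0 i : is_weak_partial Omega i (fun=> 0 : R) (fun=> 0).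
Proof.
have := test_weak_partial i (test0 Omega).
have -> // : partial i (fun _ : E => 0 : R) = fun=> 0.
by apply/funext => x; exact: derive_cst.
Qed.

Lemma test_H1 psi : test_function Omega psi -> H1 Omega psi.
Proof.
move=> tpsi; split; first by apply/(L2_sqint oO); exact: test_sqint.
by move=> i; exists (partial i psi); exact: test_weak_partial.
Qed.

Lemma test_H10 psi : test_function Omega psi -> H10 Omega psi.
Proof.
move=> tpsi; split; first exact: test_H1.
move=> e e0; exists psi => //.
have -> : psi \- psi = fun=> 0 by apply/funext => x /=; rewrite subrr.
have H0 : H1 Omega (fun=> 0 : R) := test_H1 (test0 Omega).
rewrite /H1norm big1 ?addr0.
  rewrite (_ : Lint _ _ = 0) ?sqrtr0//.
  by rewrite /Lint; under eq_Rintegral do rewrite expr0n; rewrite Rintegral_cst// mul0r.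
(* Even for the zero function [wpartial] is some unspecified representative, shown to be null by
   uniqueness. *)
move=> i _; have wi := wpartialP i H0; have si := weak_partial_sqint wi.
have := weak_partial_unique wi (weak_partial0 i) => h.
rewrite -[RHS]h; apply: eq_Rintegral => x _; rewrite subr0 expr2//.
Qed.

Let wp n i := wpartial Omega i (phi n).

Lemma eigenfunction_weak_partial n i : is_weak_partial Omega i (phi n) (wp n i).
Proof. by apply: wpartialP; case: (eigenfunction_H10 n). Qed.

Lemma wp_sqf n : sqf (wp n).
Proof. by move=> i; exact: weak_partial_sqint (eigenfunction_weak_partial n i). Qed.

Definition grad (psi : E -> R) : 'I_N -> E -> R := fun i => partial i psi.

Lemma grad_sqf psi : test_function Omega psi -> sqf (grad psi).
Proof. by move=> tpsi i; exact: test_partial_sqint. Qed.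

(** The eigenvalue equation speaks of the chosen [wpartial] of [psi]; uniqueness of weak derivatives
    exchanges it for the classical gradient. *)
Lemma form_eigen_test n psi : test_function Omega psi ->
  form (wp n) (grad psi) = lam n * ip (phi n) psi.
Proof.
move=> tpsi; have [_ _ /(_ psi (test_H10 tpsi))] := eigenbasis_eigen eb n.
have -> : Lint Omega (fun x => lam n * phi n x * psi x) = lam n * ip (phi n) psi.
  by rewrite -innerZl//; exact: test_sqint.
move=> <-; have swp : sqf (fun i => wpartial Omega i psi).
  by move=> i; apply: weak_partial_sqint (wpartialP i (test_H1 tpsi)).
rewrite -[RHS]/(form (wp n) (fun i => wpartial Omega i psi)).
rewrite (form_sym oO ella (wp_sqf n) swp) (form_sym oO ella (wp_sqf n) (grad_sqf tpsi)).
apply: (form_null oO ella (grad_sqf tpsi) swp (wp_sqf n)) => i.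
exact: weak_partial_unique (test_weak_partial i tpsi) (wpartialP i (test_H1 tpsi)).
Qed.

Lemma form_eigen n m : form (wp n) (wp m) = lam n * (n == m)%:R.
Proof.
have [_ _ /(_ _ (eigenfunction_H10 m))] := eigenbasis_eigen eb n.
rewrite -[LHS]/(form (wp n) (wp m)) => ->.
have -> : Lint Omega (fun x => lam n * phi n x * phi m x) = lam n * ip (phi n) (phi m).
  by rewrite -innerZl.
by rewrite oe.
Qed.

Definition gspan (c : nat -> R) m : 'I_N -> E -> R :=
  fun i x => \sum_(n < m) c n * wp n i x.

Lemma gspan_sqf c m : sqf (gspan c m).
Proof.
by move=> i; exact: (sqint_sum mO _ (fun n : 'I_m => c n) (fun n : 'I_m => wp_sqf n i)).
Qed.

Lemma form_gspan c m K : sqf K -> form (gspan c m) K = \sum_(n < m) c n * form (wp n) K.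
Proof.
move=> sK; elim: m => [|m IH].
  by rewrite big_ord0 (form0l a oO sK)// => i x; rewrite /gspan big_ord0.
rewrite big_ord_recr/= -IH.
have -> : gspan c m.+1 = (fun i x => 1 * gspan c m i x + c m * wp m i x).
  by apply/funext => i; apply/funext => x; rewrite /gspan big_ord_recr/= mul1r.
rewrite (form_linl oO ella); [|exact: gspan_sqf|exact: wp_sqf|exact: sK].
by rewrite mul1r.
Qed.

Lemma form_gspan2 c m : form (gspan c m) (gspan c m) = \sum_(n < m) lam n * c n ^+ 2.
Proof.
rewrite form_gspan; last exact: gspan_sqf.
apply: eq_bigr => n _; rewrite (form_sym oO ella); [|exact: wp_sqf|exact: gspan_sqf].
rewrite form_gspan; last exact: wp_sqf.
rewrite (bigD1 n)//= form_eigen eqxx mulr1 big1 ?addr0; first by ring.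
by move=> k kn; rewrite form_eigen (_ : (_ == _) = false) ?mulr0//; apply/negbTE.
Qed.

(** Bessel's inequality for the form, in which the eigenfunctions are orthogonal with squares
    [lam n]: positivity at the gradient of [psi] minus its spectral truncation. *)
Lemma form_bessel psi m : test_function Omega psi ->
  \sum_(n < m) lam n * ip psi (phi n) ^+ 2 <= form (grad psi) (grad psi).
Proof.
move=> tpsi; set c := fun n => ip psi (phi n).
have sG := grad_sqf tpsi; have sS := gspan_sqf c m.
have sl : sqf (fun i x => 1 * grad psi i x + (-1) * gspan c m i x).
  by move=> i; exact: sqint_lin.
have := form_ge0 oO ella sl.
rewrite (form_linl oO ella)// !(form_linr oO ella)// (form_sym oO ella sG sS).
have -> : form (gspan c m) (grad psi) = \sum_(n < m) lam n * c n ^+ 2.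
  rewrite form_gspan//; apply: eq_bigr => n _.
  by rewrite form_eigen_test// innerC /c; ring.
rewrite form_gspan2; lra.
Qed.

(** Finite combinations of eigenfunctions are approximated together with their gradients, one
    eigenfunction at a time. *)
Lemma span_test_approx c m (e : R) : 0 < e -> exists psi, [/\ test_function Omega psi,
  ip (fun x => span phi c m x - psi x) (fun x => span phi c m x - psi x) <= e &
  forall i, ip (fun x => grad psi i x - gspan c m i x)
    (fun x => grad psi i x - gspan c m i x) <= e].
Proof.
elim: m e => [|m IH] e e0.
  exists (fun=> 0); split; first exact: test0.
    by rewrite inner_zero ?(ltW e0)// => x; rewrite /span big_ord0 subrr.
  move=> i; rewrite inner_zero ?(ltW e0)// => x.
  by rewrite /grad /gspan big_ord0 subr0; exact: derive_cst.
have e4 : 0 < e / 4 by rewrite divr_gt0.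
have [psi [tpsi hpsi gpsi]] := IH _ e4.
have d0 : 0 < e / 4 / (c m ^+ 2 + 1) by rewrite divr_gt0// ltr_wpDl ?sqr_ge0.
have [chi tchi hchi] := eigenfunction_test_approx m d0.
have H1mc := H1_test_sub m tchi.
have [h1 g1] := H1norm_ge H1mc.
have sp := test_sqint oO tpsi; have sc := test_sqint oO tchi.
have ss := sqint_span mO se c m.
have s1 : sq (fun x => span phi c m x - psi x) by exact: sqintB.
have s3 : sq (phi m \- chi) by exact: sqintB.
have s2 : sq (fun x => c m * (phi m \- chi) x) by exact: sqintZ.
have c0 : 0 <= c m ^+ 2 := sqr_ge0 _.
have small (x : R) : x <= e / 4 / (c m ^+ 2 + 1) -> c m ^+ 2 * x <= e / 4.
  move=> hx; apply: (@le_trans _ _ (c m ^+ 2 * (e / 4 / (c m ^+ 2 + 1)))).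
    by rewrite ler_wpM2l.
  by rewrite mulrA ler_pdivrMr ?ltr_wpDl// mulrC ler_wpM2l ?(ltW e4)// lerDl.
exists (fun x => 1 * psi x + c m * chi x); split; first exact: test_lin.
  have E1 : ip (fun x => span phi c m.+1 x - (1 * psi x + c m * chi x))
     (fun x => span phi c m.+1 x - (1 * psi x + c m * chi x)) =
     ip (fun x => (span phi c m x - psi x) + c m * (phi m \- chi) x)
        (fun x => (span phi c m x - psi x) + c m * (phi m \- chi) x).
    by apply: eq_inner => x _; rewrite /span big_ord_recr /=; ring.
  rewrite E1; apply: le_trans (inner_sqrD_le mO ltr01 s1 s2) _.
  rewrite inner_sqrZ//.
  by rewrite invr1; exact: (quarters hpsi (small _ (le_trans h1 hchi))).
move=> i; have sGp := test_partial_sqint oO i tpsi.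
have sGc := test_partial_sqint oO i tchi; have sS := gspan_sqf c m i.
have sw := wp_sqf m i.
have t1 : sq (fun x => grad psi i x - gspan c m i x) by exact: sqintB.
have t3 : sq (fun x => wp m i x - grad chi i x) by exact: sqintB.
have t2 : sq (fun x => - c m * (wp m i x - grad chi i x)) by exact: sqintZ.
have E2 : ip (fun x => grad (fun y => 1 * psi y + c m * chi y) i x - gspan c m.+1 i x)
     (fun x => grad (fun y => 1 * psi y + c m * chi y) i x - gspan c m.+1 i x) =
   ip (fun x => (grad psi i x - gspan c m i x) + - c m * (wp m i x - grad chi i x))
      (fun x => (grad psi i x - gspan c m i x) + - c m * (wp m i x - grad chi i x)).
  apply: eq_inner => x _; rewrite /grad /gspan big_ord_recr /=;
    rewrite (partial_lin 1 (c m) i x (test_C1c tpsi) (test_C1c tchi)); ring.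
rewrite E2; apply: le_trans (inner_sqrD_le mO ltr01 t1 t2) _.
have wd : is_weak_partial Omega i (phi m \- chi) (fun x => wp m i x - grad chi i x).
  have -> : phi m \- chi = (fun x => 1 * phi m x + (-1) * chi x).
    by apply/funext => x /=; rewrite mul1r mulN1r.
  have -> : (fun x => wp m i x - grad chi i x) = (fun x => 1 * wp m i x + (-1) * grad chi i x).
    by apply/funext => x /=; rewrite mul1r mulN1r.
  apply: weak_partial_lin => //; first exact: eigenfunction_weak_partial.
  exact: test_weak_partial.
have wq := wpartialP i H1mc.
have E3 := inner_null2 mO t3 (weak_partial_sqint wq) (weak_partial_unique wd wq).
rewrite inner_sqrZ// sqrrN E3.
by rewrite invr1; exact: (quarters (gpsi i) (small _ (le_trans (g1 i) hchi))).
Qed.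

Lemma form_approx c m (e : R) : 0 < e -> exists psi, [/\ test_function Omega psi,
  ip (fun x => span phi c m x - psi x) (fun x => span phi c m x - psi x) <= e &
  form (grad psi) (grad psi) <= \sum_(n < m) lam n * c n ^+ 2 + e].
Proof.
move=> e0; pose X := \sum_(n < m) lam n * c n ^+ 2.
have X0 : 0 <= X.
  by apply: sumr_ge0 => n _; rewrite mulr_ge0 ?sqr_ge0// ltW//; exact: eigenbasis_gt0 eb n.
have [d d0 hd] := form_perturb oO ella X0 e0.
(* The gradient errors in the [N] directions add up to at most [d]; the [+ 1] keeps the denominator
   positive. *)
have dN : 0 < Num.min e (d / (N%:R + 1)).
  by rewrite lt_min e0 divr_gt0// ltr_wpDl.
have [psi [tpsi h1 h2]] := span_test_approx c m dN.
exists psi; split => //; first by rewrite (le_trans h1)// ge_min lexx.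
apply: (hd (gspan c m)).
- exact: gspan_sqf.
- exact: grad_sqf.
- by rewrite form_gspan2.
- apply: (@le_trans _ _ (\sum_(i < N) d / (N%:R + 1))).
    by apply: ler_sum => i _; rewrite (le_trans (h2 i))// ge_min lexx orbT.
  rewrite sumr_const card_ord -[leLHS]mulr_natr mulrAC ler_pdivrMr ?ltr_wpDl//.
  by rewrite ler_wpM2l ?(ltW d0)// lerDl.
Qed.

End eigen.

(** * Truncation and the K-functional *)

Section nneseries.
Context {R : realType}.
Implicit Types f g : nat -> R.

Lemma nneseries_le_bound f (C : R) : (forall n, 0 <= f n) ->
  (forall n, \sum_(k < n) f k <= C) -> (\sum_(0 <= k <oo) (f k)%:E <= C%:E)%E.
Proof.
move=> f0 h; apply: lime_le; first by apply: is_cvg_nneseries => n _ _; rewrite lee_fin.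
by apply: nearW => n; rewrite sumEFin big_mkord lee_fin.
Qed.

Lemma sum_le_nneseries f n : (forall n, 0 <= f n) ->
  ((\sum_(k < n) f k)%:E <= \sum_(0 <= k <oo) (f k)%:E)%E.
Proof.
move=> f0; rewrite -(big_mkord xpredT) -sumEFin.
by apply: nneseries_lim_ge => k _ _; rewrite lee_fin.
Qed.

End nneseries.

Section contraction.
Context {R : realType} {N : nat}.
Local Notation E := 'rV[R]_N.
Local Notation mu := (@lebesgue_n R N).
Variables (Omega : set E) (a : 'I_N -> 'I_N -> E -> R) (lam : nat -> R)
  (phi : nat -> E -> R).
Hypotheses (oO : open Omega) (bO : bounded_set Omega)
  (ella : elliptic_coefficients Omega a) (eb : eigenbasis Omega a lam phi).
Local Notation sq := (sqint mu Omega).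
Local Notation ip := (inner mu Omega).
Local Notation form := (form Omega a).

Let mO := measurable_Omega oO.
Let se := eigenfunction_sqint oO eb.
Let oe := eigenfunction_orthonormal eb.
Let ce := eigenfunction_complete oO eb.
Let l0 n : 0 < lam n := eigenbasis_gt0 eb n.

(* The K-functional of the pair (L^2, H^1_0) at the point u. *)
Definition Kfun (t : R) (u : E -> R) : \bar R :=
  (\sum_(0 <= n <oo) (resolvent_weight t (lam n) * ip u (phi n) ^+ 2)%:E)%E.

Let Kterm0 t u n : 0 < t -> 0 <= resolvent_weight t (lam n) * ip u (phi n) ^+ 2.
Proof. by move=> t0; rewrite mulr_ge0 ?sqr_ge0// rw_ge0 ?ltW. Qed.

(** Every test function is a competitor. In each coefficient the difference of the two sides is a
    perfect square, and the coefficientwise sums are bounded by Bessel's inequality for the inner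
    product and for the form. *)
Lemma Kfun_le t g psi : 0 < t -> sq g -> test_function Omega psi ->
  (Kfun t g <= (ip (fun x => g x - psi x) (fun x => g x - psi x) +
    t^-1 * form (grad psi) (grad psi))%:E)%E.
Proof.
move=> t0 sg tpsi; have sp := test_sqint oO tpsi.
apply: nneseries_le_bound => [n|m]; first exact: Kterm0.
have sB : sq (fun x => g x - psi x) by exact: sqintB.
apply: (@le_trans _ _ (\sum_(k < m) ip (fun x => g x - psi x) (phi k) ^+ 2 +
    t^-1 * \sum_(k < m) lam k * ip psi (phi k) ^+ 2)); last first.
  apply: lerD; first exact: bessel.
  by rewrite ler_pM2l ?invr_gt0//; exact: (form_bessel oO ella eb m tpsi).
rewrite mulr_sumr -big_split/=; apply: ler_sum => k _.
rewrite innerBl//; set x := ip g _; set y := ip psi _; rewrite /resolvent_weight.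
have l0k := l0 k; have lt0 : 0 < lam k + t by rewrite addr_gt0.
have -> : (x - y) ^+ 2 + t^-1 * (lam k * y ^+ 2) = lam k / (lam k + t) * x ^+ 2 +
    (t * (x - y) - lam k * y) ^+ 2 / (t * (lam k + t)).
  by field; rewrite !gt_eqF.
by rewrite lerDl divr_ge0 ?sqr_ge0// mulr_ge0 ?ltW.
Qed.

Lemma Kfun_ge t u e : 0 < t -> 0 < e -> sq u -> exists2 psi, test_function Omega psi &
  ((ip (fun x => u x - psi x) (fun x => u x - psi x) +
    t^-1 * form (grad psi) (grad psi))%:E <= Kfun t u + e%:E)%E.
Proof.
(* The coefficientwise minimizer. It is cut at an index [m] beyond which the coefficients of [u]
   have square sum at most [e / 4], then approximated by a test function. *)
move=> t0 e0 su; pose c n := t / (lam n + t) * ip u (phi n).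
have e4 : 0 < e / 4 by rewrite divr_gt0.
have [m _ hm] := cvgr_ge _ (parseval_cvg mO se oe ce su) (ip u u - e / 4) ltac:(by rewrite ltrBlDr ltrDl).
have {}hm := hm m (leqnn m); rewrite /= in hm.
have ss := sqint_span mO se c m.
pose A := ip (fun x => u x - span phi c m x) (fun x => u x - span phi c m x).
have A0 : 0 <= A by exact: inner_ge0.
have [d d0 hd] := exists_slack A0 e4.
(* The L^2 error will be multiplied by [1 + d^-1] and the form error by [t^-1]; each should cost at
   most [e / 4]. *)
pose e2 := Num.min (e / 4 / (1 + d^-1)) (t * (e / 4)).
have dd : 0 < 1 + d^-1 by rewrite addr_gt0 ?invr_gt0.
have e20 : 0 < e2 by rewrite lt_min divr_gt0// mulr_gt0.
have [psi [tpsi h1 h2]] := form_approx oO ella eb c m e20.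
exists psi => //; have sp := test_sqint oO tpsi.
pose X := \sum_(k < m) resolvent_weight t (lam k) * ip u (phi k) ^+ 2.
apply: (@le_trans _ _ (X + e)%:E); last first.
  by rewrite EFinD leeD2r// sum_le_nneseries// => n; exact: Kterm0.
rewrite lee_fin.
have E1 : X = \sum_(k < m) (ip u (phi k) - c k) ^+ 2 + t^-1 * \sum_(k < m) lam k * c k ^+ 2.
  rewrite mulr_sumr -big_split/=; apply: eq_bigr => k _.
  rewrite /c /resolvent_weight; have l0k := l0 k.
  by field; rewrite !gt_eqF// addr_gt0.
have E2 : A = ip u u - \sum_(k < m) ip u (phi k) ^+ 2 + \sum_(k < m) (ip u (phi k) - c k) ^+ 2.
  exact: inner_sub_span.
have h3 := inner_sub_tri mO d0 su ss sp.
have h4 : (1 + d^-1) * ip (fun x => span phi c m x - psi x) (fun x => span phi c m x - psi x) <= e / 4.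
  by rewrite mulrC -ler_pdivlMr// (le_trans h1)// ge_min lexx.
have h5 : t^-1 * form (grad psi) (grad psi) <= t^-1 * \sum_(k < m) lam k * c k ^+ 2 + e / 4.
  apply: (@le_trans _ _ (t^-1 * (\sum_(k < m) lam k * c k ^+ 2 + e2))).
    by rewrite ler_pM2l ?invr_gt0.
  by rewrite mulrDr lerD2l ler_pdivrMl// ge_min lexx orbT.
rewrite -/A in h3; move: h3 h4 h5 hd hm E1 E2; clear.
set B := ip _ _; set C := ip _ _; set F := form _ _.
set S1 := \sum_(k < m) (_ - _) ^+ 2; set S2 := \sum_(k < m) lam k * _; set S3 := \sum_(k < m) _ ^+ 2.
by move=> *; lra.
Qed.

Let half_quarter (e : R) : 0 < e -> e / 2 + e / 4 <= e.
Proof. by move=> ?; lra. Qed.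

Let clamp0 k : clamp k 0 = 0 :> R.
Proof. by rewrite /clamp add0r sub0r normrN subrr mul0r. Qed.

Lemma clamp_norm_le k (t : R) : 0 <= k -> `|clamp k t| <= `|t|.
Proof. by move=> k0; have := clamp_lipschitz t 0 k0; rewrite clamp0 !subr0. Qed.

Let measurable_clampT k : measurable_fun setT (clamp k : R -> R).
Proof.
apply: continuous_measurable_fun => t; apply: cvgM; last exact: cst_continuous.
apply: cvgB; apply: cvg_norm; first by apply: cvgD; [exact: cvg_id|exact: cst_continuous].
by apply: cvgB; [exact: cvg_id|exact: cst_continuous].
Qed.

Lemma measurable_clamp k (u : E -> R) :
  measurable_fun (Omega : set (lebesgue_space R N)) (u : lebesgue_space R N -> R) ->
  measurable_fun (Omega : set (lebesgue_space R N)) (fun x : lebesgue_space R N => clamp k (u x)).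
Proof. by move=> mu_; exact: measurableT_comp (measurable_clampT k) mu_. Qed.

Lemma sqint_clamp k u : 0 <= k -> sq u -> sq (fun x => clamp k (u x)).
Proof.
move=> k0 su; have [mu_ _] := su; apply: (sqint_le mO _ _ su).
  exact: measurable_clamp.
by move=> x _; exact: clamp_norm_le.
Qed.

Lemma sqint_cst (c : R) : sq (fun=> c).
Proof.
split; first exact: measurable_cst.
apply/integrableP; split; first exact: measurable_cst.
rewrite integral_cst//; apply: lte_mul_pinfty => //.
exact: Omega_lty.
Qed.

Lemma test_sclamp k e psi : 0 < e -> test_function Omega psi ->
  test_function Omega (fun x => sclamp k e (psi x)).
Proof.
move=> e0 tpsi; apply: (test_sub tpsi); last by move=> x ->; exact: sclamp0.
have [spsi _ _] := tpsi; apply/smoothnP => n.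
have sn := (smoothnP psi).1 spsi n.
have sc c : smoothn n (fun x => Num.sqrt ((psi x + c) ^+ 2 + e ^+ 2)).
  apply: smoothn_sqrt => [x|]; first by rewrite ltr_wpDl ?sqr_ge0 ?exprn_gt0.
  apply: smoothnD; last exact: smoothn_cst.
  have s1 : smoothn n (fun x => psi x + c) by apply: smoothnD => //; exact: smoothn_cst.
  have -> : (fun x => (psi x + c) ^+ 2) = (fun x => (psi x + c) * (psi x + c)) by apply/funext.
  exact: smoothnM.
have -> : (fun x => sclamp k e (psi x)) = (fun x =>
   (Num.sqrt ((psi x + k) ^+ 2 + e ^+ 2) + (-1) * Num.sqrt ((psi x + - k) ^+ 2 + e ^+ 2)) * 2^-1).
  by apply/funext => x; rewrite /sclamp mulN1r.
apply: smoothnM; last exact: smoothn_cst.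
apply: smoothnD; first exact: sc.
by apply: smoothnM; [exact: smoothn_cst|exact: sc].
Qed.

Lemma form_sclamp k e psi : 0 < e -> test_function Omega psi ->
  form (grad (fun x => sclamp k e (psi x))) (grad (fun x => sclamp k e (psi x))) <=
  form (grad psi) (grad psi).
Proof.
move=> e0 tpsi; have ts := test_sclamp k e0 tpsi.
apply: (form_contraction oO ella (grad_sqf oO ts) (grad_sqf oO tpsi)).
move=> x _; have [c c1 dc] := is_derive_sclamp k (psi x) e0; exists c => // i.
have [_ dpsi _] := test_C1c tpsi.
by have [_] := derive_chain (dpsi i x) dc.
Qed.

(** If [psi] nearly minimizes for [u], its smooth truncation competes for the truncation of [u]. The
    form does not grow, the truncation is 1-Lipschitz, and smoothing moves it by at most [eta]
    uniformly, which is small in L^2 because [Omega] has finite measure. *)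
Lemma Kfun_clamp k t u : 0 <= k -> 0 < t -> sq u ->
  (Kfun t (fun x => clamp k (u x)) <= Kfun t u)%E.
Proof.
move=> k0 t0 su; apply/lee_addgt0Pr => e e0.
have e4 : 0 < e / 4 by rewrite divr_gt0.
have [psi tpsi hpsi] := Kfun_ge t0 e4 su; have sp := test_sqint oO tpsi.
pose A := ip (fun x => u x - psi x) (fun x => u x - psi x).
have A0 : 0 <= A by exact: inner_ge0.
have [d d0 hd] := exists_slack A0 e4.
pose V := ip (fun=> 1) (fun=> 1); have V0 : 0 <= V by exact: inner_ge0.
have dd : 0 < 1 + d^-1 by rewrite addr_gt0 ?invr_gt0.
have W0 : 0 <= (1 + d^-1) * V by rewrite mulr_ge0// ltW.
(* Here [q = eta^2], and [q V] bounds the squared L^2 cost of smoothing, [V] being the measure of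
   [Omega]. *)
pose q := e / 4 / ((1 + d^-1) * V + 1).
have q0 : 0 < q by rewrite divr_gt0// ltr_wpDl.
pose eta := Num.sqrt q; have eta0 : 0 < eta by rewrite sqrtr_gt0.
have ts := test_sclamp k eta0 tpsi; have sts := test_sqint oO ts.
have scu := sqint_clamp k0 su; have scp := sqint_clamp k0 sp.
apply: (le_trans (Kfun_le t0 scu ts)).
have h1 := inner_sub_tri mO d0 scu scp sts.
have h2 : ip (fun x => clamp k (u x) - clamp k (psi x)) (fun x => clamp k (u x) - clamp k (psi x)) <= A.
  have [] := sqint_ae_le mO (proj1 (sqintB mO scu scp)) (sqintB mO su sp) (@ler01 R).
  - by apply: aeW => x _; rewrite mul1r; exact: clamp_lipschitz.
  - by rewrite expr1n mul1r.
have h3 : ip (fun x => clamp k (psi x) - sclamp k eta (psi x))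
    (fun x => clamp k (psi x) - sclamp k eta (psi x)) <= q * V.
  have [] := sqint_ae_le mO (proj1 (sqintB mO scp sts)) (sqint_cst 1) (ltW eta0).
  - by apply: aeW => x _; rewrite normr1 mulr1 distrC; exact/sclamp_dist/ltW.
  - by rewrite sqr_sqrtr ?(ltW q0).
have h4 : (1 + d^-1) * ip (fun x => clamp k (psi x) - sclamp k eta (psi x))
    (fun x => clamp k (psi x) - sclamp k eta (psi x)) <= e / 4.
  apply: (@le_trans _ _ ((1 + d^-1) * (q * V))); first by rewrite ler_pM2l.
  by rewrite mulrCA /q mulrAC ler_pdivrMr ?ltr_wpDl// ler_wpM2l ?(ltW e4)// lerDl.
have h5 : (1 + d) * ip (fun x => clamp k (u x) - clamp k (psi x))
   (fun x => clamp k (u x) - clamp k (psi x)) <= A + e / 4.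
  by apply: le_trans hd; rewrite ler_wpM2l// addr_ge0// ltW.
have h6 : t^-1 * form (grad (fun x => sclamp k eta (psi x)))
    (grad (fun x => sclamp k eta (psi x))) <= t^-1 * form (grad psi) (grad psi).
  apply: ler_wpM2l; first by rewrite invr_ge0 ltW.
  exact: form_sclamp.
apply: (@le_trans _ _ ((A + t^-1 * form (grad psi) (grad psi))%:E + (e / 2)%:E)%E).
  rewrite -EFinD lee_fin; apply: le_trans (lerD h1 h6) _.
  move: h5 h4; clear; set B := ip _ _; set C := ip _ _; set F := form _ _.
  by move=> *; lra.
apply: le_trans (leeD2r _ hpsi) _; rewrite -addeA; apply: leeD2l.
rewrite -EFinD lee_fin addrC; exact: half_quarter.
Qed.

Lemma Hsqnorm_clamp s k u : 0 < s < 1 -> 0 <= k -> sq u ->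
  (Hsqnorm Omega lam phi s (fun x => clamp k (u x)) <= Hsqnorm Omega lam phi s u)%E.
Proof.
move=> s01 k0 su; apply: powR_sum_le => // [n|n|t t0]; rewrite ?sqr_ge0//.
exact: Kfun_clamp.
Qed.

End contraction.

(** * The fractional form *)

Section fractional_form.
Context {R : realType} {N : nat}.
Local Notation E := 'rV[R]_N.
Local Notation mu := (@lebesgue_n R N).
Variables (Omega : set E) (a : 'I_N -> 'I_N -> E -> R) (lam : nat -> R)
  (phi : nat -> E -> R) (s : R).
Hypotheses (oO : open Omega) (bO : bounded_set Omega)
  (ella : elliptic_coefficients Omega a) (eb : eigenbasis Omega a lam phi)
  (s01 : 0 < s < 1).
Local Notation sq := (sqint mu Omega).
Local Notation ip := (inner mu Omega).
Local Notation Hs := (Hsqnorm Omega lam phi s).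
Local Notation inH := (Hspace Omega lam phi s).

Let mO := measurable_Omega oO.
Let se := eigenfunction_sqint oO eb.
Let oe := eigenfunction_orthonormal eb.
Let ce := eigenfunction_complete oO eb.
Let l0 n : 0 < lam n := eigenbasis_gt0 eb n.

Lemma coefE u n : coef Omega phi u n = ip u (phi n).
Proof. by []. Qed.

Let coef_lin (b d x y : R) u v w : sq u -> sq v -> sq w -> ip u w = x -> ip v w = y ->
  ip (fun z => b * u z + d * v z) w = b * x + d * y.
Proof. by move=> su sv sw <- <-; exact: inner_linl. Qed.

Lemma HspaceP u : inH u <-> sq u /\ (Hs u < +oo)%E.
Proof. by split=> -[h1 h2]; split => //; apply/(L2_sqint oO). Qed.

Lemma Hspace_sqint u : inH u -> sq u.
Proof. by move=> /HspaceP[]. Qed.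

Let half_sqr n : (lam n `^ (s / 2)) ^+ 2 = lam n `^ s.
Proof. by rewrite expr2 -powRD ?(gt_eqF (l0 n)) ?implybT// -splitr. Qed.

Let c u n := lam n `^ (s / 2) * coef Omega phi u n.

Let c_sqr u n : c u n ^+ 2 = lam n `^ s * coef Omega phi u n ^+ 2.
Proof. by rewrite exprMn half_sqr. Qed.

Let Hs_c u : Hs u = (\sum_(0 <= n <oo) (c u n ^+ 2)%:E)%E.
Proof. by apply: eq_eseriesr => n _; rewrite c_sqr. Qed.

Local Notation W := (LDpow Omega lam phi (s / 2)).

(** [LDpow] selects some L^2 limit. Riesz-Fischer shows that one exists, and any such limit has the
    expected coefficients; only these are used afterwards. *)
Lemma LDpowP u : inH u -> sq (W u) /\ forall n, ip (W u) (phi n) = c u n.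
Proof.
move=> /HspaceP[su fu].
have [w sw hw] : exists2 w, sq w &
    ip (fun x => w x - span phi (c u) n x) (fun x => w x - span phi (c u) n x)
      @[n --> \oo] --> 0.
  by apply: (riesz_fischer mO se oe); rewrite -Hs_c.
have nonempty : exists w, L2 Omega w /\ Lpnorm Omega 2%:E (fun x =>
      w x - \sum_(k < n) lam k `^ (s / 2) * coef Omega phi u k * phi k x)
    @[n --> \oo] --> 0%E.
  exists w; split; first exact/(L2_sqint oO).
  have sB n : sq (fun x => w x - span phi (c u) n x).
    by apply: sqintB => //; exact: sqint_span.
  have : (Num.sqrt (ip (fun x => w x - span phi (c u) n x)
      (fun x => w x - span phi (c u) n x)))%:E @[n --> \oo] --> (0 : R)%:E.
    apply: cvg_EFin; first exact: nearW.
    rewrite -[X in _ --> X]sqrtr0; apply: (cvg_comp _ _ hw).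
    exact: sqrt_continuous.
  by under eq_fun do rewrite -(sqint_Lnorm2 mO (sB _)).
have [h1 h2] := xgetPex (cst 0) nonempty.
have sW : sq (W u) by apply/(L2_sqint oO).
split => // n; apply: (coef_limit mO se oe) => //.
apply: (Lpnorm_cvg0 oO) => [m|]; last exact: h2.
by apply: sqintB => //; exact: sqint_span.
Qed.

(** The bilinear form of the fractional operator. Going through the representatives makes it
    literally the first term of [weak_solution]. *)
Definition dirichlet u v := ip (W u) (W v).

Lemma dirichletC u v : dirichlet u v = dirichlet v u.
Proof. exact: innerC. Qed.

Lemma dirichlet_Hsqnorm u : inH u -> Hs u = (dirichlet u u)%:E.
Proof.
move=> hu; have [sW cW] := LDpowP hu; rewrite Hs_c -(parseval mO se oe ce sW).
by apply: eq_eseriesr => n _; rewrite cW.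
Qed.

Lemma dirichlet_ge0 u : 0 <= dirichlet u u.
Proof. exact: inner_ge0. Qed.

Lemma Hnorm_sqr u : inH u -> Hnorm Omega lam phi s u ^+ 2 = dirichlet u u.
Proof. by move=> hu; rewrite /Hnorm dirichlet_Hsqnorm//= sqr_sqrtr// dirichlet_ge0. Qed.

(** The representatives chosen by [LDpow] need not add up pointwise. The two candidates have the
    same coefficients, hence differ by a null function, which the pairing does not see. *)
Lemma Hspace_lin (b d : R) u v : inH u -> inH v ->
  inH (fun x => b * u x + d * v x) /\
  forall w, inH w ->
    dirichlet (fun x => b * u x + d * v x) w = b * dirichlet u w + d * dirichlet v w.
Proof.
move=> hu hv; have su := Hspace_sqint hu; have sv := Hspace_sqint hv.
have [sWu cWu] := LDpowP hu; have [sWv cWv] := LDpowP hv.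
set uv := fun x => _; have suv : sq uv := sqint_lin mO b d su sv.
pose w x := b * W u x + d * W v x; have sw : sq w := sqint_lin mO b d sWu sWv.
have cw n : ip w (phi n) = c uv n.
  have E1 : ip w (phi n) = b * c u n + d * c v n := coef_lin b d sWu sWv (se n) (cWu n) (cWv n).
  have E2 : coef Omega phi uv n = b * coef Omega phi u n + d * coef Omega phi v n.
    by rewrite !coefE; have Z := coef_lin b d su sv (se n) erefl erefl; exact Z.
  rewrite E1 /c E2; ring.
have huv : inH uv.
  apply/HspaceP; split => //; rewrite Hs_c.
  under eq_eseriesr do rewrite -cw.
  by rewrite (parseval mO se oe ce sw) ltry.
split => // w' hw'; have [sW' _] := LDpowP hw'; have [sWuv cWuv] := LDpowP huv.
rewrite /dirichlet -(inner_linl mO b d sWu sWv sW'); apply: (inner_null mO sWuv sw sW').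
apply: (coef_eq0 mO se oe ce); first exact: (sqintB mO sWuv sw).
by move=> n; rewrite (innerBl mO sWuv sw (se n)) cWuv cw subrr.
Qed.

Local Opaque dirichlet.

Lemma Hspace_sub u v : inH u -> inH v -> inH (u \- v).
Proof.
move=> hu hv; have [+ _] := Hspace_lin 1 (-1) hu hv.
by congr inH; apply/funext => x /=; rewrite mul1r mulN1r.
Qed.

Lemma dirichlet_subl u v w : inH u -> inH v -> inH w ->
  dirichlet (u \- v) w = dirichlet u w - dirichlet v w.
Proof.
move=> hu hv hw; have [_ /(_ w hw) E1] := Hspace_lin 1 (-1) hu hv.
have E2 : u \- v = fun x => 1 * u x + -1 * v x.
  by apply/funext => x /=; rewrite mul1r mulN1r.
rewrite E2 E1; set X := dirichlet u w; set Y := dirichlet v w.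
by rewrite mul1r mulN1r.
Qed.

Lemma Hspace_clamp k u : 0 <= k -> inH u ->
  inH (fun x => clamp k (u x)) /\
  dirichlet (fun x => clamp k (u x)) (fun x => clamp k (u x)) <= dirichlet u u.
Proof.
move=> k0 hu; have [su fu] := (HspaceP u).1 hu.
have := Hsqnorm_clamp oO bO ella eb s01 k0 su => le.
have hc : inH (fun x => clamp k (u x)).
  by apply/HspaceP; split; [exact: sqint_clamp|exact: le_lt_trans le fu].
by split; [exact: hc|move: le; rewrite (dirichlet_Hsqnorm hc) (dirichlet_Hsqnorm hu) lee_fin].
Qed.

(* The truncation w = u - clamp k u satisfies E(w, w) <= 2 E(u, w) since
   E(u - w, u - w) <= E(u, u). *)
Lemma dirichlet_truncation k u : 0 <= k -> inH u ->
  inH (fun x => u x - clamp k (u x)) /\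
  dirichlet (fun x => u x - clamp k (u x)) (fun x => u x - clamp k (u x)) <=
  2 * dirichlet u (fun x => u x - clamp k (u x)).
Proof.
move=> k0 hu; have [hc lec] := Hspace_clamp k0 hu.
have hw : inH (fun x => u x - clamp k (u x)) by exact: (Hspace_sub hu hc).
split; first exact: hw.
set w := fun x => u x - clamp k (u x); set v := fun x => clamp k (u x).
have E1 : dirichlet w w = dirichlet u w - dirichlet v w := dirichlet_subl hu hc hw.
have E2 : dirichlet w u = dirichlet u u - dirichlet v u := dirichlet_subl hu hc hu.
have E3 : dirichlet w v = dirichlet u v - dirichlet v v := dirichlet_subl hu hc hc.
move: lec E1 E2 E3; rewrite -/v (dirichletC w u) (dirichletC w v) (dirichletC u v).
by move: (dirichlet _ _) (dirichlet w w) (dirichlet u w) (dirichlet v w) (dirichlet v u)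
  (dirichlet u u) => *; lra.
Qed.

Lemma poincare u : inH u -> lam 0%N `^ s * ip u u <= dirichlet u u.
Proof.
move=> hu; have su := Hspace_sqint hu.
rewrite -lee_fin EFinM -(parseval mO se oe ce su) -(dirichlet_Hsqnorm hu).
rewrite -nneseriesZl; last by move=> n _; rewrite lee_fin sqr_ge0.
apply: lee_nneseries => [n _ _|n _]; first by rewrite -EFinM lee_fin mulr_ge0 ?powR_ge0 ?sqr_ge0.
rewrite -EFinM lee_fin; apply: ler_wpM2r; first exact: sqr_ge0.
have s0 : 0 <= s by case/andP: s01 => /ltW.
apply: ge0_ler_powR; [exact: s0|by rewrite nnegrE ltW|by rewrite nnegrE ltW|].
by elim: n => // n IH; apply: le_trans IH (eigenbasis_le eb n).
Qed.

(** Termwise, with [x = lam n / t]: the weight [x / (x + 1)] is at most the minimum of [x] and 1,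
    hence at most [x^s] because [0 < s < 1]. *)
Lemma Kfun_Hsqnorm t u : 0 < t -> inH u ->
  (Kfun Omega lam phi t u <= (t `^ (- s) * dirichlet u u)%:E)%E.
Proof.
move=> t0 hu; rewrite EFinM -(dirichlet_Hsqnorm hu).
rewrite -nneseriesZl; last by move=> n _; rewrite lee_fin mulr_ge0 ?powR_ge0 ?sqr_ge0.
apply: lee_nneseries => [n _ _|n _].
  by rewrite lee_fin mulr_ge0 ?sqr_ge0// rw_ge0 ?ltW.
rewrite -EFinM lee_fin [leRHS]mulrA coefE; apply: ler_wpM2r; first exact: sqr_ge0.
have ln := l0 n; have /andP[s0 s1] := s01.
have -> : t `^ (- s) * lam n `^ s = (lam n / t) `^ s.
  rewrite powRM ?invr_ge0 ?(ltW t0) ?(ltW ln)// -(powR_inv1 (ltW t0)) -powRrM.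
  by rewrite mulN1r mulrC.
have x0 : 0 < lam n / t by rewrite divr_gt0.
have [x1|x1] := leP (lam n / t) 1.
  apply: (@le_trans _ _ (lam n / t)).
    rewrite /resolvent_weight; apply: ler_wpM2l; first exact: ltW.
    by rewrite lef_pV2 ?posrE ?addr_gt0// lerDr ltW.
  rewrite -[leLHS]powRr1 ?(ltW x0)//.
  by apply: ger_powR; [rewrite x0 x1|exact: ltW].
apply: (@le_trans _ _ 1); first by apply: rw_le1; [exact: ltW|exact: ln].
rewrite -(pow1R s); apply: ge0_ler_powR; first exact: ltW.
- by rewrite nnegrE ler01.
- by rewrite nnegrE ltW.
- exact: ltW.
Qed.

End fractional_form.

(** * Fractional Nash and Faber-Krahn inequalities *)

Section faber_krahn.
Context {R : realType} {N : nat}.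
Local Notation E := 'rV[R]_N.
Local Notation L := (lebesgue_space R N).
Local Notation mu := (@lebesgue_n R N).
Variables (Omega : set E) (a : 'I_N -> 'I_N -> E -> R) (lam : nat -> R)
  (phi : nat -> E -> R) (s : R).
Hypotheses (oO : open Omega) (bO : bounded_set Omega)
  (ella : elliptic_coefficients Omega a) (eb : eigenbasis Omega a lam phi)
  (s01 : 0 < s < 1).
Local Notation sq := (sqint mu Omega).
Local Notation ip := (inner mu Omega).
Local Notation inH := (Hspace Omega lam phi s).
Local Notation dirichlet := (dirichlet Omega lam phi s).

Let mO := measurable_Omega oO.

Let patch_inner (v w : E -> R) : sq v -> (forall x, w x = if x \in Omega then v x else 0) ->
  (\int[mu]_x (w x ^+ 2)%:E)%E = (ip v v)%:E.
Proof.
move=> sv vw; rewrite (inner_integral mO sv) [RHS]integral_mkcond.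
by apply: eq_integral => x _; rewrite patchE vw; case: ifP => // _; rewrite expr0n.
Qed.

Lemma sqint_integrable u : sq u -> mu.-integrable Omega (fun x => (u x)%:E).
Proof.
move=> su; have := sqint_mul mO su (sqint_cst oO bO 1).
by apply: eq_integrable => // x _; rewrite mulr1.
Qed.

Lemma nash_Omega (r : R) u psi : 0 < r -> sq u -> test_function Omega psi ->
  2 * r ^+ N * ip u u <=
  3 * (2 * r ^+ N * ip (fun x => u x - psi x) (fun x => u x - psi x) +
       2 ^+ N * r ^+ N.+2 * fnorm Omega (grad psi)) +
  2 * (\int[mu]_(x in Omega) `|u x|) ^+ 2.
Proof.
move=> r0 su tpsi; have sp := test_sqint oO tpsi; have sB := sqintB mO su sp.
pose v : L -> R := u \_ Omega.
have mv : measurable_fun setT v.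
  by have [mu_ _] := su; exact: (measurable_restrictT u mO).1.
have := nash_setT r0 (test_C1c tpsi) mv.
have -> : (\int[mu]_x (v x ^+ 2)%:E)%E = (ip u u)%:E.
  by apply: patch_inner => // x; rewrite /v patchE.
have -> : (\int[mu]_x ((v x - psi x) ^+ 2)%:E)%E =
    (ip (fun x => u x - psi x) (fun x => u x - psi x))%:E.
  apply: (patch_inner sB) => x; rewrite /v patchE; case: ifPn => // /negP.
  by rewrite inE => /(test_out tpsi) ->; rewrite subrr.
have -> : (\int[mu]_x (\sum_(i < N) partial i psi x ^+ 2)%:E)%E = (fnorm Omega (grad psi))%:E.
  have i2 i := sqint_mul mO (test_partial_sqint oO i tpsi) (test_partial_sqint oO i tpsi).
  have [iS eS] := EFin_integrable_sum mO (index_enum 'I_N) i2.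
  rewrite /fnorm -[X in _ = X%:E]eS /Rintegral fineK; last exact: integrable_fin_num.
  rewrite [RHS]integral_mkcond; apply: eq_integral => x _; rewrite patchE.
  case: ifPn => [_|/negP]; first by congr EFin; apply: eq_bigr => i _; rewrite expr2.
  rewrite inE => nOx; congr EFin; apply: big1 => i _.
  by rewrite (test_partial_out i tpsi nOx) expr0n.
have -> : (\int[mu]_x `|v x|%:E)%E = (\int[mu]_(x in Omega) `|u x|)%:E.
  have iu := sqint_integrable su.
  rewrite /Rintegral fineK; last first.
    by apply: integrable_fin_num => //; exact: (integrable_abse iu).
  rewrite [RHS]integral_mkcond; apply: eq_integral => x _; rewrite /v !patchE.
  by case: ifP => // _; rewrite normr0.
by rewrite expr2 -lee_fin; apply: le_trans.
Qed.

(** By coercivity the right side of [nash_Omega] contains [r^N] times the squared distance to [psi]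
    plus [r^2] times the form of [psi]. This is the quantity minimized by [Kfun] at [t = r^-2], so
    the infimum is at most [r^(2s)] times the fractional form. *)
Let nash_constant : exists2 K : R, 0 < K & forall (r : R) u, 0 < r -> inH u ->
  2 * r ^+ N * ip u u <= K * (r ^+ N * ((r ^+ 2) `^ s * dirichlet u u)) +
    2 * (\int[mu]_(x in Omega) `|u x|) ^+ 2.
Proof.
have [g g0 hg] := form_coercive oO ella.
(* The 6 serves the L^2 term of [nash_Omega], the rest its gradient term, [g] being the coercivity
   constant. *)
pose K := 6 + 3 * 2 ^+ N / g.
have K0 : 0 < K by rewrite addr_gt0// divr_gt0// mulr_gt0// exprn_gt0.
exists K; first exact: K0.
move=> r u r0 hu; have su := Hspace_sqint oO hu.
have rN : 0 < r ^+ N by rewrite exprn_gt0.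
apply/ler_addgt0Pr => e e0.
have t0 : 0 < (r ^+ 2)^-1 by rewrite invr_gt0 exprn_gt0.
have d0 : 0 < e / (K * r ^+ N) by rewrite divr_gt0// mulr_gt0.
have [psi tpsi hpsi] := Kfun_ge oO ella eb t0 d0 su.
have := le_trans hpsi (leeD2r (e / (K * r ^+ N))%:E (Kfun_Hsqnorm oO eb s01 t0 hu)).
rewrite -EFinD lee_fin invrK.
have -> : (r ^+ 2)^-1 `^ (- s) = (r ^+ 2) `^ s.
  by rewrite -powR_inv1 ?exprn_ge0 ?ltW// -powRrM mulN1r opprK.
have := nash_Omega r0 su tpsi; have := hg _ (grad_sqf oO tpsi).
set I := ip u u; set B := ip _ _; set F := fnorm _ _; set Fo := form _ _ _ _.
set D := _ `^ s * _; set A := (\int[mu]_(x in Omega) _) ^+ 2 => gF h1 h2.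
have B0 : 0 <= B by exact: inner_ge0.
have Fo0 : 0 <= Fo by exact: (form_ge0 oO ella (grad_sqf oO tpsi)).
have r2 : 0 < r ^+ 2 by rewrite exprn_gt0.
apply: (le_trans h1); rewrite -[leRHS]addrAC; apply: lerD; last exact: lexx.
apply: (@le_trans _ _ (K * r ^+ N * (B + r ^+ 2 * Fo))); last first.
  apply: (@le_trans _ _ (K * r ^+ N * (D + e / (K * r ^+ N)))).
    by rewrite ler_pM2l// mulr_gt0.
  by rewrite mulrDr (mulrC _ (e / _)) divfK ?gt_eqF ?mulr_gt0// -[X in X + _]mulrA.
have h3 : 2 ^+ N * r ^+ N.+2 * F <= 2 ^+ N / g * r ^+ N * (r ^+ 2 * Fo).
  have -> : 2 ^+ N / g * r ^+ N * (r ^+ 2 * Fo) = 2 ^+ N * r ^+ N.+2 * (Fo / g).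
    by rewrite -(addn2 N) exprD; ring.
  apply: ler_wpM2l; first by rewrite mulr_ge0 ?exprn_ge0// ltW.
  by rewrite ler_pdivlMr// mulrC.
have C0 : 0 <= 2 ^+ N / g by rewrite divr_ge0 ?exprn_ge0// ltW.
have E1 : 3 * 2 ^+ N / g = 3 * (2 ^+ N / g) by rewrite mulrA.
rewrite /K E1; move: (2 ^+ N / g) C0 h3 => C C0 h3.
have r2F : 0 <= r ^+ 2 * Fo by rewrite mulr_ge0// ltW.
apply: (@le_trans _ _ (3 * (2 * r ^+ N * B + C * r ^+ N * (r ^+ 2 * Fo)))).
  by rewrite ler_pM2l// lerD2l.
have := mulr_ge0 (ltW rN) r2F; have := mulr_ge0 C0 (mulr_ge0 (ltW rN) B0).
move=> p1 p2.
have -> : (6 + 3 * C) * r ^+ N * (B + r ^+ 2 * Fo) =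
  3 * (2 * r ^+ N * B + C * r ^+ N * (r ^+ 2 * Fo)) +
  (3 * (C * (r ^+ N * B)) + 6 * (r ^+ N * (r ^+ 2 * Fo))) by ring.
by rewrite lerDl; apply: addr_ge0; apply: mulr_ge0.
Qed.

(** For [u] vanishing outside [A], Cauchy-Schwarz bounds the squared L^1 norm by the measure of [A]
    times the squared L^2 norm, and the side of the cubes is adjusted to absorb this term. *)
Lemma faber_krahn : (0 < N)%N -> exists2 C : R, 0 < C & forall u (A : set E), inH u ->
  measurable (A : set L) -> A `<=` Omega -> (forall x, Omega x -> ~ A x -> u x = 0) ->
  ip u u <= C * fine (mu A) `^ (2 * s / N%:R) * dirichlet u u.
Proof.
move=> N0; have [K K0 hK] := nash_constant.
have p20 : 0 < 2 `^ (2 * s / N%:R) :> R by rewrite powR_gt0.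
exists (K * 2 `^ (2 * s / N%:R)); first by rewrite mulr_gt0.
move=> u A hu mA AO uA; have su := Hspace_sqint oO hu.
have fA : (mu A < +oo)%E.
  by apply: le_lt_trans (Omega_lty oO bO); apply: le_measure => //; rewrite inE.
have A0 : 0 <= fine (mu A) by rewrite fine_ge0.
have sI : sq (\1_A : L -> R).
  apply: (sqint_le mO _ _ (sqint_cst oO bO 1)).
    by apply: measurable_funTS; exact: measurable_indic.
  by move=> x _; rewrite indicE normr1; case: (x \in A); rewrite ?normr1 ?normr0.
have sau : sq (fun x => `|u x|).
  apply: (sqint_le mO _ _ su) => [|x _]; last by rewrite normr_id.
  by have [mu_ _] := su; exact: measurableT_comp.
have h1 : (\int[mu]_(x in Omega) `|u x|) ^+ 2 <= ip u u * fine (mu A).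
  have := cauchy_schwarz mO sau sI.
  have -> : ip (fun x => `|u x|) \1_A = \int[mu]_(x in Omega) `|u x|.
    apply: eq_Rintegral => x /set_mem Ox; rewrite indicE.
    case: (boolP (x \in A)) => [_|/negP]; first by rewrite mulr1.
    by rewrite inE => /(uA _ Ox) ->; rewrite normr0 mul0r.
  have -> : ip (fun x => `|u x|) (fun x => `|u x|) = ip u u.
    by apply: eq_Rintegral => x _; rewrite -normrM ger0_norm// -expr2 sqr_ge0.
  have -> // : ip \1_A \1_A = fine (mu A).
  rewrite /inner; transitivity (\int[mu]_(x in Omega) (\1_A x : R)).
    by apply: eq_Rintegral => x _; rewrite !indicE -natrM mulnb andbb.
  by rewrite /Rintegral integral_indic// setIC setIidr.
have D0 : 0 <= dirichlet u u := dirichlet_ge0 Omega lam phi s u.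
(* A null [A] would give cubes of side 0; in that case [u] vanishes almost everywhere. *)
have [al0|al] := eqVneq (fine (mu A)) 0.
  have -> : ip u u = 0.
    have -> : ip u u = ip (fun=> 0) (fun=> 0).
      apply: ae_inner => //; [exact: sqint0..|].
      exists A; split => //.
        by rewrite -[LHS]fineK ?ge0_fin_numE// al0.
      move=> x /= h; apply: contrapT => nAx; apply: h => Ox.
      by rewrite (uA _ Ox nAx).
    exact: inner_zero.
  by rewrite mulr_ge0// mulr_ge0 ?powR_ge0// ltW// mulr_gt0.
have {}al : 0 < fine (mu A) by rewrite lt_neqAle eq_sym al.
move: h1 al A0; set al := fine (mu A) => h1 al_gt0 A0.
have al2 : 0 < 2 * al by rewrite mulr_gt0.
(* With [r^N] equal to twice the measure of [A], the L^1 term is at most half of the left side. *)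
pose r := (2 * al) `^ N%:R^-1; have r0 : 0 < r by rewrite powR_gt0.
have rN : r ^+ N = 2 * al.
  rewrite -powR_mulrn ?(ltW r0)// -powRrM mulVf ?powRr1 ?(ltW al2)//.
  by rewrite pnatr_eq0 -lt0n.
have rs : (r ^+ 2) `^ s = 2 `^ (2 * s / N%:R) * al `^ (2 * s / N%:R).
  rewrite -powRM ?(ltW al_gt0)// -powR_mulrn ?(ltW r0)// -!powRrM.
  by congr (_ `^ _); ring.
have := hK r u r0 hu; rewrite rN rs => h2.
rewrite -[X in X * _]mulrA -mulrA -(ler_pM2l al2).
move: h1 h2; set I := ip u u; set Q := _ `^ _ * _; set A2 := _ ^+ 2 => h1 h2.
have -> : 2 * al * (K * (Q * dirichlet u u)) = K * (2 * al * (Q * dirichlet u u)) by ring.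
move: (K * _) h2 => X h2.
have E1 : 2 * (2 * al) * I = 2 * al * I + 2 * (I * al) by ring.
by rewrite E1 in h2; move: (2 * al * I) h2 => Y h2; lra.
Qed.

End faber_krahn.

(** * The nonlinearity *)

Section measurable_composition.
Context d (T : measurableType d) (R : realType).
Variables (mu : {measure set T -> \bar R}) (D : set T).
Hypothesis mD : measurable D.

Lemma measurable_fun_countable (I : countType) (q : T -> I) (g : I -> T -> R) :
  (forall i, measurable (D `&` q @^-1` [set i])) ->
  (forall i, measurable_fun D (g i)) -> measurable_fun D (fun x => g (q x) x).
Proof.
move=> mq mg _ B mB.
have -> : D `&` (fun x => g (q x) x) @^-1` B =
    \bigcup_i ((D `&` q @^-1` [set i]) `&` (D `&` g i @^-1` B)).
  apply/seteqP; split=> [x [Dx Bx]|x [i _ [[Dx <-] [_ Bx]]]]; last by split.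
  by exists (q x).
apply: countable_bigcupT_measurable => [|i]; first exact: countableP.
by apply: measurableI; [exact: mq|exact: mg].
Qed.

Lemma measurable_fun_quantized (f : T -> R -> R) (u : T -> R) (n : nat) :
  (forall t, measurable_fun D (f ^~ t)) -> measurable_fun D u ->
  measurable_fun D (fun x => f x ((Num.floor (u x * n.+1%:R))%:~R / n.+1%:R)).
Proof.
move=> mf mu_.
apply: (measurable_fun_countable (q := fun x => Num.floor (u x * n.+1%:R))
  (g := fun i x => f x (i%:~R / n.+1%:R))) => [i|i]; last exact: mf.
have mun : measurable_fun D (fun x => u x * n.+1%:R) by exact: measurable_funM.
have -> : (fun x => Num.floor (u x * n.+1%:R)) @^-1` [set i] =
    (fun x => u x * n.+1%:R) @^-1` `[i%:~R, (i + 1)%:~R[.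
  apply/seteqP; split=> x /=; rewrite in_itv/=.
    by move=> <-; rewrite floor_le floorD1_gt.
  by move=> h; exact: floor_def.
exact: mun.
Qed.

(** Off a measurable null set the convergence holds everywhere; completeness of the measure then
    allows arbitrary values on that set. *)
Lemma ae_cvg_measurable (h : nat -> T -> R) (f : T -> R) : measure_is_complete mu ->
  (forall n, measurable_fun D (h n)) ->
  {ae mu, forall x, D x -> h n x @[n --> \oo] --> f x} -> measurable_fun D f.
Proof.
move=> cmu mh [Z [mZ Z0 subZ]].
have mI : measurable_fun D (\1_(~` Z) : T -> R).
  by apply: measurable_funTS; apply: measurable_indic; exact: measurableC.
have mg : measurable_fun D (fun x => f x * \1_(~` Z) x).
  apply: (measurable_fun_cvg (h := fun n x => h n x * \1_(~` Z) x)) => [n|x Dx].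
    exact: measurable_funM.
  rewrite indicE; case: (boolP (x \in ~` Z)) => [|_].
    rewrite inE => nZx; under eq_fun do rewrite mulr1.
    by rewrite mulr1; apply: contrapT => nx; apply: nZx; apply: subZ => /= /(_ Dx).
  by under eq_fun do rewrite mulr0; rewrite mulr0; exact: cvg_cst.
apply/measurable_EFinP; apply: (ae_measurable_fun cmu (f := EFin \o (fun x => f x * \1_(~` Z) x))).
  exists Z; split => // x /= nx; apply: contrapT => nZx; apply: nx => _.
  by rewrite indicE mem_set// mulr1.
exact/measurable_EFinP.
Qed.

(** Round [u] down to multiples of [1 / (n + 1)]. The composition is then glued from countably many
    functions [f(., t)], and continuity in the second variable gives the limit. *)
Lemma caratheodory_measurable_comp (f : T -> R -> R) (u : T -> R) : measure_is_complete mu ->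
  (forall t, measurable_fun D (f ^~ t)) ->
  {ae mu, forall x, D x -> continuous (f x)} ->
  measurable_fun D u -> measurable_fun D (fun x => f x (u x)).
Proof.
move=> cmu mf cf mu_.
apply: (ae_cvg_measurable cmu (fun n => measurable_fun_quantized n mf mu_)).
apply: filterS cf => x h Dx.
apply: (cvg_comp (fun n : nat => (Num.floor (u x * n.+1%:R))%:~R / n.+1%:R : R) (f x));
  last exact: h.
apply/cvgrPdist_le => e e0.
have := @cvg_harmonic R => /cvgrPdist_le /(_ e e0); apply: filterS => n.
rewrite sub0r normrN ger0_norm ?invr_ge0// => hn; apply: le_trans hn.
have n0 : 0 < n.+1%:R :> R by rewrite ltr0n.
have -> : u x - (Num.floor (u x * n.+1%:R))%:~R / n.+1%:R =
    (u x * n.+1%:R - (Num.floor (u x * n.+1%:R))%:~R) / n.+1%:R.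
  by field; rewrite gt_eqF.
rewrite normrM (ger0_norm (x := n.+1%:R^-1)) ?invr_ge0// ler_piMl ?invr_ge0//.
have := floor_le (u x * n.+1%:R); have := floorD1_gt (u x * n.+1%:R).
rewrite intrD ler_norml => h1 h2; apply/andP; split; lra.
Qed.

End measurable_composition.

(** * Primitives of increasing functions: Riemann sums and doubling *)

Section monotone_primitive.
Context {R : realType}.
Variable h : R -> R.
Hypotheses (ch : continuous h) (mh : {homo h : x y / x <= y}) (h0 : h 0 = 0).

Let P (t : R) : R := \int[lebesgue_measure]_(tau in `[0, `|t|]) h tau.

Let h_ge0 t : 0 <= t -> 0 <= h t.
Proof. by move=> /mh; rewrite h0. Qed.

Let int_h (a b : R) : lebesgue_measure.-integrable `[a, b] (EFin \o h).
Proof.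
apply: continuous_compact_integrable; first exact: segment_compact.
exact: continuous_subspaceT.
Qed.

Lemma primitive_sub a b : 0 <= a -> a <= b ->
  (b - a) * h a <= P b - P a <= (b - a) * h b.
Proof.
move=> a0 ab; have b0 := le_trans a0 ab.
rewrite /P (ger0_norm a0) (ger0_norm b0) Rintegral_itvB//; [|by rewrite bnd_simp..].
have i1 : lebesgue_measure.-integrable `]a, b] (EFin \o h).
  by apply: integrableS (int_h a b) => //; exact: subset_itv_oc_cc.
have Ec (c : R) : lebesgue_measure.-integrable `]a, b] (EFin \o (cst c : R -> R)) /\
    \int[lebesgue_measure]_(x in `]a, b]) c = (b - a) * c.
  split.
    have ic : lebesgue_measure.-integrable `[a, b] (EFin \o (cst c : R -> R)).
      apply: continuous_compact_integrable; first exact: segment_compact.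
      by apply: continuous_subspaceT; exact: cst_continuous.
    by apply: integrableS ic => //; exact: subset_itv_oc_cc.
  rewrite Rintegral_cst//= lebesgue_measure_itv/= lte_fin mulrC.
  case: ltP => [_|ba]; first by [].
  by rewrite (le_anti (introT andP (conj ab ba))) subrr.
have [ia ea] := Ec (h a); have [ib eb] := Ec (h b).
rewrite -{1}ea -{1}eb; apply/andP; split; apply: le_Rintegral => // x /=; rewrite in_itv/= => /andP[ax xb].
  by apply: mh; exact: ltW.
exact: mh.
Qed.

Lemma primitive0 : P 0 = 0.
Proof. by rewrite /P normr0 set_itv1 Rintegral_set1. Qed.

Lemma primitive_ge0 t : 0 <= P t.
Proof.
have -> : P t = P `|t| by rewrite /P normr_id.
have /andP[+ _] := primitive_sub (lexx 0) (normr_ge0 t).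
by rewrite primitive0 h0 mulr0 subr0.
Qed.

Lemma primitive_le t u : `|t| <= `|u| -> P t <= P u.
Proof.
move=> tu; have E v : P v = P `|v| by rewrite /P normr_id.
rewrite (E t) (E u) -subr_ge0; have /andP[+ _] := primitive_sub (normr_ge0 t) tu.
by apply: le_trans; rewrite mulr_ge0 ?subr_ge0// h_ge0.
Qed.

(** Left Riemann sums of an increasing function on [[0, b]] are off by at most [b h(b) / (n + 1)],
    by telescoping. The sums involve only values of [h], so the primitive becomes measurable in [x]
    when [h] is [f x]. *)
Lemma primitive_riemann t :
  \sum_(i < n.+1) `|t| / n.+1%:R * h (`|t| * (i%:R / n.+1%:R)) @[n --> \oo] --> P t.
Proof.
have -> : P t = P `|t| by rewrite /P normr_id.
set b := `|t|; have b0 : 0 <= b by exact: normr_ge0.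
have bound n : 0 <= P b - \sum_(i < n.+1) b / n.+1%:R * h (b * (i%:R / n.+1%:R)) <=
    b * h b * n.+1%:R^-1.
  have n0 : 0 < n.+1%:R :> R by rewrite ltr0n.
  pose x i := b * (i%:R / n.+1%:R).
  have x1 : x n.+1 = b by rewrite /x divff ?mulr1// gt_eqF.
  have x0 : x 0%N = 0 by rewrite /x mul0r mulr0.
  have dx i : x i.+1 - x i = b / n.+1%:R by rewrite /x -mulrBr -mulrBl -natrB ?subSnn ?mul1r.
  have -> : P b = \sum_(i < n.+1) (P (x i.+1) - P (x i)).
    rewrite -(big_mkord xpredT (fun i => P (x i.+1) - P (x i))) telescope_sumr//.
    by rewrite x1 x0 primitive0 subr0.
  have hx : h b = \sum_(i < n.+1) (h (x i.+1) - h (x i)).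
    rewrite -(big_mkord xpredT (fun i => h (x i.+1) - h (x i))) telescope_sumr//.
    by rewrite x1 x0 h0 subr0.
  have px i : (x i.+1 - x i) * h (x i) <= P (x i.+1) - P (x i) <= (x i.+1 - x i) * h (x i.+1).
    apply: primitive_sub; first by rewrite /x mulr_ge0// divr_ge0.
    by rewrite -subr_ge0 dx divr_ge0// ltW.
  rewrite -sumrB; apply/andP; split.
    by apply: sumr_ge0 => i _; have /andP[+ _] := px i; rewrite dx subr_ge0.
  have -> : b * h b * n.+1%:R^-1 = b / n.+1%:R * h b by rewrite mulrAC.
  rewrite hx mulr_sumr; apply: ler_sum => i _.
  by rewrite mulrBr lerD2r -(dx i); have /andP[] := px i.
apply/cvgrPdist_le => e e0.
have := @cvg_harmonic R; have : b * h b @[_ --> \oo] --> b * h b by exact: cvg_cst.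
move=> /cvgM cM /cM; rewrite mulr0 => /cvgrPdist_le /(_ e e0); apply: filterS => n.
have /andP[l1 l2] := bound n.
by rewrite sub0r normrN (ger0_norm l1) => h3; apply: le_trans l2 (le_trans (ler_norm _) h3).
Qed.

(** Put [T = (1 + c) t]. The increment of the primitive from [t] to [T] is at most [c t h(T)], and
    the hypothesis at [T] bounds this by the primitive at [T] divided by [1 + c], which is absorbed
    on the left. *)
Lemma primitive_enlarge (c : R) t : 0 < c -> 0 <= t ->
  (forall t, c * (t * h t) <= P t) -> P ((1 + c) * t) <= (1 + c) / c * P t.
Proof.
move=> c0 t0 hc; have c1 : 0 < 1 + c by rewrite addr_gt0.
have tt : t <= (1 + c) * t by rewrite mulrDl mul1r lerDl mulr_ge0// ltW.
have /andP[_ h1] := primitive_sub t0 tt.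
have h2 := hc ((1 + c) * t).
rewrite mulrAC ler_pdivlMr// .
have E1 : (1 + c) * t - t = c * t by ring.
rewrite E1 in h1.
have E2 : c * ((1 + c) * t * h ((1 + c) * t)) = (1 + c) * (c * t * h ((1 + c) * t)) by ring.
rewrite E2 in h2; have h3 := ler_wpM2l (ltW c1) h1.
move: h2 h3; move: (P ((1 + c) * t)) (P t) (c * t * h _) => p q r h2 h3; nra.
Qed.

End monotone_primitive.

(* Since F(x, (1 + c) t) <= (1 + 1/c) F(x, t), the primitive satisfies the
   doubling condition, with a constant depending on c only. *)
Lemma primitive_doubling {R : realType} (c : R) : 0 < c <= 1 -> exists2 K : R, 0 < K &
  forall h : R -> R, continuous h -> {homo h : x y / x <= y} -> h 0 = 0 ->
  (forall t, c * (t * h t) <= \int[lebesgue_measure]_(tau in `[0, `|t|]) h tau) ->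
  forall t u v : R, `|v| <= `|t| + `|u| ->
   \int[lebesgue_measure]_(tau in `[0, `|v|]) h tau <=
   K * (\int[lebesgue_measure]_(tau in `[0, `|t|]) h tau +
        \int[lebesgue_measure]_(tau in `[0, `|u|]) h tau).
Proof.
move=> /andP[c0 c1]; have d1 : 1 < 1 + c by rewrite ltrDl.
have [m hm] := expr_unbounded d1 2.
have K0 : 0 < (1 + c) / c by rewrite divr_gt0// addr_gt0.
exists (((1 + c) / c) ^+ m); first by rewrite exprn_gt0.
move=> h ch mh h0 hc t u v vtu.
pose P (t : R) : R := \int[lebesgue_measure]_(tau in `[0, `|t|]) h tau.
have P0 := primitive_ge0 ch mh h0.
have iter k x : 0 <= x -> P ((1 + c) ^+ k * x) <= ((1 + c) / c) ^+ k * P x.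
  elim: k x => [|k IH] x x0; first by rewrite !expr0 !mul1r.
  rewrite exprS -mulrA; apply: le_trans (primitive_enlarge ch mh c0 _ hc) _.
    by rewrite mulr_ge0// exprn_ge0// addr_ge0// ltW.
  by rewrite exprS -[leRHS]mulrA; apply: ler_wpM2l; [exact: ltW|exact: IH].
suff main t' u' : `|u'| <= `|t'| -> `|v| <= `|t'| + `|u'| ->
    P v <= ((1 + c) / c) ^+ m * (P t' + P u').
  have [ut|/ltW tu] := leP `|u| `|t|; first exact: main.
  by rewrite (addrC (\int[_]_(_ in _) _)); apply: main => //; rewrite addrC.
move=> {vtu} tu vtu.
apply: (@le_trans _ _ (P ((1 + c) ^+ m * `|t'|))).
  apply: (primitive_le ch mh h0); apply: (le_trans vtu).
  apply: (le_trans _ (ler_norm _)); apply: (@le_trans _ _ (2 * `|t'|)).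
    by rewrite mulr_natl mulr2n lerD2l.
  exact: ler_wpM2r.
apply: le_trans (iter m _ (normr_ge0 _)) _.
apply: ler_wpM2l; first by rewrite exprn_ge0// ltW.
by rewrite /P normr_id lerDl; exact: P0.
Qed.

Lemma lebesgue_n_complete (R : realType) (N : nat) : measure_is_complete (@lebesgue_n R N).
Proof. exact: measure_is_complete_caratheodory. Qed.

Lemma ae_integrable_le d (T : measurableType d) (R : realType)
    (mu : {measure set T -> \bar R}) (D : set T) (u v : T -> R) : measurable D ->
  measurable_fun D u -> {ae mu, forall x, D x -> `|u x| <= v x} ->
  mu.-integrable D (fun x => (v x)%:E) -> mu.-integrable D (fun x => (u x)%:E).
Proof.
move=> mD mu_ uv iv; have /integrableP[mv fv] := iv.
apply/integrableP; split; first exact/measurable_EFinP.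
apply: le_lt_trans fv; apply: ae_ge0_le_integral => //.
- by apply: measurableT_comp => //; exact/measurable_EFinP.
- by apply: measurableT_comp.
- by apply: filterS uv => x h Dx /=; rewrite lee_fin (le_trans (h Dx))// ler_norm.
Qed.

Lemma sub_arith (R : realFieldType) (A B C D : R) : 0 <= A - B -> C - D <= (C + A) - (D + B).
Proof. by move=> ?; lra. Qed.

(** * Admissible test functions and the difference of two equations *)

Section nonlinearity.
Context {R : realType} {N : nat}.
Local Notation E := 'rV[R]_N.
Local Notation L := (lebesgue_space R N).
Local Notation mu := (@lebesgue_n R N).
Variables (Omega : set E) (a : 'I_N -> 'I_N -> E -> R) (lam : nat -> R)
  (phi : nat -> E -> R) (s : R) (f : E -> R -> R).
Hypotheses (oO : open Omega) (bO : bounded_set Omega)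
  (ella : elliptic_coefficients Omega a) (eb : eigenbasis Omega a lam phi)
  (s01 : 0 < s < 1) (fA : assumptionA f Omega).
Local Notation inH := (Hspace Omega lam phi s).
Local Notation V0 := (V0 f Omega lam phi s).
Local Notation dirichlet := (dirichlet Omega lam phi s).
Local Notation P := (primitive f).

Let mO := measurable_Omega oO.

Definition regular_at (x : E) := [/\ forall t : R, f x `|t| = `|f x t|,
  {homo f x : t t' / t <= t'}, continuous (f x) & f x 0 = 0].

Lemma regular_ae : {ae mu, forall x, Omega x -> regular_at x}.
Proof.
have [h _ _] := fA; move: h; apply: ae_sub => x h Ox.
have [odd inc cf f0 _] := h Ox.
have mono : {homo f x : t t' / t <= t'}.
  by move=> t t'; rewrite le_eqVlt => /predU1P[->//|/inc /ltW].
split => // t; have [t0|t0] := leP 0 t.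
  have ft : 0 <= f x t by rewrite -f0; exact: mono.
  by rewrite (ger0_norm t0) (ger0_norm ft).
have ft : f x t <= 0 by rewrite -f0; apply: mono; exact: ltW.
by rewrite (ltr0_norm t0) odd (ler0_norm ft).
Qed.

Lemma measurable_nemytskii (v : L -> R) : measurable_fun (Omega : set L) v ->
  measurable_fun (Omega : set L) (fun x : L => f x (v x)).
Proof.
move=> mv; have [_ mf _] := fA.
apply: (caratheodory_measurable_comp (f := f : L -> R -> R) mO (@lebesgue_n_complete R N)) => //.
by have := regular_ae; apply: ae_sub => x h Ox; have [] := h Ox.
Qed.

Lemma measurable_primitive (v : L -> R) : measurable_fun (Omega : set L) v ->
  measurable_fun (Omega : set L) (fun x : L => P x (v x)).
Proof.
move=> mv; pose h n (x : L) : R :=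
  \sum_(i < n.+1) `|v x| / n.+1%:R * f x (`|v x| * (i%:R / n.+1%:R)).
have mav : measurable_fun (Omega : set L) (fun x => `|v x|) by exact: measurableT_comp.
have mc (c : R) : measurable_fun (Omega : set L) (fun x => `|v x| * c).
  by apply: measurable_funM => //; exact: measurable_cst.
apply: (@ae_cvg_measurable _ L R mu Omega h (fun x : L => P x (v x)) (@lebesgue_n_complete R N)) => [n|].
  apply: measurable_sum => i; apply: measurable_funM; first exact: mc.
  exact: measurable_nemytskii (mc _).
have := regular_ae; apply: ae_sub => x hx Ox; have [_ mono cf f0] := hx Ox.
exact: primitive_riemann.
Qed.

(** The pointwise facts that make a function dominated by two members of [V0] admissible, together
    with the sign of the nonlinear term. The part [K] is the doubling constant; [2 / c1] comes from
    [t f(x, t) <= F(x, t) / c1]. *)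
Lemma nonlinear_bounds : exists2 K : R, 0 < K &
  {ae mu, forall x, Omega x -> forall t1 t2 v : R, `|v| <= `|t1| + `|t2| ->
    [/\ `|P x v| <= K * (P x t1 + P x t2), `|f x t1 * v| <= K * (P x t1 + P x t2) &
        0 <= (t1 - t2) * v -> 0 <= (f x t1 - f x t2) * v]}.
Proof.
have [_ _ [c1 [c2 [c101 _ fc]]]] := fA.
have [K K0 hK] := primitive_doubling c101.
have c0 : 0 < c1 by case/andP: c101.
exists (K + 2 / c1); first by rewrite addr_gt0// divr_gt0.
have both := ae_and regular_ae fc.
move: both; apply: ae_sub => x [hreg hfc] Ox t1 t2 v vt.
have [fn mono cf f0] := hreg Ox.
have Pge (t : R) : c1 * (t * f x t) <= P x t by have [/andP[]] := hfc Ox t.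
have P0 (t : R) : 0 <= P x t := primitive_ge0 cf mono f0 t.
have dbl := hK (f x) cf mono f0 Pge t1 t2 v vt.
have fa (t : R) : 0 <= f x `|t| by rewrite fn.
have tf (t : R) : `|t| * f x `|t| <= P x t / c1.
  rewrite ler_pdivlMr// mulrC; apply: le_trans (Pge `|t|) _.
  by rewrite /primitive normr_id.
split.
- rewrite (ger0_norm (P0 v)); apply: (le_trans dbl); rewrite mulrDl lerDl.
  by rewrite mulr_ge0// ?addr_ge0// divr_ge0// ltW.
- rewrite normrM -fn; apply: (@le_trans _ _ (f x `|t1| * (`|t1| + `|t2|))).
    exact: ler_wpM2l.
  (* By monotonicity the mixed product is below the diagonal product of the larger argument. *)
  have h1 : f x `|t1| * `|t2| <= `|t1| * f x `|t1| + `|t2| * f x `|t2|.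
    have [le|/ltW le] := leP `|t2| `|t1|.
      apply: (@le_trans _ _ (f x `|t1| * `|t1|)); first exact: ler_wpM2l.
      by rewrite mulrC lerDl mulr_ge0.
    apply: (@le_trans _ _ (f x `|t2| * `|t2|)); first by apply: ler_wpM2r => //; exact: mono.
    by rewrite [X in X <= _]mulrC lerDr mulr_ge0.
  have := tf t1; have := tf t2; have p1 := P0 t1; have p2 := P0 t2.
  have KP : 0 <= K * (P x t1 + P x t2) by rewrite mulr_ge0 ?addr_ge0// ltW.
  have c1P : 0 <= P x t2 / c1 by rewrite divr_ge0// ltW.
  rewrite mulrDr (mulrC _ `|t1|) (mulrDl K).
  have -> : 2 / c1 * (P x t1 + P x t2) = 2 * (P x t1 / c1) + 2 * (P x t2 / c1) by ring.
  move: h1 KP c1P; move: (f x `|t1| * `|t2|) (`|t1| * f x `|t1|) (`|t2| * f x `|t2|)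
    (K * _) (P x t1 / c1) (P x t2 / c1) => *; lra.
- have [lt|lt|->] := ltgtP t1 t2; last by rewrite !subrr mul0r.
    rewrite (nmulr_rge0 (x := t1 - t2)) ?subr_lt0// => v0.
    by rewrite mulr_le0// subr_le0; exact/mono/ltW.
  rewrite (pmulr_rge0 (x := t1 - t2)) ?subr_gt0// => v0.
  by rewrite mulr_ge0// subr_ge0; exact/mono/ltW.
Qed.

Let V0_measurable u : V0 u -> measurable_fun (Omega : set L) (u : L -> R).
Proof. by move=> [/(Hspace_sqint oO)[]]. Qed.

(** [V0] is not closed under addition by definition. Domination covers [u1 - u2] and the parts of it
    beyond a level, the functions with which both equations are tested. *)
Lemma V0_dominated u1 u2 v : V0 u1 -> V0 u2 -> inH v ->
  (forall x, `|v x| <= `|u1 x| + `|u2 x|) ->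
  V0 v /\ mu.-integrable Omega (fun x => (f x (u1 x) * v x)%:E).
Proof.
move=> Vu1 Vu2 hv vu; have mu1 := V0_measurable Vu1; have mu2 := V0_measurable Vu2.
have mv : measurable_fun (Omega : set L) (v : L -> R) by case: (Hspace_sqint oO hv).
have [K K0 hK] := nonlinear_bounds.
have iP : mu.-integrable Omega (fun x : L => (K * (P x (u1 x) + P x (u2 x)))%:E).
  apply: EFin_integrableZ => //.
  by apply: EFin_integrableD => //; [case: Vu1|case: Vu2].
split.
  split; first exact: hv.
  apply: (ae_integrable_le mO (measurable_primitive mv) _ iP).
  by move: hK; apply: ae_sub => x h Ox; have [] := h Ox _ _ _ (vu x).
apply: (ae_integrable_le mO _ _ iP).
  exact: measurable_funM (measurable_nemytskii mu1) mv.
by move: hK; apply: ae_sub => x h Ox; have [] := h Ox _ _ _ (vu x).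
Qed.

Lemma weak_solution_sub z1 z2 u1 u2 v :
  weak_solution f Omega lam phi s z1 u1 -> weak_solution f Omega lam phi s z2 u2 ->
  inH v -> (forall x, `|v x| <= `|u1 x| + `|u2 x|) ->
  (forall x, 0 <= (u1 x - u2 x) * v x) ->
  dirichlet (u1 \- u2) v <= z1 v - z2 v.
Proof.
move=> [V1 w1] [V2 w2] hv vu vs.
have vu' x : `|v x| <= `|u2 x| + `|u1 x| by rewrite addrC.
have [Vv i1] := V0_dominated V1 V2 hv vu.
have [_ i2] := V0_dominated V2 V1 hv vu'.
have e1 : dirichlet u1 v + Lint Omega (fun x => f x (u1 x) * v x) = z1 v := w1 v Vv.
have e2 : dirichlet u2 v + Lint Omega (fun x => f x (u2 x) * v x) = z2 v := w2 v Vv.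
rewrite (dirichlet_subl oO eb (proj1 V1) (proj1 V2) hv).
move: e1 e2; move: (z1 v) (z2 v) => y1 y2 <- <-; apply: sub_arith.
rewrite /Lint -RintegralB//; apply: ae_Rintegral_ge0 => //.
  have := integrableB mO i1 i2.
  by apply: eq_integrable => // x _.
have [K _ hK] := nonlinear_bounds; move: hK; apply: ae_sub => x h Ox.
have [_ _ h3] := h Ox _ _ _ (vu x).
by rewrite -mulrBl; exact: h3.
Qed.

End nonlinearity.

(** * Duality estimate *)

Section dual.
Context {R : realType} {N : nat}.
Local Notation E := 'rV[R]_N.
Variables (Omega : set E) (a : 'I_N -> 'I_N -> E -> R) (lam : nat -> R)
  (phi : nat -> E -> R) (s : R).
Hypotheses (oO : open Omega) (eb : eigenbasis Omega a lam phi) (s01 : 0 < s < 1).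
Local Notation inH := (Hspace Omega lam phi s).
Local Notation dirichlet := (dirichlet Omega lam phi s).
Local Notation Hn := (Hnorm Omega lam phi s).
Local Notation Hdual := (Hdual Omega lam phi s).
Local Notation Hdn := (Hdualnorm Omega lam phi s).

Let mO := measurable_Omega oO.

Lemma Hnorm_ge0 u : 0 <= Hn u.
Proof. exact: sqrtr_ge0. Qed.

Lemma HspaceZ c u : inH u -> inH (fun x => c * u x) /\ Hn (fun x => c * u x) = `|c| * Hn u.
Proof.
move=> hu; have [hv Dv] := Hspace_lin oO eb c 0 hu hu.
have E1 : (fun x => c * u x + 0 * u x) = (fun x => c * u x).
  by apply/funext => x; rewrite mul0r addr0.
move: hv Dv; rewrite E1 => hv Dv; split; first exact: hv.
have Dvv : dirichlet (fun x => c * u x) (fun x => c * u x) = c ^+ 2 * dirichlet u u.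
  rewrite (Dv _ hv) mul0r addr0 (dirichletC Omega lam phi s u) (Dv _ hu).
  by rewrite mul0r addr0 mulrA expr2.
apply/eqP; rewrite -(eqrXn2 (n := 2)) ?mulr_ge0 ?Hnorm_ge0//.
apply/eqP; rewrite (Hnorm_sqr oO eb hv) Dvv exprMn (Hnorm_sqr oO eb hu).
by rewrite (real_normK (num_real c)).
Qed.

Lemma Hspace0 u : inH u -> inH (fun=> 0).
Proof.
by move=> /(HspaceZ 0)[+ _]; congr inH; apply/funext => x; rewrite mul0r.
Qed.

Lemma HdualZ z c u : Hdual z -> inH u -> z (fun x => c * u x) = c * z u.
Proof.
move=> [lz _] hu; have h0 := Hspace0 hu.
have z0 : z (fun=> 0) = 0.
  have := lz 1 _ _ h0 h0; have -> : (fun x : E => 1 * 0 + 0 : R) = (fun=> 0).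
    by apply/funext => x; rewrite mul1r addr0.
  rewrite mul1r => h; apply: (@addrI _ (z (fun=> 0))).
  by rewrite addr0 -h.
have := lz c _ _ hu h0; have -> : (fun x => c * u x + 0) = (fun x => c * u x).
  by apply/funext => x; rewrite addr0.
by rewrite z0 addr0.
Qed.

Let unit_values (z : (E -> R) -> R) := [set `|z v| | v in [set v | inH v /\ Hn v <= 1]].

Let unit_ub z : Hdual z -> has_ubound (unit_values z).
Proof.
move=> [_ [M hM]]; exists `|M| => _ [v [hv v1] <-]; apply: (le_trans (hM v hv)).
apply: le_trans (ler_norm _) _; rewrite normrM (ger0_norm (Hnorm_ge0 v)).
by rewrite ler_piMr.
Qed.

Lemma Hdual_bound z u : Hdual z -> inH u -> `|z u| <= Hdn z * Hn u.
Proof.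
move=> hz hu; have [n0|n0] := eqVneq (Hn u) 0.
  by have [_ [M hM]] := hz; have := hM u hu; rewrite n0 !mulr0.
have {}n0 : 0 < Hn u by rewrite lt_neqAle eq_sym n0 Hnorm_ge0.
have [hv nv] := HspaceZ (Hn u)^-1 hu.
have vn : unit_values z `|z (fun x => (Hn u)^-1 * u x)|.
  exists (fun x => (Hn u)^-1 * u x) => //; split => //.
  by rewrite nv ger0_norm ?invr_ge0 ?(ltW n0)// mulVf ?gt_eqF.
have := ub_le_sup (unit_ub hz) vn.
rewrite (HdualZ _ hz hu) normrM ger0_norm ?invr_ge0 ?(ltW n0)// => h.
by rewrite -ler_pdivrMr// mulrC.
Qed.

Lemma Hdualnorm_ge0 z u : Hdual z -> inH u -> 0 <= Hdn z.
Proof.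
move=> hz hu; apply: le_trans (ub_le_sup (unit_ub hz) (_ : unit_values z `|z (fun=> 0)|)).
  exact: normr_ge0.
have [hv nv] := HspaceZ 0 hu.
exists (fun=> 0); last by [].
split; first exact: (Hspace0 hu).
have -> : (fun _ : E => 0 : R) = (fun x => 0 * u x) by apply/funext => x; rewrite mul0r.
by rewrite nv normr0 mul0r.
Qed.

Lemma Hdual_sub z1 z2 : Hdual z1 -> Hdual z2 -> Hdual (z1 \- z2).
Proof.
move=> [l1 [M1 h1]] [l2 [M2 h2]]; split.
  move=> c v w hv hw /=; move: (l1 c v w hv hw) (l2 c v w hv hw).
  move: (z1 _) (z2 _) (z1 v) (z2 v) (z1 w) (z2 w) => x1 x2 x3 x4 x5 x6 -> ->; ring.
exists (M1 + M2) => v hv /=; rewrite mulrDl.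
by apply: le_trans (ler_normB _ _) _; apply: lerD; [exact: h1|exact: h2].
Qed.

Lemma Lpnorm2_le_Hnorm u : inH u ->
  (Lpnorm Omega 2%:E u <= ((Num.sqrt (lam 0%N `^ s))^-1 * Hn u)%:E)%E.
Proof.
move=> hu; have su := Hspace_sqint oO hu; rewrite /Lpnorm (sqint_Lnorm2 mO su) lee_fin.
have l0 : 0 < lam 0%N `^ s by rewrite powR_gt0//; exact: (eigenbasis_gt0 eb).
have q0 : 0 < Num.sqrt (lam 0%N `^ s) by rewrite sqrtr_gt0.
rewrite ler_pdivlMl// -sqrtrM ?(ltW l0)//.
have -> : Hn u = Num.sqrt (dirichlet u u).
  by rewrite -(Hnorm_sqr oO eb hu) sqrtr_sqr ger0_norm// Hnorm_ge0.
by rewrite ler_wsqrtr//; exact: (poincare oO eb s01 hu).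
Qed.

End dual.

Lemma weak_solution_Hnorm {R : realType} {N : nat} (Omega : set 'rV[R]_N)
    (a : 'I_N -> 'I_N -> 'rV[R]_N -> R) (lam : nat -> R) (phi : nat -> 'rV[R]_N -> R)
    (s : R) f z1 z2 u1 u2 : open Omega -> bounded_set Omega ->
  elliptic_coefficients Omega a -> eigenbasis Omega a lam phi -> 0 < s < 1 ->
  assumptionA f Omega ->
  weak_solution f Omega lam phi s z1 u1 -> weak_solution f Omega lam phi s z2 u2 ->
  Hspace Omega lam phi s (u1 \- u2) /\
  Hnorm Omega lam phi s (u1 \- u2) ^+ 2 <= z1 (u1 \- u2) - z2 (u1 \- u2).
Proof.
move=> oO bO ella eb s01 fA w1 w2.
have h1 : Hspace Omega lam phi s u1 by case: w1 => -[].
have h2 : Hspace Omega lam phi s u2 by case: w2 => -[].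
have hw := Hspace_sub oO eb h1 h2; split; first exact: hw.
rewrite (Hnorm_sqr oO eb hw); apply: (weak_solution_sub oO eb fA w1 w2 hw).
  by move=> x; exact: ler_normB.
by move=> x; rewrite -expr2 sqr_ge0.
Qed.

Lemma weak_solution_dual_estimate {R : realType} {N : nat} (Omega : set 'rV[R]_N)
    (a : 'I_N -> 'I_N -> 'rV[R]_N -> R) (lam : nat -> R) (phi : nat -> 'rV[R]_N -> R)
    (s : R) f z1 z2 u1 u2 : open Omega -> bounded_set Omega ->
  elliptic_coefficients Omega a -> eigenbasis Omega a lam phi -> 0 < s < 1 ->
  assumptionA f Omega -> Hdual Omega lam phi s z1 -> Hdual Omega lam phi s z2 ->
  weak_solution f Omega lam phi s z1 u1 -> weak_solution f Omega lam phi s z2 u2 ->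
  Hnorm Omega lam phi s (u1 \- u2) <= Hdualnorm Omega lam phi s (z1 \- z2).
Proof.
move=> oO bO ella eb s01 fA d1 d2 w1 w2.
have [hw] := weak_solution_Hnorm oO bO ella eb s01 fA w1 w2.
have dz := Hdual_sub d1 d2; have := Hdual_bound oO eb dz hw.
have dn := Hdualnorm_ge0 oO eb dz hw; have n0 := Hnorm_ge0 Omega lam phi s (u1 \- u2).
rewrite [(z1 \- z2) _]/=; move: dn n0.
move: (Hdualnorm _ _ _ _ _) (Hnorm _ _ _ _ _) (z1 _ - z2 _) => d n z d0 n0 h1 h2.
rewrite leNgt; apply/negP => dn.
have h3 : n ^+ 2 <= d * n by apply: le_trans h2 (le_trans (ler_norm _) h1).
have n_gt0 : 0 < n by apply: le_lt_trans dn.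
by move: h3; rewrite expr2 ler_pM2r// leNgt dn.
Qed.

(** * Maximum estimate *)

(* Along the levels k_n = d (1 - 2^-n) the hypothesis gives al (k_n) <= V r^n
   with r ^ (beta - 1) = 1/4. *)
Lemma stampacchia {R : realType} (al : R -> R) (B V beta d : R) :
  0 <= B -> 0 < V -> 1 < beta -> 0 < d -> (forall k, 0 <= al k) ->
  (forall k h, k <= h -> al h <= al k) -> al 0 <= V ->
  (forall h k, 0 <= k -> k < h -> (h - k) ^+ 2 * al h <= B * al k `^ beta) ->
  4 * B * V `^ (beta - 1) <= 4 `^ (- (beta - 1)^-1) * d ^+ 2 ->
  al d = 0.
Proof.
move=> B0 V0 b1 d0 al0 alh alV step; set r := 4 `^ _ => small.
have bb : 0 < beta - 1 by rewrite subr_gt0.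
have r0 : 0 < r by rewrite powR_gt0.
have rb : r `^ (beta - 1) = 4^-1.
  by rewrite /r -powRrM mulNr mulVf ?gt_eqF// powR_inv1.
have r1 : r < 1.
  rewrite /r powRN invf_lt1 ?powR_gt0// -[ltLHS](pow1R (beta - 1)^-1).
  by apply: gt0_ltr_powR; rewrite ?invr_gt0 ?nnegrE// ltr1n.
have D0 : 0 < d ^+ 2 by rewrite exprn_gt0.
pose q : R := 4^-1; have q0 : 0 < q by rewrite invr_gt0.
have BV : B * V `^ (beta - 1) <= q * r * d ^+ 2.
  by rewrite -mulrA ler_pdivlMl// mulrA.
pose k n := d * (1 - 2^-1 ^+ n).
have claim n : al (k n) <= V * r ^+ n.
  elim: n => [|n IH]; first by rewrite /k expr0 subrr mulr0 mulr1.
  have p0 : 0 < 2^-1 ^+ n :> R by rewrite exprn_gt0.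
  have p1 : 2^-1 ^+ n <= 1 :> R by rewrite exprn_ile1// invf_le1// ler1n.
  have k0 : 0 <= k n by rewrite /k mulr_ge0 ?(ltW d0)// subr_ge0.
  have kk : k n.+1 - k n = d * (2^-1 ^+ n.+1) by rewrite /k exprS; field.
  have kS : k n < k n.+1 by rewrite -subr_gt0 kk mulr_gt0// exprn_gt0.
  have Vr : 0 < V * r ^+ n by rewrite mulr_gt0// exprn_gt0.
  have := step _ _ k0 kS; rewrite kk exprMn.
  have -> : (2^-1 ^+ n.+1) ^+ 2 = q ^+ n.+1 :> R.
    rewrite exprAC /q; congr (_ ^+ _); rewrite expr2 -invfM; congr (_^-1); ring.
  move=> h1; have Dq : 0 < d ^+ 2 * q ^+ n.+1 by rewrite mulr_gt0// exprn_gt0.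
  rewrite -(ler_pM2l Dq); apply: (le_trans h1).
  apply: (@le_trans _ _ (B * (V * r ^+ n) `^ beta)).
    apply: ler_wpM2l => //; apply: ge0_ler_powR; rewrite ?nnegrE ?(ltW Vr)//.
    by rewrite ltW// (lt_trans _ b1).
  (* One factor [V r^n] is kept; the power [beta - 1] of the [r^n] in the rest is [4^-n], which
     matches the squared gap [d^2 4^-(n+1)] between consecutive levels. *)
  have -> : (V * r ^+ n) `^ beta = V * r ^+ n * (V `^ (beta - 1) * q ^+ n).
    have -> : (V * r ^+ n) `^ beta = (V * r ^+ n) `^ 1 * (V * r ^+ n) `^ (beta - 1).
      by rewrite -powRD ?(gt_eqF Vr) ?implybT// addrC subrK.
    rewrite powRr1 ?(ltW Vr)//; congr (_ * _).
    rewrite powRM ?(ltW V0) ?exprn_ge0 ?(ltW r0)//; congr (_ * _).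
    by rewrite -(powR_mulrn n (ltW r0)) -powRrM mulrC powRrM rb powR_mulrn ?(ltW q0).
  have -> : d ^+ 2 * q ^+ n.+1 * (V * r ^+ n.+1) = (q * r * d ^+ 2) * (q ^+ n * (V * r ^+ n)).
    by rewrite !exprS; ring.
  have -> : B * (V * r ^+ n * (V `^ (beta - 1) * q ^+ n)) =
      (B * V `^ (beta - 1)) * (q ^+ n * (V * r ^+ n)) by ring.
  by rewrite ler_wpM2r// mulr_ge0 ?exprn_ge0 ?(ltW q0) ?(ltW Vr).
apply/le_anti; rewrite al0 andbT.
have lim0 : V * r ^+ n @[n --> \oo] --> (0 : R).
  rewrite -[X in _ --> X](mulr0 V); apply: cvgM; first exact: cvg_cst.
  by apply: cvg_expr; rewrite ger0_norm ?(ltW r0).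
apply: (cvgr_to_ge lim0); apply: nearW => n; apply: le_trans (claim n); apply: alh.
by rewrite /k ler_piMr ?(ltW d0)// gerBl exprn_ge0// invr_ge0.
Qed.

(** * Hoelder's inequality on a set and the exponent of the iteration *)

Section holder_set.
Context d (T : measurableType d) (R : realType).
Variables (mu : {measure set T -> \bar R}) (D : set T) (mD : measurable D).
Local Notation norm p u := ('N[mu]_p[EFin \o (u \_ D)])%E.

(** The reciprocal [1 - 1/p] of the conjugate exponent, a real number even for [p = 1]. Under
    [1 <= p] the last branch is [p = +oo]. *)
Definition dual_exponent (p : \bar R) : R := if p is r%:E then 1 - r^-1 else 1.

(** Hoelder against the indicator of [A], whose conjugate norm is a power of the measure. The
    endpoints [p = 1] and [p = +oo] are monotonicity and the almost everywhere bound. *)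
Lemma integral_le_Lnorm (p : \bar R) (z : T -> R) (A : set T) : (1 <= p)%E ->
  measurable_fun D z -> (norm p z < +oo)%E -> measurable A -> A `<=` D -> (mu A < +oo)%E ->
  (\int[mu]_(x in A) `|z x|%:E <= (fine (norm p z) * fine (mu A) `^ dual_exponent p)%:E)%E.
Proof.
move=> p1 mz fz mA AD fA; set Z := fine (norm p z).
have EZ : norm p z = Z%:E by rewrite fineK// ge0_fin_numE// Lnorm_ge0.
have EA : mu A = (fine (mu A))%:E by rewrite fineK// ge0_fin_numE.
have mzD : measurable_fun setT (z \_ D) by exact: (measurable_restrictT z mD).1.
have E1 : (\int[mu]_(x in A) `|z x|%:E = \int[mu]_x `|(z \_ D) x * \1_A x|%:E)%E.
  rewrite integral_mkcond; apply: eq_integral => x _; rewrite !patchE indicE.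
  case: (boolP (x \in A)) => [xA|_]; last by rewrite mulr0 normr0.
  by rewrite mulr1 mem_set//; exact/AD/set_mem.
case: p p1 fz Z EZ => [r| |] // r1 fz Z EZ.
- move: r1; rewrite lee_fin le_eqVlt => /predU1P[r1|r1].
    rewrite /dual_exponent -r1 invr1 subrr powRr0 mulr1 -EZ -r1 Lnorm1 E1.
    apply: ge0_le_integral => //.
    + by apply/measurable_EFinP/measurableT_comp => //; apply: measurable_funM => //; exact: measurable_indic.
    + by apply/measurableT_comp => //; exact/measurable_EFinP.
    + move=> x _ /=; rewrite lee_fin normrM indicE; case: (x \in A); rewrite ?normr1 ?mulr1//.
      by rewrite normr0 mulr0.
  have r0 : 0 < r by apply: lt_trans r1.
  have q0 : 0 < 1 - r^-1 by rewrite subr_gt0 invf_lt1.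
  have mI : measurable_fun setT (\1_A : T -> R) by exact: measurable_indic.
  have q0' : 0 < (1 - r^-1)^-1 by rewrite invr_gt0.
  have qq : r^-1 + ((1 - r^-1)^-1)^-1 = 1 by rewrite invrK addrC subrK.
  have := @hoelder _ _ _ mu (z \_ D) (\1_A) r (1 - r^-1)^-1 mzD mI r0 q0' qq.
  rewrite Lnorm1 EZ E1.
  have -> : ('N[mu]_((1 - r^-1)^-1)%:E[EFin \o \1_A])%E = (fine (mu A) `^ (1 - r^-1))%:E.
    rewrite unlock invrK -poweR_EFin -EA -[X in _ = (mu X `^ _)%E]setIT.
    rewrite -integral_indic//; congr (_ `^ _)%E; apply: eq_integral => x _ /=.
    rewrite indicE; case: (x \in A); first by rewrite normr1 powR1.
    by rewrite normr0 powR0// gt_eqF// invr_gt0.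
  by rewrite -EFinM.
- have Z1 : 0 <= Z by rewrite -lee_fin -EZ; exact: Lnorm_ge0.
  have Z2 : {ae mu, forall x, A x -> (`|z x|%:E <= Z%:E)%E}.
    have := Lnormoo_ae fz; rewrite EZ; apply: filterS => x h Ax.
    by rewrite lee_fin; apply: h; exact: AD.
  rewrite /dual_exponent powRr1 ?fine_ge0// EFinM -EA -integral_cst//.
  apply: ae_ge0_le_integral => //.
  by apply/measurable_EFinP/measurableT_comp => //; exact: measurable_funS mz.
Qed.

End holder_set.

(** The three regimes have one consequence, that [2s/N + 1 - 1/p] exceeds 1. This is the power to
    which the measures of level sets are raised in the iteration. *)
Lemma admissible_exponentP {R : realType} (N : nat) (s : R) (p : \bar R) :
  (0 < N)%N -> 0 < s -> admissible_exponent N s p ->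
  (1 <= p)%E /\ 1 < 2 * s / N%:R + dual_exponent p.
Proof.
move=> N0 s0 [h1 h2 h3]; have n0 : 0 < N%:R :> R by rewrite ltr0n.
have s2 : 0 < 2 * s by rewrite mulr_gt0.
have t0 : 0 < 2 * s / N%:R by rewrite divr_gt0.
case: (ltgtP (2 * s) N%:R) => [lt|gt|eq].
- have := h1 lt; have one : 1 < N%:R / (2 * s) by rewrite ltr_pdivlMr// mul1r.
  case: p {h1 h2 h3} => [r| |]//=; rewrite ?lte_fin ?lee_fin => rs.
    have r1 := lt_trans one rs; split; first exact: ltW.
    have : r^-1 < 2 * s / N%:R.
      have np : 0 < N%:R / (2 * s) by rewrite divr_gt0.
      have rp : 0 < r by apply: lt_trans r1.
      by rewrite -[ltRHS]invrK invf_div ltf_pV2.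
    by move: (r^-1) (_ / _) => *; lra.
  by split; [exact: leey|rewrite ltrDr].
- rewrite (h3 gt) /= invr1 subrr addr0; split => //.
  by rewrite ltr_pdivlMr// mul1r.
- have := h2 (esym eq); rewrite eq divff ?gt_eqF//.
  case: p {h1 h2 h3} => [r| |]//=; rewrite ?lte_fin ?lee_fin => r1.
    split; first exact: ltW.
    by rewrite ltrDl subr_gt0 invf_lt1// (lt_trans _ r1).
  by split; [exact: leey|rewrite ltrDl].
Qed.

Lemma truncation_facts {R : realType} (k t : R) : 0 <= k ->
  [/\ `|t - clamp k t| <= `|t|, 0 <= t * (t - clamp k t),
      `|t| <= k -> t - clamp k t = 0 & `|t| - k <= `|t - clamp k t|].
Proof.
move=> k0; have [[tk ->]|[/andP[t1 t2] ->]|[tk ->]] := clamp_cases t k0.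
- have t0 : t < 0 by apply: lt_le_trans tk _; rewrite oppr_le0.
  have tk0 : t - - k <= 0 by rewrite subr_le0 ltW.
  rewrite (ltr0_norm t0) (ler0_norm tk0); split; first by lra.
  + by rewrite mulr_le0// ltW.
  + by move=> h; lra.
  + by lra.
- rewrite subrr normr0 mulr0; split => //.
  by rewrite subr_le0 ler_norml t1 t2.
- have t0 : 0 < t by apply: le_lt_trans tk.
  have tk0 : 0 <= t - k by rewrite subr_ge0 ltW.
  rewrite (gtr0_norm t0) (ger0_norm tk0); split; first by lra.
  + by rewrite mulr_ge0// ltW.
  + by move=> h; lra.
  + by [].
Qed.

(** The iteration delivers [M <= d] for each positive threshold with [L M <= d^2]. If [L < M],
    taking for [d^2] the midpoint of [L M] and [M^2] gives a positive [d] below [M], a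
    contradiction. *)
Lemma le_of_sqr_step {R : realType} (M L : R) : 0 <= M -> 0 <= L ->
  (forall d, 0 < d -> L * M <= d ^+ 2 -> M <= d) -> M <= L.
Proof.
move=> M0 L0 h; rewrite leNgt; apply/negP => LM.
have M1 : 0 < M by apply: le_lt_trans LM.
pose e := (L * M + M ^+ 2) / 2.
have LMM : L * M < M ^+ 2 by rewrite expr2 ltr_pM2r.
have LM0 : 0 <= L * M by rewrite mulr_ge0.
have e0 : 0 < e by rewrite divr_gt0// ltr_wpDl// exprn_gt0.
have e1 : L * M <= e by rewrite /e ler_pdivlMr//; lra.
have e2 : e < M ^+ 2 by rewrite /e ltr_pdivrMr//; lra.
have := h (Num.sqrt e); rewrite sqrtr_gt0 sqr_sqrtr ?(ltW e0)// => /(_ e0 e1).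
rewrite -(ler_pXn2r (n := 2)) ?nnegrE ?sqrtr_ge0// sqr_sqrtr ?(ltW e0)//.
by rewrite leNgt e2.
Qed.

Section max_estimate.
Context {R : realType} {N : nat}.
Local Notation E := 'rV[R]_N.
Local Notation L := (lebesgue_space R N).
Local Notation mu := (@lebesgue_n R N).
Variables (Omega : set E) (a : 'I_N -> 'I_N -> E -> R) (lam : nat -> R)
  (phi : nat -> E -> R) (s : R).
Hypotheses (oO : open Omega) (bO : bounded_set Omega)
  (ella : elliptic_coefficients Omega a) (eb : eigenbasis Omega a lam phi)
  (s01 : 0 < s < 1).
Local Notation sq := (sqint mu Omega).
Local Notation ip := (inner mu Omega).
Local Notation inH := (Hspace Omega lam phi s).
Local Notation dirichlet := (dirichlet Omega lam phi s).

Let mO := measurable_Omega oO.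

Definition level (w : E -> R) (k : R) : set L := Omega `&` [set x | k < `|w x|].

Lemma measurable_level (w : E -> R) k : measurable_fun (Omega : set L) (w : L -> R) ->
  measurable (level w k).
Proof.
move=> mw; have maw : measurable_fun (Omega : set L) (fun x : L => `|w x|).
  exact: measurableT_comp mw.
have := maw mO `]k, +oo[%classic (measurable_itv _); congr (measurable _).
by apply/seteqP; split => x [Ox]; rewrite /= in_itv/= andbT.
Qed.

Lemma level_lty (A : set L) : measurable A -> A `<=` Omega -> (mu A < +oo)%E.
Proof.
by move=> mA AO; apply: le_lt_trans (Omega_lty oO bO); apply: le_measure => //; rewrite inE.
Qed.

Lemma level_chebyshev w h k : sq w -> 0 <= k -> k < h ->
  (h - k) ^+ 2 * fine (mu (level w h)) <=
  ip (fun x => w x - clamp k (w x)) (fun x => w x - clamp k (w x)).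
Proof.
move=> sw k0 kh; have [mw _] := sw; have mA := measurable_level h mw.
have fA : (mu (level w h) < +oo)%E by apply: level_lty => // x [].
have swk : sq (fun x => w x - clamp k (w x)) := sqintB mO sw (sqint_clamp oO k0 sw).
have EA : mu (level w h) = (fine (mu (level w h)))%:E by rewrite fineK// ge0_fin_numE.
rewrite -lee_fin (inner_integral mO swk) EFinM -EA -integral_cst//.
rewrite integral_mkcond [leRHS]integral_mkcond; apply: le_nnintegral => x _.
  by rewrite patchE; case: ifP => // _; rewrite lee_fin sqr_ge0.
rewrite !patchE; case: ifPn => [|_]; last first.
  by case: ifP => // _; rewrite lee_fin sqr_ge0.
rewrite inE => -[Ox hx]; rewrite mem_set// lee_fin.
have [_ _ _ h4] := truncation_facts (w x) k0.
rewrite -[leRHS](real_normK (num_real _)) ler_pXn2r ?nnegrE ?subr_ge0 ?(ltW kh)//.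
by apply: le_trans h4; rewrite lerB// ltW.
Qed.

(** The bound [M] on [v] is pulled out, and Hoelder on [A] turns the remaining L^1 norm into a power
    of the measure of [A]. *)
Lemma data_bound (p : \bar R) (z1 z2 v : E -> R) (A : set L) (M : R) : (1 <= p)%E ->
  Lp Omega p z1 -> Lp Omega p z2 -> (Lpnorm Omega p (z1 \- z2)%R < +oo)%E -> 0 <= M ->
  measurable_fun (Omega : set L) (v : L -> R) -> measurable A -> A `<=` Omega ->
  {ae mu, forall x, Omega x -> `|v x| <= M} -> (forall x, Omega x -> ~ A x -> v x = 0) ->
  Lint Omega (fun x => z1 x * v x) - Lint Omega (fun x => z2 x * v x) <=
  M * (fine (Lpnorm Omega p (z1 \- z2)) * fine (mu A) `^ dual_exponent p).
Proof.
move=> p1 [mz1 fz1] [mz2 fz2] fz M0 mv mA AO vM v0.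
have fO := Omega_lty oO bO.
have int z : measurable_fun (Omega : set L) (z : L -> R) -> (Lpnorm Omega p z < +oo)%E ->
    mu.-integrable Omega (fun x => (z x * v x)%:E).
  move=> mz fz'; have iz : mu.-integrable Omega (fun x => (M * `|z x|)%:E).
    apply: EFin_integrableZ => //; apply/integrableP; split.
      by apply/measurable_EFinP; exact: measurableT_comp mz.
    apply: le_lt_trans (ltry (fine (Lpnorm Omega p z) * fine (mu Omega) `^ dual_exponent p)).
    apply: le_trans (integral_le_Lnorm mO p1 mz fz' mO (@subset_refl _ _) fO).
    by apply: le_nnintegral => x _ //=; rewrite lee_fin normr_id.
  apply: (ae_integrable_le mO _ _ iz); first exact: measurable_funM mz mv.
  by move: vM; apply: ae_sub => x h Ox; rewrite normrM mulrC ler_wpM2r//; exact: h.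
have mz : measurable_fun (Omega : set L) (z1 \- z2 : L -> R) by exact: measurable_funB.
have E0 : Lint Omega (fun x => z1 x * v x) - Lint Omega (fun x => z2 x * v x) =
    Lint Omega (fun x => (z1 \- z2) x * v x).
  have i1 := int _ mz1 fz1; have i2 := int _ mz2 fz2.
  rewrite /Lint -RintegralB//; apply: eq_Rintegral => x _; rewrite /=; ring.
rewrite {}E0; move: mz fz; move: (z1 \- z2) => z mz fz; have i3 := int _ mz fz.
pose g (x : L) : R := z x * v x.
apply: le_trans (ler_norm _) _; apply: le_trans (le_normr_Rintegral mO i3) _.
have fzA := level_lty mA AO.
have hA := integral_le_Lnorm mO p1 mz fz mA AO fzA.
have i3' := integrable_abse i3.
rewrite -lee_fin /Rintegral fineK; last exact: (integrable_fin_num mO i3').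
rewrite (EFinM M); apply: (@le_trans _ _ (M%:E * \int[mu]_(x in A) `|z x|%:E)%E); last first.
  by apply: lee_wpmul2l; [rewrite lee_fin|exact: hA].
have mzA : measurable_fun A (fun x : L => `|z x|%:E).
  by apply/measurable_EFinP; apply: measurableT_comp => //; exact: measurable_funS mz.
have mgA : measurable_fun A (fun x : L => `|g x|%:E).
  apply/measurable_EFinP; apply: measurableT_comp => //.
  by apply: measurable_funM; [exact: measurable_funS mz|exact: measurable_funS mv].
have -> : (\int[mu]_(x in Omega) `|g x|%:E = \int[mu]_(x in A) `|g x|%:E)%E.
  rewrite integral_mkcond [RHS]integral_mkcond; apply: eq_integral => x _.
  rewrite !patchE; case: (boolP (x \in A)) => [/set_mem Ax|/negP]; first by rewrite mem_set//; exact: AO.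
  rewrite inE => nAx; case: ifPn => // /set_mem Ox.
  by rewrite /g (v0 x Ox nAx) mulr0 normr0.
have mMz : measurable_fun A (fun x : L => (M%:E * `|z x|%:E)%E) by exact: measurable_funeM.
rewrite -ge0_integralZl_EFin; [|exact: mA|by move=> x _; rewrite lee_fin|exact: mzA|exact: M0].
apply: ae_ge0_le_integral; [exact: mA|by move=> x _; rewrite lee_fin|exact: mgA|
  by move=> x _; rewrite -EFinM lee_fin mulr_ge0|exact: mMz|].
move: vM; apply: ae_sub => x h Ax; rewrite -EFinM lee_fin normrM mulrC.
by rewrite ler_wpM2r//; exact: h (AO _ Ax).
Qed.

Lemma max_estimate (p : \bar R) : (0 < N)%N -> admissible_exponent N s p ->
  exists2 K : R, 0 < K & forall f, assumptionA f Omega ->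
  forall z1 z2 u1 u2 : E -> R, Lp Omega p z1 -> Lp Omega p z2 ->
  Linfty Omega u1 -> Linfty Omega u2 ->
  weak_solution f Omega lam phi s (fun v => Lint Omega (fun x => z1 x * v x)) u1 ->
  weak_solution f Omega lam phi s (fun v => Lint Omega (fun x => z2 x * v x)) u2 ->
  (Lpnorm Omega p (z1 \- z2)%R < +oo)%E ->
  (Lpnorm Omega +oo%E (u1 \- u2)%R <= (K * fine (Lpnorm Omega p (z1 \- z2)))%:E)%E.
Proof.
move=> N0 adm; have s0 : 0 < s by case/andP: s01.
have [p1 b1] := admissible_exponentP N0 s0 adm; set q := dual_exponent p in b1.
pose beta := 2 * s / N%:R + q.
have [C C0 hC] := faber_krahn oO bO ella eb s01 N0.
(* The [+ 1] keeps [V] positive, as [stampacchia] requires, even if [Omega] is empty. *)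
pose V := fine (mu Omega) + 1.
have V0 : 0 < V by rewrite ltr_wpDl// fine_ge0.
pose r : R := 4 `^ (- (beta - 1)^-1); have r0 : 0 < r by rewrite powR_gt0.
pose W := V `^ (beta - 1); have W0 : 0 < W by rewrite powR_gt0.
(* Chosen so that the smallness condition of [stampacchia] with [B = 2 C M Z] reads
   [K Z M <= d^2]. *)
pose K := 4 * (2 * C) * W / r.
have K0 : 0 < K by rewrite divr_gt0// !mulr_gt0.
exists K; first exact: K0.
move=> f fA z1 z2 u1 u2 Lz1 Lz2 [mu1 fu1] [mu2 fu2] w1 w2 fz.
set Z := fine (Lpnorm Omega p (z1 \- z2)).
have Z0 : 0 <= Z by apply: fine_ge0; exact: Lnorm_ge0.
have h1 : inH u1 by case: w1 => -[].
have h2 : inH u2 by case: w2 => -[].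
set w := u1 \- u2; have hw : inH w := Hspace_sub oO eb h1 h2.
have sw := Hspace_sqint oO hw; have [mw _] := sw.
(* The sup norm of [w] will stand on both sides of the final inequality, so its finiteness must be
   known beforehand. *)
have foo : (Lpnorm Omega +oo w < +oo)%E.
  apply: le_lt_trans (ltry (fine (Lpnorm Omega +oo u1) + fine (Lpnorm Omega +oo u2))).
  apply: ae_Lnormoo; first by apply: addr_ge0; apply: fine_ge0; exact: Lnorm_ge0.
  have := ae_and (Lnormoo_ae fu1) (Lnormoo_ae fu2); apply: ae_sub => x [b c] Ox.
  by apply: le_trans (ler_normB _ _) _; apply: lerD; [exact: b|exact: c].
set M := fine (Lpnorm Omega +oo w).
have M0 : 0 <= M by apply: fine_ge0; exact: Lnorm_ge0.
have EM : Lpnorm Omega +oo w = M%:E by rewrite fineK// ge0_fin_numE// Lnorm_ge0.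
have wM : {ae mu, forall x, Omega x -> `|w x| <= M} := Lnormoo_ae foo.
have sub k : level w k `<=` Omega by move=> x [].
have mA k := measurable_level k mw.
pose al k := fine (mu (level w k)).
have al0 k : 0 <= al k by exact: fine_ge0.
have fA' k : (mu (level w k) < +oo)%E := level_lty (mA k) (sub k).
pose wk k x := w x - clamp k (w x).
have energy k : 0 <= k -> dirichlet (wk k) (wk k) <= 2 * (M * (Z * al k `^ q)).
  move=> k0; have [hk D1] := dirichlet_truncation oO bO ella eb s01 k0 hw.
  apply: (le_trans D1); apply: ler_wpM2l => //.
  apply: le_trans (weak_solution_sub oO eb fA w1 w2 hk _ _) _.
  - move=> x; have [h _ _ _] := truncation_facts (w x) k0.
    by apply: (le_trans h); exact: ler_normB.
  - by move=> x; have [_ h _ _] := truncation_facts (w x) k0.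
  apply: (data_bound p1 Lz1 Lz2 fz M0 _ (mA k) (sub k)).
  - by case: (Hspace_sqint oO hk).
  - move: wM; apply: ae_sub => x h Ox; have [h' _ _ _] := truncation_facts (w x) k0.
    by apply: le_trans h' (h Ox).
  - move=> x Ox nA; have [_ _ h _] := truncation_facts (w x) k0; apply: h.
    by rewrite leNgt; apply/negP => kx; apply: nA.
(* Chebyshev at level [h], Faber-Krahn on the level set at [k], then the energy bound: the exponents
   [2s/N] and [q] add up to [beta]. *)
have step h k : 0 <= k -> k < h -> (h - k) ^+ 2 * al h <= 2 * C * (M * Z) * al k `^ beta.
  move=> k0 kh; apply: le_trans (level_chebyshev sw k0 kh) _.
  have [hk _] := dirichlet_truncation oO bO ella eb s01 k0 hw.
  have FK : ip (wk k) (wk k) <= C * al k `^ (2 * s / N%:R) * dirichlet (wk k) (wk k).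
    apply: (hC (wk k) (level w k) hk (mA k) (sub k)).
    move=> x Ox nA; have [_ _ h' _] := truncation_facts (w x) k0; apply: h'.
    by rewrite leNgt; apply/negP => kx; apply: nA.
  apply: (le_trans FK).
  apply: (@le_trans _ _ (C * al k `^ (2 * s / N%:R) * (2 * (M * (Z * al k `^ q))))).
    by apply: ler_wpM2l; [rewrite mulr_ge0 ?powR_ge0// ltW|exact: energy].
  rewrite /beta powRD; last by rewrite gt_eqF// (lt_trans _ b1).
  by rewrite le_eqVlt; apply/orP; left; apply/eqP; ring.
have conclusion d : 0 < d -> K * Z * M <= d ^+ 2 -> M <= d.
  move=> d0 hd; have ald : al d = 0.
    apply: (@stampacchia R al (2 * C * (M * Z)) V beta d) => //.
    - by rewrite mulr_ge0 ?mulr_ge0// ltW.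
    - move=> k h kh; apply: fine_le; rewrite ?ge0_fin_numE//.
      by apply: le_measure; rewrite ?inE// => x [Ox hx]; split => //; exact: le_lt_trans hx.
    - apply: (@le_trans _ _ (fine (mu Omega))); last by rewrite lerDl.
      apply: fine_le; rewrite ?ge0_fin_numE//; first exact: (Omega_lty oO bO).
      by apply: le_measure; rewrite ?inE.
    - rewrite -/W -/r; apply: le_trans (ler_wpM2l (ltW r0) hd).
      rewrite le_eqVlt; apply/orP; left; apply/eqP; rewrite /K.
      by field; rewrite gt_eqF.
  rewrite -lee_fin -EM; apply: ae_Lnormoo; first exact: ltW.
  exists (level w d); split; first exact: mA.
    have EA : mu (level w d) = (al d)%:E.
      by rewrite /al fineK// ge0_fin_numE//; exact: fA'.
    by exact: (etrans EA (congr1 EFin ald)).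
  move=> x /= nx; apply: contrapT => nA; apply: nx => Ox.
  by rewrite leNgt; apply/negP => dx; apply: nA.
rewrite EM lee_fin; apply: le_of_sqr_step => //.
by rewrite mulr_ge0// ltW.
Qed.

End max_estimate.

Theorem lemma4p2 (R : realType) (N : nat) (s : R) (Omega : set 'rV[R]_N)
    (a : 'I_N -> 'I_N -> 'rV[R]_N -> R)
    (lam : nat -> R) (phi : nat -> 'rV[R]_N -> R) :
  (1 <= N)%N -> 0 < s < 1 ->
  open Omega -> bounded_set Omega ->
  elliptic_coefficients Omega a ->
  eigenbasis Omega a lam phi ->
  (exists2 C : R, 0 < C &
    forall f : 'rV[R]_N -> R -> R, assumptionA f Omega ->
    forall (z1 z2 : ('rV[R]_N -> R) -> R) (u1 u2 : 'rV[R]_N -> R),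
      Hdual Omega lam phi s z1 -> Hdual Omega lam phi s z2 ->
      weak_solution f Omega lam phi s z1 u1 ->
      weak_solution f Omega lam phi s z2 u2 ->
      (Lpnorm Omega 2%:E (u1 \- u2)%R <=
        (C * Hnorm Omega lam phi s (u1 \- u2)%R)%:E)%E /\
      C * Hnorm Omega lam phi s (u1 \- u2) <=
        C * Hdualnorm Omega lam phi s (z1 \- z2)) /\
  (forall p : \bar R, admissible_exponent N s p ->
    exists2 C : R, 0 < C &
    forall f : 'rV[R]_N -> R -> R, assumptionA f Omega -> growth f Omega ->
    forall z1 z2 u1 u2 : 'rV[R]_N -> R,
      Lp Omega p z1 -> Lp Omega p z2 ->
      Linfty Omega u1 -> Linfty Omega u2 ->
      weak_solution f Omega lam phi s
        (fun v => Lint Omega (fun x => z1 x * v x)) u1 ->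
      weak_solution f Omega lam phi s
        (fun v => Lint Omega (fun x => z2 x * v x)) u2 ->
      (Lpnorm Omega +oo%E (u1 \- u2)%R +
        (Hnorm Omega lam phi s (u1 \- u2)%R)%:E <=
        C%:E * Lpnorm Omega p (z1 \- z2)%R)%E).
Proof.
move=> N0 s01 oO bO ella eb; have s0 : 0 < s by case/andP: s01.
have mO := measurable_Omega oO; split.
  have l0 : 0 < Num.sqrt (lam 0%N `^ s).
    by rewrite sqrtr_gt0 powR_gt0//; exact: (eigenbasis_gt0 eb).
  (* The Poincare constant, in terms of the smallest eigenvalue. *)
  exists (Num.sqrt (lam 0%N `^ s))^-1; first by rewrite invr_gt0.
  move=> f fA z1 z2 u1 u2 d1 d2 w1 w2.
  have [hw _] := weak_solution_Hnorm oO bO ella eb s01 fA w1 w2.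
  split; first exact: (Lpnorm2_le_Hnorm oO eb s01 hw).
  apply: ler_wpM2l; first by rewrite invr_ge0 ltW.
  exact: (weak_solution_dual_estimate oO bO ella eb s01 fA d1 d2 w1 w2).
move=> p adm; have [p1 _] := admissible_exponentP N0 s0 adm.
have [K K0 hK] := max_estimate oO bO ella eb s01 N0 adm.
pose V := fine (@lebesgue_n R N Omega) `^ dual_exponent p.
have V0 : 0 <= V by exact: powR_ge0.
have KV0 : 0 <= K * V by rewrite mulr_ge0// ltW.
(* The squared fractional norm of [w] is at most its pairing with [z1 - z2]. The sup bound [K Z] and
   Hoelder on all of [Omega] make this at most [K V Z^2]. *)
pose H := Num.sqrt (K * V); have H0 : 0 <= H by exact: sqrtr_ge0.
exists (K + H); first by rewrite ltr_wpDr.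
move=> f fA _ z1 z2 u1 u2 Lz1 Lz2 Lu1 Lu2 w1 w2.
(* An infinite norm of [z1 - z2] makes the right side infinite, since the constant is positive. *)
have [fz|] := ltP (Lpnorm Omega p (z1 \- z2)) +oo%E; last first.
  by rewrite leye_eq => /eqP ->; rewrite gt0_muley ?lte_fin ?ltr_wpDr// leey.
have max := hK f fA z1 z2 u1 u2 Lz1 Lz2 Lu1 Lu2 w1 w2 fz.
have Zge : (0 <= Lpnorm Omega p (z1 \- z2)%R)%E by exact: Lnorm_ge0.
have EZ : Lpnorm Omega p (z1 \- z2) = (fine (Lpnorm Omega p (z1 \- z2)))%:E.
  by rewrite fineK// ge0_fin_numE.
move: max EZ (fine_ge0 Zge) (@data_bound _ _ Omega oO bO p z1 z2 (u1 \- u2) Omega).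
set Z := fine _ => max EZ Z0 data; rewrite EZ.
have KZ0 : 0 <= K * Z by rewrite mulr_ge0// ltW.
have [hw energy] := weak_solution_Hnorm oO bO ella eb s01 fA w1 w2.
have Hw : Hnorm Omega lam phi s (u1 \- u2) <= H * Z.
  rewrite -(ler_pXn2r (n := 2)) ?nnegrE ?Hnorm_ge0 ?mulr_ge0//.
  apply: (le_trans energy); apply: (@le_trans _ _ (K * Z * (Z * V))).
    apply: (data (K * Z)) => //; first by case: (Hspace_sqint oO hw).
    have foo := le_lt_trans max (ltry _).
    move: (Lnormoo_ae foo); apply: ae_sub => x h Ox; apply: (le_trans (h Ox)).
    rewrite -lee_fin fineK; first exact: max.
    by rewrite ge0_fin_numE//; exact: Lnorm_ge0.
  rewrite exprMn sqr_sqrtr// le_eqVlt; apply/orP; left; apply/eqP; ring.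
rewrite -EFinM mulrDl EFinD; apply: leeD; first exact: max.
by rewrite lee_fin.
Qed.
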